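(* Let $\psi_0\in\mathcal{S}(\mathbb{R}^D)$ with $\|\psi_0\|_{L^2}=1$, and let $\hat A\neq0$ be one of the operators $\mathrm{Id}$, $\hat q_j^n$, $\hat p_j^n$, $T$, $V$, $\hat H$ ($n\in\mathbb{N}$, $j\in\{1,\dots,D\}$). Among all probability densities $\rho>0$ on $\mathbb{R}^{4D}$, the optimal sampling density that minimizes the variance $\mathbb{V}_0[\hat A,\psi_0,\rho]$ at the initial time $t=0$ is $$\rho_{\rm opt}(w)=\frac{1}{\kappa_{\rm opt}}|f_0(w)\,O_0[\hat A](w)|,\qquad \kappa_{\rm opt}=\int_{\mathbb{R}^{4D}}|f_0(\xi)\,O_0[\hat A](\xi)|\,d\xi,$$ where $\kappa_{\rm opt}$ ensures the normalization. At the initial time the variance satisfies $$\mathbb{V}_0[\hat A,\psi_0,\rho_{\rm opt}]=\kappa_{\rm opt}^2-|\langle\hat A\rangle_0|^2.$$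
   Context: Fix a dimension $D\ge 1$, a semiclassical parameter $\epsilon>0$ (thought of as $0<\epsilon\ll 1$), a real symmetric positive-definite matrix $\Gamma\in\mathbb{R}^{D\times D}$, and a smooth potential $V:\mathbb{R}^D\to\mathbb{R}$ that is sub-quadratic, meaning that all partial derivatives of $V$ of order at least $2$ are bounded. $\langle\cdot,\cdot\rangle$ is the $L^2(\mathbb{R}^D)$ inner product $\langle\phi,\psi\rangle=\int\overline{\phi}\,\psi\,dx$. Densities written $\rho>0$ are allowed to vanish on Lebesgue null sets. Operators: $\hat q_j$ is multiplication by $x_j$, $\hat p_j=-i\epsilon\partial_{x_j}$, $T=-\frac{\epsilon^2}{2}\Delta$, $V$ also denotes multiplication by $V(x)$, and $\hat H=T+V$. Gaussians: for $z=(q,p)\in\mathbb{R}^{2D}$, $$g_z(x)=\left(\frac{\det\Gamma}{\pi^D\epsilon^D}\right)^{1/4}\exp\left(-\frac{1}{2\epsilon}(x-q)^T\Gamma(x-q)+\frac{i}{\epsilon}p^T(x-q)\right).$$ For $w=(y,z)\in\mathbb{R}^{4D}$ with $y,z\in\mathbb{R}^{2D}$, define $$f_0(y,z)=(2\pi\epsilon)^{-2D}\langle\psi_0,g_y\rangle\langle g_z,\psi_0\rangle,\qquad O_0[\hat A](y,z)=\langle g_y,\hat A g_z\rangle,$$ and $\langle\hat A\rangle_0=\int_{\mathbb{R}^{4D}}f_0(w)O_0[\hat A](w)\,dw$. (In the time-dependent theory the integrand carries an additional factor $\Phi_t$, which satisfies $\Phi_0=1$.) For a probability density $\rho>0$ on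 $\mathbb{R}^{4D}$, the variance of the Monte Carlo integrand at time $0$ is $$\mathbb{V}_0[\hat A,\psi_0,\rho]=\int_{\mathbb{R}^{4D}}\left|\frac{f_0(w)O_0[\hat A](w)}{\rho(w)}-\langle\hat A\rangle_0\right|^2\rho(w)\,dw=\int_{\mathbb{R}^{4D}}\frac{|f_0(w)O_0[\hat A](w)|^2}{\rho(w)}\,dw-|\langle\hat A\rangle_0|^2$$ (possibly $+\infty$). *)

(* Defs.v *)
From HB Require Import structures.
From mathcomp Require Import all_boot all_order all_algebra.
From mathcomp Require Import all_classical all_reals all_analysis.
From mathcomp Require Import complex.

Set Implicit Arguments.
Unset Strict Implicit.
Unset Printing Implicit Defensive.

Import Order.TTheory GRing.Theory Num.Theory.
Import numFieldNormedType.Exports.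

Local Open Scope classical_set_scope.
Local Open Scope ring_scope.
Local Open Scope complex_scope.

(* R^n is the type 'rV[R]_n of row vectors, equipped with the sigma-algebra
   generated by the coordinate maps, i.e. the Borel sigma-algebra. *)
Definition measure_rV_display : measure_display.
Proof. exact: default_measure_display. Qed.

Section measurable_rV.
Variables (R : realType) (n : nat).

Let coord (i : 'I_n) (x : 'rV[R]_n) : measurableTypeR R := x ord0 i.

Let rV_set0 : g_sigma_preimage coord set0.
Proof. exact: sigma_algebra0. Qed.

Let rV_setC A : g_sigma_preimage coord A -> g_sigma_preimage coord (~` A).
Proof. exact: sigma_algebraC. Qed.

Let rV_bigcup (F : (set 'rV[R]_n)^nat) :
  (forall i, g_sigma_preimage coord (F i)) ->
  g_sigma_preimage coord (\bigcup_i (F i)).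
Proof. exact: sigma_algebra_bigcup. Qed.

HB.instance Definition _ := @isMeasurable.Build measure_rV_display
  'rV[R]_n (g_sigma_preimage coord) rV_set0 rV_setC rV_bigcup.

End measurable_rV.


(* Restates a fact proved locally in lebesgue_integral_fubini: the instance
   declared there is shadowed by the one for products of subprobabilities. *)
Lemma product_sigma_finite d1 d2 (T1 : measurableType d1)
    (T2 : measurableType d2) (R : realType)
    (m1 : {sigma_finite_measure set T1 -> \bar R})
    (m2 : {sigma_finite_measure set T2 -> \bar R}) :
  sigma_finite setT (m1 \x m2)%E.
Proof.
have /sigma_finiteP[F [TF ndF Foo]] := sigma_finiteT m1.
have /sigma_finiteP[G [TG ndG Goo]] := sigma_finiteT m2.
exists (fun n => F n `*` G n).
  rewrite -setXTT TF TG predeqE => -[x y]; split.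
    move=> [/= [n _ Fnx] [k _ Gky]]; exists (maxn n k) => //; split.
    - by move: x Fnx; exact/subsetPset/ndF/leq_maxl.
    - by move: y Gky; exact/subsetPset/ndG/leq_maxr.
  by move=> [n _ []/= ? ?]; split; exists n.
move=> k; have [? ?] := Foo k; have [? ?] := Goo k.
split; first exact: measurableX.
by rewrite product_measure1E// lte_mul_pinfty// ge0_fin_numE.
Qed.

Lemma sigma_finite_measure_pack d (T : measurableType d) (R : realType)
    (mu : set T -> \bar R) :
  mu set0 = 0%E -> (forall A, 0 <= mu A)%E -> semi_sigma_additive mu ->
  sigma_finite setT mu ->
  exists m : {sigma_finite_measure set T -> \bar R}, m = mu :> (set T -> \bar R).
Proof.
move=> mu0 mu_ge0 mu_add mu_sf.
pose mmu := isMeasure.Build _ _ _ mu mu0 mu_ge0 mu_add.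
pose M : {measure set T -> \bar R} := HB.pack mu mmu.
pose smu := Measure_isSigmaFinite.Build _ _ _ M mu_sf.
pose S : {sigma_finite_measure set T -> \bar R} := HB.pack mu mmu smu.
by exists S.
Qed.

Section measurable_rV_theory.
Variable R : realType.

Lemma measurable_coord n (i : 'I_n) :
  measurable_fun [set: 'rV[R]_n] (fun x => x ord0 i).
Proof.
move=> _ Y mY; rewrite setTI; apply: sub_sigma_algebra => /=.
rewrite -bigcup_seq/=; exists i => /=; first by rewrite mem_index_enum.
by exists Y => //; rewrite setTI.
Qed.

Lemma measurable_fun_rVP d (T : measurableType d) n (f : T -> 'rV[R]_n) :
  measurable_fun [set: T] f <->
  forall i, measurable_fun [set: T] (fun t => f t ord0 i).
Proof.
split=> [mf i|mf].
  by apply: (measurableT_comp (measurable_coord i)).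
move=> _ Y mY; rewrite setTI.
suff : g_sigma_preimage (fun (i : 'I_n) (x : 'rV[R]_n) => x ord0 i) `<=`
    [set A | measurable (f @^-1` A)] by apply.
apply: smallest_sub.
  split => /=.
  - by rewrite preimage_set0.
  - by move=> A /= mA; rewrite setTD preimage_setC; exact: measurableC.
  - by move=> F mF /=; rewrite preimage_bigcup; exact: bigcup_measurable.
rewrite -bigcup_seq => A [i _ [B mB <-]] /=.
by rewrite setTI -[X in measurable X]setTI; exact: (mf i).
Qed.

Definition rV_cons n (p : measurableTypeR R * 'rV[R]_n) : 'rV[R]_n.+1 :=
  \row_i (if unlift ord0 i is Some j then p.2 ord0 j else p.1).

Lemma measurable_rV_cons n : measurable_fun setT (@rV_cons n).
Proof.
apply/measurable_fun_rVP => i; under eq_fun do rewrite mxE.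
case: unliftP => [j _|_]; last exact: measurable_fst.
exact: (measurableT_comp (measurable_coord j)).
Qed.

(* n-dimensional Lebesgue measure: the n-fold product of the one-dimensional
   one; see lebesgue_rV_box. *)
Fixpoint lebesgue_rV n : set 'rV[R]_n -> \bar R :=
  match n with
  | 0 => \d_(0 : 'rV[R]_0)
  | m.+1 => pushforward (lebesgue_measure \x @lebesgue_rV m)%E (@rV_cons m)
  end.

Let lebesgue_rV_spec n :
  exists m : {sigma_finite_measure set 'rV[R]_n -> \bar R},
    m = @lebesgue_rV n :> (set _ -> \bar R).
Proof.
elim: n => [|n [m mE]].
  by exists (\d_(0 : 'rV[R]_0)).
rewrite /= -mE.
pose P := pushforward (lebesgue_measure \x m)%E (@rV_cons n).
have P0 : P set0 = 0%E by rewrite /P /pushforward preimage_set0 measure0.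
have mpre A : measurable A -> measurable (@rV_cons n @^-1` A).
  by move=> mA; rewrite -[X in measurable X]setTI; exact: measurable_rV_cons.
have P_ge0 A : (0 <= P A)%E.
  exact: (measure_ge0 (lebesgue_measure \x m)%E).
have P_add : semi_sigma_additive P.
  move=> F mF tF mUF; rewrite /P /pushforward preimage_bigcup.
  apply: measure_semi_sigma_additive.
  - by move=> i; exact: mpre.
  - apply/trivIsetP => /= i j _ _ ij; rewrite -preimage_setI.
    by move/trivIsetP : tF => /(_ _ _ _ _ ij) ->//; rewrite preimage_set0.
  - by rewrite -preimage_bigcup; exact: mpre.
have P_sf : sigma_finite setT P.
  have [F FT Foo] := product_sigma_finite (@lebesgue_measure R) m.
  pose g (v : 'rV[R]_n.+1) : measurableTypeR R * 'rV[R]_n :=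
    (v ord0 ord0, \row_j v ord0 (lift ord0 j)).
  have gK : cancel (@rV_cons n) g.
    case=> x v; rewrite /g /rV_cons mxE unlift_none /=; congr pair.
    by apply/rowP => j; rewrite !mxE liftK.
  have mg : measurable_fun setT g.
    apply/measurable_fun_pairP; split; first exact: measurable_coord.
    apply/measurable_fun_rVP => i.
    rewrite [X in measurable_fun _ X](_ : _ =
      (fun v : 'rV[R]_n.+1 => v ord0 (lift ord0 i))).
      exact: measurable_coord.
    by apply/funext => v; rewrite /= mxE.
  exists (fun i => g @^-1` F i).
    by rewrite -preimage_bigcup -FT preimage_setT.
  move=> i; have [mFi Fioo] := Foo i; split.
    by rewrite -[X in measurable X]setTI; exact: mg.
  rewrite /P /pushforward -comp_preimage.
  by rewrite (_ : g \o _ = id) //; apply/funext => p /=; rewrite gK.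
exact: sigma_finite_measure_pack.
Qed.

Let lebesgue_rV0 n : @lebesgue_rV n set0 = 0%E.
Proof. by have [m <-] := lebesgue_rV_spec n; rewrite measure0. Qed.

Let lebesgue_rV_ge0 n A : (0 <= @lebesgue_rV n A)%E.
Proof. by have [m <-] := lebesgue_rV_spec n. Qed.

Let lebesgue_rV_semi_sigma_additive n : semi_sigma_additive (@lebesgue_rV n).
Proof.
by have [m <-] := lebesgue_rV_spec n; exact: measure_semi_sigma_additive.
Qed.

HB.instance Definition _ n := isMeasure.Build _ _ _ (@lebesgue_rV n)
  (@lebesgue_rV0 n) (@lebesgue_rV_ge0 n) (@lebesgue_rV_semi_sigma_additive n).

Let lebesgue_rV_sigma_finite n : sigma_finite setT (@lebesgue_rV n).
Proof. by have [m <-] := lebesgue_rV_spec n; exact: sigma_finiteT. Qed.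

HB.instance Definition _ n := Measure_isSigmaFinite.Build _ _ _
  (@lebesgue_rV n) (@lebesgue_rV_sigma_finite n).

Lemma lebesgue_rV_box n (E : 'I_n -> set (measurableTypeR R)) :
  (forall i, measurable (E i)) ->
  @lebesgue_rV n [set x | forall i, E i (x ord0 i)] =
  (\prod_(i < n) lebesgue_measure (E i))%E.
Proof.
elim: n E => [|n ih] E mE.
  rewrite big_ord0 /= diracE mem_set//.
  by case.
pose B := [set v : 'rV[R]_n | forall i, E (lift ord0 i) (v ord0 i)].
have mB : measurable B.
  have -> : B = \bigcap_(i in setT)
      (fun v : 'rV[R]_n => v ord0 i) @^-1` E (lift ord0 i).
    by apply/seteqP; split=> v /= vE i *; exact: (vE i).
  apply: fin_bigcap_measurable => // i _.
  rewrite -[X in measurable X]setTI; apply: (measurable_coord i) => //.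
  exact: mE.
rewrite big_ord_recl -(ih (fun i => E (lift ord0 i))) // -/B.
rewrite -product_measure1E//= /pushforward.
congr (product_measure1 _ _ _).
apply/seteqP; split => [[x v] xvE|[x v] [/= Ex Ev] i].
  split=> /= [|i].
    by have := xvE ord0; rewrite mxE unlift_none.
  by have := xvE (lift ord0 i); rewrite mxE liftK.
by rewrite mxE; case: unliftP => [j ->|->].
Qed.

End measurable_rV_theory.

Local Notation Re := (@complex.Re _).
Local Notation Im := (@complex.Im _).
Local Notation normc := (@Normc.normc _).

(* R^{2D} is represented by pairs (q, p) of vectors of R^D, and R^{4D} by pairs
   w = (y, z) of points of R^{2D}, with the product Lebesgue measures. *)
Section phase_space_measures.
Variables (R : realType) (D : nat).

Definition lebesgue_2D : set ('rV[R]_D * 'rV[R]_D) -> \bar R :=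
  (@lebesgue_rV R D \x @lebesgue_rV R D)%E.

HB.instance Definition _ := Measure.on lebesgue_2D.
HB.instance Definition _ := Measure_isSigmaFinite.Build _ _ _ lebesgue_2D
  (product_sigma_finite (@lebesgue_rV R D) (@lebesgue_rV R D)).

Definition lebesgue_4D :
    set (('rV[R]_D * 'rV[R]_D) * ('rV[R]_D * 'rV[R]_D)) -> \bar R :=
  (lebesgue_2D \x lebesgue_2D)%E.

HB.instance Definition _ := Measure.on lebesgue_4D.
HB.instance Definition _ := Measure_isSigmaFinite.Build _ _ _ lebesgue_4D
  (product_sigma_finite lebesgue_2D lebesgue_2D).

End phase_space_measures.

Definition cintegral d (T : measurableType d) (R : realType)
    (mu : {measure set T -> \bar R}) (f : T -> R[i]) : R[i] :=
  (\int[mu]_x Re (f x))%R +i* (\int[mu]_x Im (f x))%R.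

Definition cexp (R : realType) (z : R[i]) : R[i] :=
  (expR (Re z))%:C * (cos (Im z) +i* sin (Im z)).

Section function_classes.
Variables (R : realType) (D : nat).
Implicit Types (f : 'rV[R]_D -> R) (phi psi : 'rV[R]_D -> R[i]).

Definition partial (j : 'I_D) f : 'rV[R]_D -> R := 'D_(delta_mx ord0 j) f.

(* partials [:: j1; ..; jk] f is d_{j1} (.. (d_{jk} f)). *)
Definition partials (s : seq 'I_D) f := foldr partial f s.

(* C^infinity: all iterated partial derivatives exist and are continuous. *)
Definition smooth f := forall s : seq 'I_D,
  continuous (partials s f) /\
  forall j x, derivable (partials s f) x (delta_mx ord0 j).

Definition subquadratic f := smooth f /\
  forall s : seq 'I_D, (2 <= size s)%N ->
    exists C : R, forall x, `|partials s f x| <= C.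

(* There is no normed R-module structure on R[i], so derivatives of
   complex-valued functions are taken componentwise. *)
Definition cpartial (j : 'I_D) psi : 'rV[R]_D -> R[i] := fun x =>
  partial j (fun y => Re (psi y)) x +i* partial j (fun y => Im (psi y)) x.

Definition cpartials (s : seq 'I_D) psi := foldr cpartial psi s.

(* `|x| is the sup norm on 'rV[R]_D; by equivalence of norms this gives the
   usual Schwartz space. *)
Definition schwartz psi :=
  [/\ smooth (fun x => Re (psi x)), smooth (fun x => Im (psi x)) &
      forall (k : nat) (s : seq 'I_D), exists C : R, forall x,
        `|x| ^+ k * normc (cpartials s psi x) <= C].

Definition inner phi psi : R[i] :=
  cintegral (@lebesgue_rV R D) (fun x => (phi x)^* * psi x).

Definition L2norm psi : \bar R :=
  Lnorm (@lebesgue_rV R D) 2%:E (fun x => (normc (psi x))%:E).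

End function_classes.

Section operators.
Variables (R : realType) (D : nat) (eps : R) (V : 'rV[R]_D -> R).

(* Operators act on all functions; their values are only meaningful on smooth
   ones, such as the Gaussians and the Schwartz functions. *)
Definition operator := ('rV[R]_D -> R[i]) -> ('rV[R]_D -> R[i]).

Definition qhat (j : 'I_D) : operator := fun psi x => (x ord0 j)%:C * psi x.

Definition phat (j : 'I_D) : operator := fun psi x =>
  - 'i%C * eps%:C * cpartial j psi x.

Definition kinetic : operator := fun psi x =>
  (- (eps ^+ 2 / 2))%:C * \sum_(j < D) cpartial j (cpartial j psi) x.

Definition potential : operator := fun psi x => (V x)%:C * psi x.

Definition hamiltonian : operator := fun psi x =>
  kinetic psi x + potential psi x.

Variant observable : operator -> Prop :=
| Obs_id : observable id
| Obs_q (j : 'I_D) (n : nat) : observable (iter n (qhat j))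
| Obs_p (j : 'I_D) (n : nat) : observable (iter n (phat j))
| Obs_T : observable kinetic
| Obs_V : observable potential
| Obs_H : observable hamiltonian.

(* A is not the zero operator on the Schwartz space. *)
Definition nonzero_operator (A : operator) :=
  exists2 psi, schwartz psi & A psi <> (fun=> 0).

End operators.

Section sampling.
Variables (R : realType) (D : nat) (eps : R) (Gamma : 'M[R]_D).

Definition posdefmx := forall v : 'rV[R]_D, v != 0 ->
  0 < (v *m Gamma *m v^T) ord0 ord0.

(* z = (q, p); vectors are rows, hence the transposes on the right. *)
Definition gaussian (z : 'rV[R]_D * 'rV[R]_D) : 'rV[R]_D -> R[i] := fun x =>
  let u := x - z.1 in
  ((\det Gamma / (pi ^+ D * eps ^+ D)) `^ 4^-1)%:C *
  cexp ((- (2 * eps)^-1 * (u *m Gamma *m u^T) ord0 ord0)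
        +i* (eps^-1 * (z.2 *m u^T) ord0 ord0)).

Variables (psi0 : 'rV[R]_D -> R[i]) (A : operator R D).

Local Notation phase4 := (('rV[R]_D * 'rV[R]_D) * ('rV[R]_D * 'rV[R]_D))%type.
Implicit Types (w : phase4) (rho : phase4 -> R).

Definition f_0 w : R[i] :=
  ((2 * pi * eps) ^- (2 * D))%:C *
  (inner psi0 (gaussian w.1) * inner (gaussian w.2) psi0).

Definition O_0 w : R[i] := inner (gaussian w.1) (A (gaussian w.2)).

Definition mean_0 : R[i] :=
  cintegral (@lebesgue_4D R D) (fun w => f_0 w * O_0 w).

(* A density may vanish on a Lebesgue null set; at such points the quotient by
   rho w below is 0 by convention, which does not affect the integral. *)
Definition prob_density rho :=
  [/\ measurable_fun setT rho,
      forall w, 0 <= rho w,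
      {ae @lebesgue_4D R D, forall w, 0 < rho w} &
      (\int[@lebesgue_4D R D]_w (rho w)%:E = 1)%E].

Definition variance_0 rho : \bar R :=
  (\int[@lebesgue_4D R D]_w
    (normc (f_0 w * O_0 w / (rho w)%:C - mean_0) ^+ 2 * rho w)%:E)%E.

Definition kappa_opt : \bar R :=
  (\int[@lebesgue_4D R D]_w (normc (f_0 w * O_0 w))%:E)%E.

(* fine kappa_opt is the real number kappa_opt, once shown to be finite. *)
Definition rho_opt w : R := (fine kappa_opt)^-1 * normc (f_0 w * O_0 w).

End sampling.

(* Main.v *)
Require Import Defs.
From mathcomp Require Import all_boot all_order all_algebra.
From mathcomp Require Import all_classical all_reals all_analysis.
From mathcomp Require Import measurable_realfun complex.
From mathcomp Require Import ring lra.

(** Write f for the integrand f_0 O_0, kappa for the integral of |f| and m for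
    the integral of f.  Completing the square pointwise and using that rho has
    integral 1 turns the variance into

      Var rho = \int (|f| - kappa rho)^2 / rho + (kappa^2 - |m|^2),

    an identity in the extended reals (variance_decomposition).  The integral
    is nonnegative and it vanishes exactly when |f| = kappa rho almost
    everywhere (integral_fluct_eq0), so |f| / kappa is the minimizer, it is
    unique up to null sets, and its variance is kappa^2 - |m|^2.  This
    argument needs two analytic facts: kappa is finite, and |f| / kappa is
    positive almost everywhere.

    Finiteness.  Up to a constant, |f (y, z)| is the product of
    |<g_y, psi0>|, |<g_z, psi0>| and |<g_y, A g_z>|.  The first two factors
    are short-time Fourier transforms of a Schwartz function with a Gaussian
    window.  Multiplying such a transform by a coordinate of q or of p gives
    again a combination of such transforms (with p, by parts), so they decay
    faster than every power (stft_rapid, inner_schwartz_rapid).  The observable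
    A acts on a Gaussian as multiplication by a function of polynomial growth
    M z x (observable_symbol; for the potential this uses that bounded second
    derivatives force quadratic growth, subquadratic_growth).  Hence
    <g_y, A g_z> grows at most polynomially in z, uniformly in y (O_0_bound),
    and f is dominated by the inverse of a weight, which is integrable
    (integrable_sampling_integrand).

    Positivity.  Let phi be continuous, of polynomial growth and not
    identically zero.  For fixed q, the function p |-> <g_(q,p), phi> is the
    Fourier transform of an integrable continuous function that is not
    identically zero.  It is therefore nonzero somewhere
    (fourier_injective, inner_gaussian_neq0), and the Gaussian decay makes its
    real and imaginary parts entire in each coordinate of p
    (sep_entire_integral_trig).  A separately entire function which is nonzero
    somewhere vanishes only on a null set (sep_entire_zero_null), so
    <g_y, phi> is nonzero for almost every y (inner_gaussian_null).  This
    applies to phi = psi0, and to phi = A g_z for every z with nonzero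
    momentum, because M z is then not the zero function.  Fubini gives that f
    vanishes only on a null set (sampling_integrand_null).

    All bounds use the weight \prod_i (1 + x_i^2), whose inverse is integrable and
    which is multiplicative in the coordinates, so that inductions on the
    dimension and iterated integrals are direct. *)

Set Implicit Arguments.
Unset Strict Implicit.
Unset Printing Implicit Defensive.

Import Order.TTheory GRing.Theory Num.Theory.
Import numFieldNormedType.Exports.
Local Open Scope classical_set_scope.
Local Open Scope ring_scope.

(** * Variance of an importance sampling integrand *)

Section complex_parts.
Context {R : realType}.
Implicit Types z w : R[i].

Lemma Re_mulc z w : complex.Re (z * w) =
  complex.Re z * complex.Re w - complex.Im z * complex.Im w.
Proof. by case: z w => [a b] [c d]. Qed.

Lemma Im_mulc z w : complex.Im (z * w) =
  complex.Re z * complex.Im w + complex.Im z * complex.Re w.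
Proof. by case: z w => [a b] [c d]. Qed.

Lemma normc_sqr z : Normc.normc z ^+ 2 = complex.Re z ^+ 2 + complex.Im z ^+ 2.
Proof. by case: z => a b; rewrite sqr_sqrtr// addr_ge0 ?sqr_ge0. Qed.

Lemma normc_ge0 z : 0 <= Normc.normc z.
Proof. by case: z => a b; rewrite sqrtr_ge0. Qed.

Lemma normc_eq0 z : (Normc.normc z == 0) = (z == 0).
Proof.
by apply/eqP/eqP => [/Normc.eq0_normc//|->]; rewrite Normc.normc0.
Qed.

Lemma normr_Re_le z : `|complex.Re z| <= Normc.normc z.
Proof.
by case: z => a b /=; rewrite -sqrtr_sqr ler_wsqrtr// lerDl sqr_ge0.
Qed.

Lemma normr_Im_le z : `|complex.Im z| <= Normc.normc z.
Proof.
by case: z => a b /=; rewrite -sqrtr_sqr ler_wsqrtr// lerDr sqr_ge0.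
Qed.

Lemma normc_le_ReIm z : Normc.normc z <= `|complex.Re z| + `|complex.Im z|.
Proof.
rewrite -(ler_pXn2r (n := 2))// ?nnegrE ?normc_ge0 ?addr_ge0//.
rewrite normc_sqr sqrrD !real_normK ?num_real// addrAC lerDl.
by rewrite mulrn_wge0// mulr_ge0.
Qed.

Lemma divc_real z (r : R) :
  z / (r%:C)%C = Complex (complex.Re z / r) (complex.Im z / r).
Proof.
have -> : (r%:C)%C^-1 = (r^-1)%:C%C :> R[i].
  by rewrite -[LHS]/(invc _) /invc /= expr0n /= addr0 expr2 mul0r oppr0;
    have [->|r0] := eqVneq r 0; [rewrite mul0r invr0|congr Complex; field].
by case: z => x y; rewrite -[LHS]/(mulc _ _) /mulc/= !mulr0 subr0 add0r.
Qed.

End complex_parts.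

(** Inversion is continuous away from 0, and the single point 0 is a measurable
    set, so the convention 0^-1 = 0 does no harm. *)
Lemma measurable_fun_inv d (T : measurableType d) (R : realType) (f : T -> R) :
  measurable_fun setT f -> measurable_fun setT (fun x => (f x)^-1).
Proof.
move=> mf; apply: (measurableT_comp (f := @GRing.inv R)) => //.
rewrite -(setUv [set (0 : R)]); apply/measurable_funU => //.
  exact: measurableC.
split; first exact: measurable_fun_set1.
apply: open_continuous_measurable_fun; first exact: closed_openC.
by move=> x; rewrite inE /= => /eqP x0; exact: inv_continuous.
Qed.

Section integral_lemmas.
Context {d : measure_display} {T : measurableType d} {R : realType}.
Variable mu : {measure set T -> \bar R}.

Lemma measurable_integrand {f : T -> R} :
  mu.-integrable setT (EFin \o f) -> measurable_fun setT f.
Proof. by move=> /measurable_int/measurable_EFinP. Qed.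

Lemma integrable_addR (f g : T -> R) :
  mu.-integrable setT (EFin \o f) -> mu.-integrable setT (EFin \o g) ->
  mu.-integrable setT (EFin \o (fun x => f x + g x)).
Proof.
by move=> fi gi; apply: eq_integrable (integrableD measurableT fi gi).
Qed.

Lemma integrable_subR (f g : T -> R) :
  mu.-integrable setT (EFin \o f) -> mu.-integrable setT (EFin \o g) ->
  mu.-integrable setT (EFin \o (fun x => f x - g x)).
Proof.
by move=> fi gi; apply: eq_integrable (integrableB measurableT fi gi).
Qed.

Lemma integrable_scaleR (k : R) (f : T -> R) :
  mu.-integrable setT (EFin \o f) ->
  mu.-integrable setT (EFin \o (fun x => k * f x)).
Proof.
by move=> fi; apply: eq_integrable (integrableZl measurableT k fi).
Qed.

Lemma integrable_sumR (I : Type) (s : seq I) (F : I -> T -> R) :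
  (forall i, mu.-integrable setT (EFin \o F i)) ->
  mu.-integrable setT (EFin \o (fun x => \sum_(i <- s) F i x)).
Proof.
move=> Fi; elim: s => [|i s ih].
  by under eq_fun do rewrite big_nil; exact: integrable0.
by under eq_fun do rewrite big_cons; exact: integrable_addR.
Qed.

Lemma integrable_leR (f g : T -> R) : measurable_fun setT f ->
  (forall x, `|f x| <= g x) ->
  mu.-integrable setT (EFin \o g) -> mu.-integrable setT (EFin \o f).
Proof.
move=> mf fg; apply: le_integrable => //; first exact/measurable_EFinP.
by move=> x _ /=; rewrite lee_fin (le_trans (fg x)) ?ler_norm.
Qed.

Lemma eq_ae_integrable (f g : T -> R) : measurable_fun setT f ->
  {ae mu, forall x, f x = g x} ->
  mu.-integrable setT (EFin \o g) -> mu.-integrable setT (EFin \o f).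
Proof.
move=> mf fg /[dup] /measurable_integrand mg /integrableP[_ goo].
apply/integrableP; split; first exact/measurable_EFinP.
rewrite (ge0_ae_eq_integral (g := abse \o (EFin \o g)))//.
- by apply: measurableT_comp => //; exact/measurable_EFinP.
- by apply: measurableT_comp => //; exact/measurable_EFinP.
- by move=> x _ /=; rewrite lee_fin.
- by move: fg; apply: filterS => x fgx _ /=; rewrite fgx.
Qed.

(** Both integrals of f and g may be infinite: since h is integrable, f and g are
    then infinite together, and no subtraction of infinities is involved. *)
Lemma ge0_integral_shift (f g h : T -> R) :
  (forall x, 0 <= f x) -> (forall x, 0 <= g x) ->
  measurable_fun setT f -> measurable_fun setT g ->
  mu.-integrable setT (EFin \o h) ->
  {ae mu, forall x, f x = g x + h x} ->
  (\int[mu]_x (f x)%:E = \int[mu]_x (g x)%:E + \int[mu]_x (h x)%:E)%E.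
Proof.
move=> f0 g0 mf mg ih fgh.
have mh := measurable_integrand ih.
have [ig|ng] := boolP (mu.-integrable setT (EFin \o g)).
  rewrite -integralD//; apply: ae_eq_integral => //.
  - exact/measurable_EFinP.
  - by apply: emeasurable_funD; exact/measurable_EFinP.
  - by move: fgh; apply: filterS => x -> _; rewrite EFinD.
have [if_|nf] := boolP (mu.-integrable setT (EFin \o f)).
  exfalso; move/negP : ng; apply.
  apply: (eq_ae_integrable (g := fun x => f x - h x)) => //.
    by move: fgh; apply: filterS => x ->; rewrite addrK.
  exact: integrable_subR.
have oo (k : T -> R) : (forall x, 0 <= k x) -> measurable_fun setT k ->
    ~~ mu.-integrable setT (EFin \o k) -> (\int[mu]_x (k x)%:E = +oo)%E.
  move=> k0 mk /negP nk; apply/eqP; apply: contraPT nk.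
  rewrite -ltey => koo; rewrite not_notE; apply/integrableP; split.
    exact/measurable_EFinP.
  by under eq_integral do rewrite gee0_abs ?lee_fin//=.
rewrite oo// oo// addye// -ltNye.
by have /fin_numPlt/andP[] := integrable_fin_num measurableT ih.
Qed.

Lemma Rintegral_addR (f g : T -> R) :
  mu.-integrable setT (EFin \o f) -> mu.-integrable setT (EFin \o g) ->
  \int[mu]_x (f x + g x) = \int[mu]_x f x + \int[mu]_x g x.
Proof. by move=> fi gi; rewrite RintegralD. Qed.

Lemma Rintegral_sumR (I : Type) (s : seq I) (F : I -> T -> R) :
  (forall i, mu.-integrable setT (EFin \o F i)) ->
  \int[mu]_x (\sum_(i <- s) F i x) = \sum_(i <- s) \int[mu]_x F i x.
Proof.
move=> Fi; elim: s => [|i s ih].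
  under eq_Rintegral do rewrite big_nil.
  by rewrite big_nil Rintegral_cst// mul0r.
under eq_Rintegral do rewrite big_cons.
by rewrite big_cons RintegralD// ?ih//; exact: integrable_sumR.
Qed.

Lemma EFin_Rintegral (f : T -> R) : mu.-integrable setT (EFin \o f) ->
  (\int[mu]_x f x)%:E = (\int[mu]_x (f x)%:E)%E.
Proof. by move=> fi; rewrite fineK//; exact: integrable_fin_num. Qed.

End integral_lemmas.

Section monte_carlo.
Local Open Scope complex_scope.
Context {d : measure_display} {T : measurableType d} {R : realType}.
Variables (mu : {measure set T -> \bar R}) (f : T -> R[i]).
Local Notation a := (fun x => Normc.normc (f x)).
Hypotheses (mRe : measurable_fun setT (fun x => complex.Re (f x)))
  (mIm : measurable_fun setT (fun x => complex.Im (f x)))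
  (ia : mu.-integrable setT (EFin \o a)).
Local Notation kappa := (\int[mu]_x a x).
Local Notation m := (cintegral mu f).

Lemma measurable_normc : measurable_fun setT a.
Proof. exact: measurable_integrand ia. Qed.

Lemma integrable_Re : mu.-integrable setT (EFin \o (fun x => complex.Re (f x))).
Proof. by apply: integrable_leR ia => // x; exact: normr_Re_le. Qed.

Lemma integrable_Im : mu.-integrable setT (EFin \o (fun x => complex.Im (f x))).
Proof. by apply: integrable_leR ia => // x; exact: normr_Im_le. Qed.

(** Expand |z/r - w|^2 r = |z|^2/r - 2 Re (conj w * z) + |w|^2 r and
    (|z| - k r)^2/r = |z|^2/r - 2 k |z| + k^2 r.  The term |z|^2/r, the only one
    that may fail to be integrable, cancels in the difference. *)
Lemma variance_pointwise (z w : R[i]) (k r : R) : r != 0 ->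
  Normc.normc (z / r%:C - w) ^+ 2 * r =
  (Normc.normc z - k * r) ^+ 2 / r + (2 * k * Normc.normc z +
  (Normc.normc w ^+ 2 - k ^+ 2) * r - 2 *
  (complex.Re w * complex.Re z + complex.Im w * complex.Im z)).
Proof.
move=> r0; have := normc_sqr z; move: (Normc.normc z) => n nE.
rewrite !normc_sqr divc_real.
case: w z nE => u v [x y] /= nE.

have -> : (x / r - u) ^+ 2 + (y / r - v) ^+ 2 =
  (x ^+ 2 + y ^+ 2) / r ^+ 2 - 2 * (u * x + v * y) / r + (u ^+ 2 + v ^+ 2).
  by field.
by rewrite -nE; field.
Qed.

Section variance.
Variable rho : T -> R.
Hypotheses (mrho : measurable_fun setT rho) (rho_ge0 : forall x, 0 <= rho x)
  (rho_gt0 : {ae mu, forall x, 0 < rho x})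
  (rho_int1 : (\int[mu]_x (rho x)%:E = 1)%E).

Lemma integrable_density : mu.-integrable setT (EFin \o rho).
Proof.
apply/integrableP; split; first exact/measurable_EFinP.
under eq_integral do rewrite gee0_abs ?lee_fin//=.
by rewrite rho_int1 ltry.
Qed.

Let fluct x := (a x - kappa * rho x) ^+ 2 / rho x.

Lemma measurable_fluct : measurable_fun setT fluct.
Proof.
apply: measurable_funM; last exact: measurable_fun_inv.
apply: measurable_funX; apply: measurable_funB => //.
  exact: measurable_normc.
exact: measurable_funM.
Qed.

(** In variance_pointwise take z = f x, r = rho x, k = kappa and w = m.  The
    correction term is integrable, with integral
    2 kappa^2 + (|m|^2 - kappa^2) - 2 |m|^2 for every probability density. *)
Lemma variance_decomposition :
  (\int[mu]_x (Normc.normc (f x / (rho x)%:C - m) ^+ 2 * rho x)%:E =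
   \int[mu]_x (fluct x)%:E + (kappa ^+ 2 - Normc.normc m ^+ 2)%:E)%E.
Proof.
have irho := integrable_density.
pose h x := 2 * kappa * a x + (Normc.normc m ^+ 2 - kappa ^+ 2) * rho x
  - 2 * (complex.Re m * complex.Re (f x) + complex.Im m * complex.Im (f x)).
have i1 := integrable_scaleR (2 * kappa) ia.
have i2 := integrable_scaleR (Normc.normc m ^+ 2 - kappa ^+ 2) irho.
have i3 := integrable_scaleR (complex.Re m) integrable_Re.
have i4 := integrable_scaleR (complex.Im m) integrable_Im.
have i5 := integrable_addR i3 i4.
have i6 := integrable_scaleR 2 i5.
have ih : mu.-integrable setT (EFin \o h).
  by apply: integrable_subR => //; exact: integrable_addR.
have hE : \int[mu]_x h x = kappa ^+ 2 - Normc.normc m ^+ 2.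
  rewrite RintegralB//; last exact: integrable_addR.
  rewrite RintegralD// !RintegralZl// ?integrable_Re ?integrable_Im//.
  rewrite RintegralD// !RintegralZl// ?integrable_Re ?integrable_Im//.
  have -> : \int[mu]_x rho x = 1 by rewrite /Rintegral rho_int1.
  rewrite [in RHS]normc_sqr normc_sqr /=.
  by ring.
rewrite (ge0_integral_shift (g := fluct) (h := h))//.
- by rewrite -hE EFin_Rintegral.
- by move=> x; rewrite mulr_ge0 ?sqr_ge0.
- by move=> x; rewrite mulr_ge0 ?sqr_ge0 ?invr_ge0.
- apply: measurable_funM => //.
  rewrite (_ : (fun x => _) = (fun x =>
      (complex.Re (f x) / rho x - complex.Re m) ^+ 2 +
      (complex.Im (f x) / rho x - complex.Im m) ^+ 2)); last first.
    apply/funext => x; rewrite normc_sqr.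
    by rewrite divc_real; case: m.
  apply: measurable_funD; apply: measurable_funX; apply: measurable_funB => //;
    by apply: measurable_funM => //; exact: measurable_fun_inv.
- exact: measurable_fluct.
- move: rho_gt0; apply: filterS => x rx.
  by rewrite (variance_pointwise _ _ kappa)// gt_eqF.
Qed.

Lemma fluct_ge0 x : 0 <= fluct x.
Proof. by rewrite mulr_ge0 ?sqr_ge0 ?invr_ge0. Qed.

Lemma integral_fluct_eq0 : (\int[mu]_x (fluct x)%:E = 0)%E <->
  {ae mu, forall x, a x = kappa * rho x}.
Proof.
have mfl : measurable_fun setT (EFin \o fluct).
  by apply/measurable_EFinP; exact: measurable_fluct.
have <- : (\int[mu]_x `|(fluct x)%:E| = \int[mu]_x (fluct x)%:E)%E.
  by apply: eq_integral => x _; rewrite gee0_abs// lee_fin fluct_ge0.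
apply: (iff_trans (ae_eq_integral_abs mu measurableT mfl)); split.
  move: rho_gt0; apply: filterS2 => x rx /(_ I)[] /eqP.
  rewrite mulf_eq0 invr_eq0 (gt_eqF rx) orbF sqrf_eq0 subr_eq0.
  by move/eqP.
by apply: filterS => x ax _ /=; rewrite /fluct ax subrr expr0n/= mul0r.
Qed.

End variance.

End monte_carlo.

(** * Lebesgue measure and integrable weights on row vectors *)

Section rV_measure.
Context {R : realType}.
Local Notation mu := (@lebesgue_rV R _).
Local Notation leb := (@lebesgue_measure R).

(** An open set is the union of the boxes with rational corners that it contains,
    of which there are countably many. *)
Lemma measurable_open_rV n (U : set 'rV[R]_n) : open U -> measurable U.
Proof.
move=> oU.
pose box (ab : 'rV[rat]_n * 'rV[rat]_n) : set 'rV[R]_n :=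
  [set x | forall i, ratr (ab.1 ord0 i) < x ord0 i < ratr (ab.2 ord0 i)].
have mbox ab : measurable (box ab).
  have -> : box ab = \bigcap_(i in setT) (fun v : 'rV[R]_n => v ord0 i) @^-1`
      `](ratr (ab.1 ord0 i) : R), (ratr (ab.2 ord0 i) : R)[%classic.
    apply/seteqP; split=> v /= vE i.
      by move=> _; rewrite /= in_itv; exact: vE.
    by have := vE i I; rewrite /= in_itv.
  apply: fin_bigcap_measurable => // i _.
  rewrite -[X in measurable X]setTI; exact: (measurable_coord i).
have -> : U = \bigcup_(ab in [set ab | box ab `<=` U]) box ab.
  apply/seteqP; split=> [x Ux|x [ab /= abU xab]]; last exact: abU.
  have [P xP PU] : nbhs x U by exact: open_nbhs_nbhs.
  have /choice[a aP] (i : 'I_n) : exists ab : rat * rat,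
      [/\ ratr ab.1 < x ord0 i, x ord0 i < ratr ab.2 &
        forall y, ratr ab.1 < y < ratr ab.2 -> P ord0 i y].
    have /nbhs_ballP[e /= e0 eP] := xP ord0 i.
    have /rat_in_itvoo[q1] : x ord0 i - e < x ord0 i by rewrite gtrBl.
    have /rat_in_itvoo[q2] : x ord0 i < x ord0 i + e by rewrite ltrDl.
    rewrite !in_itv/= => /andP[h1 h2] /andP[h3 h4].
    exists (q1, q2); split => //= y /andP[h5 h6]; apply: eP => /=.
    by rewrite /ball/= ltr_distlC; apply/andP; split; lra.
  exists (\row_i (a i).1, \row_i (a i).2) => /=.
    move=> y yab; apply: PU => i j; rewrite (ord1 i).
    by have [_ _ ] := aP j; apply; have := yab j; rewrite !mxE.
  by move=> i; rewrite !mxE; have [-> -> _] := aP i.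
rewrite bigcup_mkcond; apply: countable_bigcupT_measurable => // ab.
by case: ifP => // _; exact: mbox.
Qed.

Lemma continuous_measurable_rV n (f : 'rV[R]_n -> R) :
  continuous f -> measurable_fun setT f.
Proof.
move=> /continuousP cf.
apply: (measurability _ (RGenOpens.measurableE R)) => //.
move=> _ [_ [a [b ->] <-]]; rewrite setTI; apply: measurable_open_rV.
exact/cf/interval_open.
Qed.

Lemma ge0_integral_rV_cons n (f : 'rV[R]_n.+1 -> \bar R) :
  measurable_fun setT f -> (forall x, 0 <= f x)%E ->
  (\int[mu]_x f x = \int[leb]_t \int[mu]_v f (rV_cons (t, v)))%E.
Proof.
move=> mf f0.
apply: etrans (ge0_integral_pushforward (@measurable_rV_cons R n)
  (leb \x mu)%E measurableT mf _) _; first by move=> x _; exact: f0.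
rewrite preimage_setT fubini_tonelli1//.
- by apply: measurableT_comp => //; exact: measurable_rV_cons.
- by move=> p; exact: f0.
Qed.

Lemma integrable_rV_cons n (f : 'rV[R]_n.+1 -> \bar R) :
  mu.-integrable setT f ->
  (leb \x mu)%E.-integrable setT (fun p => f (rV_cons p)).
Proof.
move=> /integrableP[mf foo]; apply/integrableP; split.
  by apply: measurableT_comp => //; exact: measurable_rV_cons.
rewrite fubini_tonelli1//; last first.
  by do 2 apply: measurableT_comp => //; exact: measurable_rV_cons.
apply: le_lt_trans foo; rewrite ge0_integral_rV_cons//.
exact: measurableT_comp.
Qed.

Lemma integral_rV_cons1 n (f : 'rV[R]_n.+1 -> \bar R) :
  mu.-integrable setT f ->
  (\int[mu]_x f x = \int[leb]_t \int[mu]_v f (rV_cons (t, v)))%E.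
Proof.
move=> fi; have fi' := integrable_rV_cons fi.
apply: etrans (integral_pushforward (mu := (leb \x mu)%E)
  (@measurable_rV_cons R n) _ _ measurableT) _.
- exact: measurable_int fi.
- by rewrite preimage_setT.
- by rewrite preimage_setT -integral12_prod_meas1.
Qed.

Lemma integral_rV_cons2 n (f : 'rV[R]_n.+1 -> \bar R) :
  mu.-integrable setT f ->
  (\int[mu]_x f x = \int[mu]_v \int[leb]_t f (rV_cons (t, v)))%E.
Proof.
move=> fi; have fi' := integrable_rV_cons fi.
by rewrite integral_rV_cons1// (Fubini fi').
Qed.

(** The form of Fubini used for inductions on the dimension: almost all slices
    at fixed first coordinate are null. *)
Lemma null_rV_cons n (A : set 'rV[R]_n.+1) : measurable A ->
  {ae leb, forall t, mu [set v | A (rV_cons (t, v))] = 0} -> mu A = 0.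
Proof.
move=> mA A0.
have mA' : measurable (@rV_cons R n @^-1` A).
  by rewrite -[X in measurable X]setTI; exact: measurable_rV_cons.
have -> : mu A = (\int[leb]_t mu (xsection (@rV_cons R n @^-1` A) t))%E by [].
transitivity (\int[leb]_t (cst 0%E t))%E; last exact: integral0.
apply: ae_eq_integral => //; first exact: measurable_fun_xsection.
move: A0; apply: filterS => t At0 _ /=; rewrite -[RHS]At0; congr (mu _).
by apply/seteqP; split=> v; rewrite /xsection/= inE.
Qed.

(** A product of one-dimensional weights rather than a power of a norm: it factors
    along rV_cons, and multiplication by it is a composition of multiplications by
    coordinates. *)
Definition weight n (x : 'rV[R]_n) : R := \prod_i (1 + x ord0 i ^+ 2).

Lemma weight_ge1 n (x : 'rV[R]_n) : 1 <= weight x.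
Proof.
rewrite /weight; elim/big_ind : _ => // [a b a1 b1|i _].
  by rewrite mulr_ege1.
by rewrite lerDl sqr_ge0.
Qed.

Lemma weight_gt0 n (x : 'rV[R]_n) : 0 < weight x.
Proof. exact: lt_le_trans (weight_ge1 x). Qed.

Lemma weight_cons n t (v : 'rV[R]_n) :
  weight (rV_cons (t, v)) = (1 + t ^+ 2) * weight v.
Proof.
rewrite /weight big_ord_recl mxE unlift_none /=; congr (_ * _).
by apply: eq_bigr => i _; rewrite mxE liftK.
Qed.

Lemma measurable_weight n : measurable_fun setT (@weight n).
Proof.
rewrite /weight; elim: (index_enum _) => [|i s ih].
  by under eq_fun do rewrite big_nil; exact: measurable_cst.
under eq_fun do rewrite big_cons.
apply: measurable_funM => //; apply: measurable_funD => //.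
by apply: measurable_funX; exact: measurable_coord.
Qed.

Lemma integrable_oneDsqrV :
  leb.-integrable setT (EFin \o (fun t : R => (1 + t ^+ 2)^-1)).
Proof.
have mf : measurable_fun setT (fun t : R => (1 + t ^+ 2)^-1).
  by apply: measurable_fun_inv; apply: measurable_funD => //;
    exact: measurable_funX.
apply/integrableP; split; first exact/measurable_EFinP.
under eq_integral do rewrite gee0_abs ?lee_fin ?invr_ge0 ?addr_ge0 ?sqr_ge0//=.
rewrite ge0_symfun_integralT//=.
- rewrite -set_itvcy; have := @integral0y_oneDsqr R.
  by rewrite /oneDsqr => ->; rewrite -EFinM ltry.
- by move=> x; rewrite invr_ge0 addr_ge0// sqr_ge0.
- by move=> x; exact: continuous_oneDsqrV.
- by move=> x /=; rewrite sqrrN.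
Qed.

(** Induction on the dimension from the integrability of 1/(1 + t^2), since the
    weight is a product. *)
Lemma integrable_weightV n :
  mu.-integrable setT (EFin \o (fun x : 'rV[R]_n => (weight x)^-1)).
Proof.
have mW m : measurable_fun setT (fun x : 'rV[R]_m => (weight x)^-1).
  by apply: measurable_fun_inv; exact: measurable_weight.
have W0 m (x : 'rV[R]_m) : 0 <= (weight x)^-1.
  by rewrite invr_ge0 ltW// weight_gt0.
apply/integrableP; split; first by apply/measurable_EFinP; exact: mW.
under eq_integral do rewrite gee0_abs ?lee_fin ?W0//=.
elim: n => [|n ih].
  rewrite integral_dirac//; last by apply/measurable_EFinP; exact: mW.
  by rewrite diracT mul1e ltry.
rewrite ge0_integral_rV_cons//; last 2 first.
- by apply/measurable_EFinP; exact: mW.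
- by move=> x; rewrite lee_fin.
set c := (\int[mu]_v (weight v)^-1%:E)%E in ih.
have cE : c = (fine c)%:E.
  by rewrite fineK// ge0_fin_numE// integral_ge0// => x _; rewrite lee_fin.
under eq_integral => t _.
  under eq_integral do rewrite weight_cons invfM EFinM.
  rewrite ge0_integralZl_EFin//; last 3 first.
  - by move=> v _; rewrite lee_fin.
  - by apply/measurable_EFinP; exact: mW.
  - by rewrite invr_ge0 addr_ge0// sqr_ge0.
  rewrite -/c cE; over.
rewrite /= integralZr//; last exact: integrable_oneDsqrV.
have /fineK <- := integrable_fin_num measurableT integrable_oneDsqrV.
by rewrite -EFinM ltry.
Qed.

Lemma integrable_weight_bound n (f : 'rV[R]_n -> R) (C : R) :
  measurable_fun setT f -> (forall x, `|f x| * weight x <= C) ->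
  mu.-integrable setT (EFin \o f).
Proof.
move=> mf fC.
apply: integrable_leR (integrable_scaleR C (@integrable_weightV n)) => // x.
by rewrite ler_pdivlMr ?weight_gt0.
Qed.

Lemma normr_Rintegral_weight_bound n (f : 'rV[R]_n -> R) (C : R) :
  measurable_fun setT f -> (forall x, `|f x| * weight x <= C) ->
  `|\int[mu]_x f x| <= C * \int[mu]_x (weight (x : 'rV[R]_n))^-1.
Proof.
move=> mf fC; have fi := integrable_weight_bound mf fC.
apply: le_trans (le_normr_Rintegral measurableT fi) _.
rewrite -RintegralZl//; last exact: integrable_weightV.
apply: le_Rintegral => //.
- exact: integrable_norm.
- by apply: integrable_scaleR; exact: integrable_weightV.
- by move=> x _; rewrite ler_pdivlMr ?weight_gt0.
Qed.

End rV_measure.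

(** * Zeros of separately entire functions *)

Section entire.
Context {R : realType}.
Local Notation leb := (@lebesgue_measure R).

(** A real-variable form of holomorphy on the whole line: at every center there is
    a power series which converges everywhere. *)
Definition entire (f : R -> R) := forall x0, exists c : nat -> R,
  forall s, series (fun n => c n * s ^+ n) @ \oo --> f (x0 + s).

(** Some coefficient c_m of the expansion at x0 is nonzero, since otherwise f
    would vanish everywhere.  With m minimal, f (x0 + s) differs from c_m s^m by
    O(|s|^(m+1)), hence is nonzero for small s different from 0. *)
Lemma entire_zero_isolated (f : R -> R) (x1 x0 : R) : entire f -> f x1 != 0 ->
  exists2 e : R, 0 < e & forall s, 0 < `|s| < e -> f (x0 + s) != 0.
Proof.
move=> fE f1; have [c cf] := fE x0.
have [m cm0 mmin] : exists2 m, c m != 0 & forall k, (k < m)%N -> c k = 0.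
  have : exists n, c n != 0.
    apply: contrapT => /forallNP c0.
    move: f1; rewrite -(subrKC x0 x1) => /eqP; apply.
    apply: (cvg_unique (@Rhausdorff R) (cf (x1 - x0))).
    rewrite (_ : series _ = cst 0); first exact: cvg_cst.
    apply/funext => N; rewrite /series /= big1// => i _.
    by have /negP := c0 i; rewrite negbK => /eqP ->; rewrite mul0r.
  move=> /ex_minnP[m cm0 mP]; exists m => // k km.
  by apply/eqP; apply: contraTT km => /mP; rewrite -leqNgt.
(* Convergence at s = 2 bounds the terms there, so that for |s| <= 1 the tail of
   the series is dominated by a geometric series of ratio 1/2. *)
have [K K0 cK] : exists2 K, 0 < K & forall k, `|c k| * 2 ^+ k <= K.
  have := cvgP _ (cvg_series_cvg_0 (cvgP _ (cf 2))).
  move=> /cvg_seq_bounded[K [_ HK]]; exists (`|K| + 1).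
    by rewrite ltr_wpDl.
  move=> k; have := HK (`|K| + 1); rewrite ltr_pwDr ?ler_norm// => /(_ isT k I).
  by rewrite /= normrM normrX (ger0_norm (ler0n R 2)).
(* Below this radius the remainder after the term of degree m, at most
   2 K |s|^(m+1), is smaller than |c m| |s|^m. *)
exists (Num.min 1 (`|c m| / (2 * K))).
  by rewrite lt_min ltr01 divr_gt0 ?normr_gt0// mulr_gt0.
move=> s /andP[s0]; rewrite lt_min => /andP[s1 sc].
(* The last factor is the geometric sum 1 + 1/2 + ... of j terms. *)
have bnd j : `|series (fun n => c n * s ^+ n) (m.+1 + j)%N - c m * s ^+ m| <=
    K * `|s| ^+ m.+1 * (2 * (1 - 2 ^- j)).
  elim: j => [|j ih].
    rewrite addn0 /series /= big_nat_recr//= big_nat big1.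
      by rewrite add0r !subrr normr0 expr0 invr1 subrr !mulr0.
    by move=> i /= im; rewrite mmin// mul0r.
  rewrite addnS /series /= big_nat_recr//= addrAC.
  apply: le_trans (ler_normD _ _) _.
  apply: le_trans (lerD ih (_ : _ <= K * `|s| ^+ m.+1 * 2 ^- j)) _.
    have := cK (m.+1 + j)%N; rewrite -ler_pdivlMr ?exprn_gt0// => cKj.
    rewrite normrM normrX mulrAC.
    apply: ler_pM => //; rewrite ?exprn_ge0//.
      apply: le_trans cKj _; rewrite ler_pM2l// lef_pV2 ?posrE ?exprn_gt0//.
      by rewrite ler_eXn2l ?ltr1n// leq_addl.
    by rewrite exprD ler_piMr ?exprn_ge0// exprn_ile1// ltW.
  rewrite -mulrDr ler_pM2l ?mulr_gt0 ?exprn_gt0//.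
  by rewrite exprS invfM; lra.
have fb : `|f (x0 + s) - c m * s ^+ m| <= K * `|s| ^+ m.+1 * 2.
  have cv : (`|series (fun n => c n * s ^+ n) N - c m * s ^+ m| @[N --> \oo] -->
      `|f (x0 + s) - c m * s ^+ m|).
    by apply: cvg_norm; apply: cvgB; [exact: cf|exact: cvg_cst].
  apply: (ler_cvg_to cv (cvg_cst _)).
  exists m.+1 => // N /= mN; rewrite -(subnKC mN); apply: le_trans (bnd _) _.
  rewrite ler_pM2l ?mulr_gt0 ?exprn_gt0//.
  by rewrite ler_piMr// gerBl invr_ge0 exprn_ge0.
apply/eqP => fs0; move: fb; rewrite fs0 sub0r normrN normrM normrX exprSr.
rewrite mulrCA -mulrA mulrC ler_pM2l ?exprn_gt0// leNgt => /negP; apply.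
by move: sc; rewrite ltr_pdivlMr ?mulr_gt0//; lra.
Qed.

(** By Bolzano-Weierstrass an infinite bounded set of zeros would have a limit
    point, against entire_zero_isolated; so the zeros are countable. *)
Lemma entire_zero_null (f : R -> R) (x1 : R) : entire f -> f x1 != 0 ->
  leb [set t | f t = 0] = 0%E.
Proof.
move=> fE f1; apply: countable_lebesgue_measure0.
have -> : [set t | f t = 0] =
    \bigcup_k ([set t | f t = 0] `&` [set t | `|t| <= k%:R]).
  apply/seteqP; split=> [t /= ft|t [k _ []]//].
  exists (Num.truncn `|t|).+1 => //; split => //=.
  by rewrite ltW// truncnS_gt.
apply: bigcup_countable => // k _; apply: finite_set_countable.
apply: contrapT => /infinite_bounded_limit_point_nonempty[].
  exists k%:R; split; first exact: num_real.
  by move=> y ky t [_ /= /le_trans]; apply; exact: ltW.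
move=> x0 /limit_pointP[u [uZ ux cu]].
have [e e0 eP] := entire_zero_isolated x0 fE f1.
have /cvgr_dist_lt/(_ _ e0)[N _ /(_ N (leqnn N))/= uN] := cu.
have [/= fu0 _] := uZ _ (ex_intro2 _ _ N I erefl).
have := eP (u N - x0); rewrite subrKC fu0 eqxx => h.
suff : false by []; apply: h.
by rewrite normr_gt0 subr_eq0 ux distrC uN.
Qed.

(** Weaker than joint analyticity, and enough for the induction on the dimension in
    sep_entire_zero_null, which only meets power series in one variable. *)
Definition sep_entire n (f : 'rV[R]_n -> R) := forall j x,
  entire (fun t => f (x + t *: delta_mx ord0 j)).

Lemma rV_consE n (x : 'rV[R]_n.+1) :
  x = rV_cons (x ord0 ord0, \row_j x ord0 (lift ord0 j)).
Proof.
by apply/rowP => i; rewrite mxE /=; case: unliftP => [j ->|->//]; rewrite mxE.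
Qed.

Lemma rV_consD0 n (s t : R) (v : 'rV[R]_n) :
  rV_cons (s + t, v) = rV_cons (s, v) + t *: delta_mx ord0 ord0.
Proof.
apply/rowP => i; rewrite !mxE eqxx andTb.
by case: unliftP => [j ->|->] /=; rewrite ?mulr1// mulr0 addr0.
Qed.

Lemma rV_consDlift n (s t : R) (v : 'rV[R]_n) j :
  rV_cons (s, v + t *: delta_mx ord0 j) =
  rV_cons (s, v) + t *: delta_mx ord0 (lift ord0 j).
Proof.
apply/rowP => i; rewrite !mxE eqxx andTb.
case: unliftP => [k ->|->] /=; last first.
  by rewrite ?(negbTE (neq_lift _ _)) mulr0 addr0.
by rewrite !mxE (inj_eq lift_inj).
Qed.

(** Induction on the dimension.  The restriction of f to the first axis line
    through x1 is nonzero except at a null set of t; for each other t the slice at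
    t is separately entire and nonzero somewhere, so it vanishes on a null set. *)
Lemma sep_entire_zero_null n (f : 'rV[R]_n -> R) x1 :
  measurable_fun setT f -> sep_entire f -> f x1 != 0 ->
  lebesgue_rV [set x | f x = 0] = 0%E.
Proof.
elim: n f x1 => [|n ih] f x1 mf fE f1.
  rewrite (_ : [set _ | _] = set0) ?measure0//.
  by apply/seteqP; split=> // x /= /eqP; rewrite (thinmx0 x) -(thinmx0 x1) (negbTE f1).
apply: null_rV_cons.
  rewrite -[X in measurable X]setTI.
  exact: (mf measurableT [set 0] (measurable_set1 0)).
pose v1 : 'rV[R]_n := \row_j x1 ord0 (lift ord0 j).
have N0 : lebesgue_measure [set t | f (rV_cons (t, v1)) = 0] = 0%E.
  have /(_ (x1 ord0 ord0)) := @entire_zero_null (fun t => f (rV_cons (0, v1) + t *: delta_mx ord0 ord0)).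
  rewrite -rV_consD0 add0r -rV_consE => /(_ (fE _ _) f1) h.
  by under eq_set do rewrite -[X in (X, _)]add0r rV_consD0.
have mpair t : measurable_fun setT (fun v => f (rV_cons (t, v))).
  apply: (measurableT_comp mf); apply: (measurableT_comp (@measurable_rV_cons R n)).
  exact: measurable_fun_pair.
have mpair1 : measurable_fun setT (fun t => f (rV_cons (t, v1))).
  apply: (measurableT_comp mf); apply: (measurableT_comp (@measurable_rV_cons R n)).
  exact: measurable_fun_pair.
exists [set t | f (rV_cons (t, v1)) = 0]; split => //.
  rewrite -[X in measurable X]setTI.
  exact: (mpair1 measurableT [set 0] (measurable_set1 0)).
move=> t /=; apply: contra_notP => /eqP ft.
apply: (ih (fun v => f (rV_cons (t, v))) v1) => //.
by move=> j x; under eq_fun do rewrite rV_consDlift; exact: fE.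
Qed.

End entire.

(** * Integrals depending on a parameter through a power series *)

Section exp_series.
Context {R : realType}.
Implicit Types (C : nat -> R) (g : R -> R).

(** Coefficients bounded by 1/n! make the partial sums at x bounded by exp |x|;
    expR, cos and sin are all of this kind. *)
Definition exp_type g C := (forall n, `|C n| <= (n`!%:R)^-1) /\
  forall x, series (fun n => C n * x ^+ n) @ \oo --> g x.

Lemma exp_type_expR : exp_type expR (fun n => (n`!%:R)^-1).
Proof.
split=> [n|x]; first by rewrite ger0_norm// invr_ge0.
rewrite (_ : (fun n => _) = exp_coeff x); first exact: is_cvg_series_exp_coeff.
by apply/funext => n; rewrite /exp_coeff/= mulrC.
Qed.

Lemma exp_type_cos :
  exp_type cos (fun n => (~~ odd n)%:R * (-1) ^+ n./2 * (n`!%:R)^-1).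
Proof.
split=> [n|x].
  rewrite normrM normrM normrX normrN1 expr1n mulr1 [X in _ * X]ger0_norm ?invr_ge0//.
  by case: odd; rewrite ?normr0 ?mul0r ?invr_ge0// normr1 mul1r.
have : cvgn (series (cos_coeff x)) by exact: is_cvg_series_cos_coeff.
by rewrite cosE cos_coeffE.
Qed.

Lemma exp_type_sin :
  exp_type sin (fun n => (odd n)%:R * (-1) ^+ n.-1./2 * (n`!%:R)^-1).
Proof.
split=> [n|x].
  rewrite normrM normrM normrX normrN1 expr1n mulr1 [X in _ * X]ger0_norm ?invr_ge0//.
  by case: odd; rewrite ?normr0 ?mul0r ?invr_ge0// normr1 mul1r.
have : cvgn (series (sin_coeff x)) by exact: is_cvg_series_sin_coeff.
by rewrite sinE sin_coeffE.
Qed.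

Lemma exp_type_partial_le g C x N : exp_type g C ->
  `|series (fun n => C n * x ^+ n) N| <= expR `|x|.
Proof.
move=> [Cb _]; apply: le_trans (_ : series (exp_coeff `|x|) N <= _).
  rewrite /series /=; apply: le_trans (ler_norm_sum _ _ _) _.
  apply: ler_sum => n _; rewrite normrM normrX /exp_coeff /= mulrC.
  by rewrite ler_wpM2l// exprn_ge0.
apply: nondecreasing_cvgn_le; last exact: is_cvg_series_exp_coeff.
apply/nondecreasing_seqP => n; rewrite /series/= big_nat_recr//= lerDl.
exact: exp_coeff_ge0.
Qed.

Lemma exp_type_measurable g C : exp_type g C -> measurable_fun setT g.
Proof.
move=> [_ gC].
have mS N : measurable_fun [set: R] (fun x => series (fun n => C n * x ^+ n) N).
  rewrite /series /=; elim: N => [|N ih].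
    by under eq_fun do rewrite big_geq//; exact: measurable_cst.
  under eq_fun do rewrite big_nat_recr//=.
  apply: measurable_funD => //; apply: measurable_funM => //.
exact: (measurable_fun_cvg mS (fun x _ => gC x)).
Qed.

Context {d : measure_display} {T : measurableType d}.
Variable mu : {measure set T -> \bar R}.
Implicit Types a k : T -> R.

(** All exponential moments in the variable a are finite for the density |k|: this
    is what justifies summing under the integral sign for every s. *)
Definition exp_integrable a k := [/\ measurable_fun setT a,
  measurable_fun setT k & forall s, 0 <= s ->
  mu.-integrable setT (EFin \o (fun x => expR (s * `|a x|) * `|k x|))].

Lemma exp_integrable_le a k1 k2 k : exp_integrable a k1 ->
  exp_integrable a k2 -> measurable_fun setT k ->
  (forall x, `|k x| <= `|k1 x| + `|k2 x|) -> exp_integrable a k.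
Proof.
move=> [ma mk1 i1] [_ mk2 i2] mk kk; split => // s s0.
apply: integrable_leR (integrable_addR (i1 s s0) (i2 s s0)).
  apply: measurable_funM; last exact: measurableT_comp.
  apply: measurableT_comp => //; apply: measurable_funM => //.
  exact: measurableT_comp.
move=> x; rewrite normrM normr_id ger0_norm ?expR_ge0// -mulrDr.
by rewrite ler_wpM2l ?expR_ge0.
Qed.

(** Dominated convergence: the partial sums of the series of g at s * a x are
    bounded by exp (|s| |a x|). *)
Lemma integral_exp_type g C a k : exp_type g C -> exp_integrable a k ->
  exists c : nat -> R, forall s,
  mu.-integrable setT (EFin \o (fun x => g (s * a x) * k x)) /\
  series (fun n => c n * s ^+ n) @ \oo --> \int[mu]_x (g (s * a x) * k x).
Proof.
move=> gC [ma mk ik]; have [Cb Cc] := gC.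
have mterm n : measurable_fun setT (fun x => C n * a x ^+ n * k x).
  apply: measurable_funM => //; apply: measurable_funM => //.
  exact: measurable_funX.
have iterm n : mu.-integrable setT (EFin \o (fun x => C n * a x ^+ n * k x)).
  apply: integrable_leR (ik 1 ler01) => // x; rewrite mul1r normrM.
  rewrite ler_wpM2r// normrM normrX mulrC.
  apply: le_trans (_ : exp_coeff `|a x| n <= _).
    by rewrite /exp_coeff/= ler_wpM2l// exprn_ge0.
  apply: le_trans (_ : series (exp_coeff `|a x|) n.+1 <= _).
    rewrite /series/= big_nat_recr//= lerDr sumr_ge0// => i _.
    exact: exp_coeff_ge0.
  have := exp_type_partial_le (`|a x|) n.+1 exp_type_expR.
  rewrite normr_id; apply: le_trans; rewrite -[leLHS]ger0_norm; last first.
    by apply: sumr_ge0 => i _; exact: exp_coeff_ge0.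
  rewrite (_ : exp_coeff _ = (fun n : nat => (n`!%:R)^-1 * `|a x| ^+ n))//.
  by apply/funext => m; rewrite /exp_coeff/= mulrC.
exists (fun n => \int[mu]_x (C n * a x ^+ n * k x)) => s.
pose f N x := series (fun n => C n * (s * a x) ^+ n) N * k x.
have fE N : f N = (fun x => \sum_(i < N) s ^+ i * (C i * a x ^+ i * k x)).
  apply/funext => x; rewrite /f /series/= big_mkord mulr_suml.
  by apply: eq_bigr => i _; rewrite exprMn; ring.
have mf N : measurable_fun setT (EFin \o f N).
  rewrite fE; apply/measurable_EFinP; apply: measurable_sum => i.
  exact: measurable_funM.
have sa x : `|s * a x| = `|s| * `|a x| by rewrite normrM.
have mlim : measurable_fun setT (fun x => g (s * a x) * k x).
  apply: measurable_funM => //; apply: measurableT_comp.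
    exact: exp_type_measurable gC.
  exact: measurable_funM.
have [|||iL _ cL] := @dominated_convergence _ _ _ mu setT measurableT
  (fun N => EFin \o f N) (EFin \o (fun x => g (s * a x) * k x)) _ mf _ _ (ik `|s| (normr_ge0 s)) _.
- exact/measurable_EFinP.
- apply: aeW => x _; apply: cvg_EFin; first exact: nearW.
  by apply: cvgM; [exact: Cc|exact: cvg_cst].
- apply: aeW => x N _; rewrite lee_fin normrM -sa ler_wpM2r//.
  exact: exp_type_partial_le gC.
split => //.
have -> : series (fun n => (\int[mu]_x (C n * a x ^+ n * k x)) * s ^+ n) =
    (fun N => \int[mu]_x f N x).
  apply/funext => N; rewrite fE Rintegral_sumR; last first.
    by move=> i; exact: integrable_scaleR.
  rewrite /series/= big_mkord; apply: eq_bigr => i _.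
  by rewrite RintegralZl// mulrC.
apply: fine_cvg; rewrite -/(Rintegral _ _ _) EFin_Rintegral//.
Qed.

End exp_series.

(** * Injectivity of the Fourier transform *)

Section trig_integrals.
Context {R : realType} {d : measure_display} {T : measurableType d}.
Variable mu : {measure set T -> \bar R}.
Implicit Types a k : T -> R.

Lemma measurable_cos : measurable_fun [set: R] cos.
Proof. exact: continuous_measurable_fun (@continuous_cos R). Qed.

Lemma measurable_sin : measurable_fun [set: R] sin.
Proof. exact: continuous_measurable_fun (@continuous_sin R). Qed.

Lemma trig_mix_le (t x y : R) :
  `|cos t * x + sin t * y| <= `|x| + `|y| /\
  `|- sin t * x + cos t * y| <= `|x| + `|y|.
Proof.
split; apply: le_trans (ler_normD _ _) _; rewrite !normrM ?normrN;
  apply: lerD; rewrite ler_piMl// ?cos_max ?sin_max//.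
Qed.

(** By the addition formulas, moving the center from 0 to t0 replaces (k1, k2) by
    their rotation by the angle t0 * a, which has the same integrability, so it
    is enough to expand at 0. *)
Lemma entire_integral_trig a k1 k2 :
  exp_integrable mu a k1 -> exp_integrable mu a k2 ->
  entire (fun t => \int[mu]_x (cos (t * a x) * k1 x + sin (t * a x) * k2 x)).
Proof.
move=> /[dup] h1 [ma mk1 _] /[dup] h2 [_ mk2 _] t0.
have mta : measurable_fun setT (fun x => t0 * a x) by exact: measurable_funM.
have mc : measurable_fun setT (fun x => cos (t0 * a x)).
  by apply: measurableT_comp => //; exact: measurable_cos.
have ms : measurable_fun setT (fun x => sin (t0 * a x)).
  by apply: measurableT_comp => //; exact: measurable_sin.
have h1' : exp_integrable mu a (fun x => cos (t0 * a x) * k1 x + sin (t0 * a x) * k2 x).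
  apply: exp_integrable_le h1 h2 _ _; last by move=> x; have [] := trig_mix_le (t0 * a x) (k1 x) (k2 x).
  by apply: measurable_funD; exact: measurable_funM.
have h2' : exp_integrable mu a (fun x => - sin (t0 * a x) * k1 x + cos (t0 * a x) * k2 x).
  apply: exp_integrable_le h1 h2 _ _; last by move=> x; have [] := trig_mix_le (t0 * a x) (k1 x) (k2 x).
  by apply: measurable_funD; apply: measurable_funM => //; exact: measurable_funN.
have [c cP] := integral_exp_type exp_type_cos h1'.
have [c' cP'] := integral_exp_type exp_type_sin h2'.
exists (fun n => c n + c' n) => s.
have [ic cc] := cP s; have [ic' cc'] := cP' s.
rewrite (_ : Rintegral _ _ _ =
   \int[mu]_x (cos (s * a x) * (cos (t0 * a x) * k1 x + sin (t0 * a x) * k2 x)) +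
   \int[mu]_x (sin (s * a x) * (- sin (t0 * a x) * k1 x + cos (t0 * a x) * k2 x))).
  rewrite (_ : series _ = (series (fun n => c n * s ^+ n) \+ series (fun n => c' n * s ^+ n))).
    exact: cvgD.
  apply/funext => N; rewrite /series /= -big_split/=; apply: eq_bigr => i _.
  by rewrite mulrDl.
rewrite -RintegralD//; apply: eq_Rintegral => x _.
by rewrite mulrDl sinD cosD; ring.
Qed.

Variables (n : nat) (u : 'I_n -> T -> R).
Definition phase (p : 'rV[R]_n) x : R := \sum_j p ord0 j * u j x.

Lemma phaseD p t j x :
  phase (p + t *: delta_mx ord0 j) x = phase p x + t * u j x.
Proof.
rewrite /phase (eq_bigr (fun i => p ord0 i * u i x + t * (i == j)%:R * u i x)).
  2: by move=> i _; rewrite !mxE mulrDl.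
rewrite big_split/=; congr (_ + _); rewrite (bigD1 j)//= eqxx mulr1.
by rewrite big1 ?addr0// => i ij; rewrite (negbTE ij) mulr0 mul0r.
Qed.

(** Along the j-th axis the phase is phase p + t * u j, so the rotation argument of
    entire_integral_trig applies with a = u j. *)
Lemma sep_entire_integral_trig k1 k2 :
  (forall j, exp_integrable mu (u j) k1) ->
  (forall j, exp_integrable mu (u j) k2) ->
  sep_entire (fun p =>
    \int[mu]_x (cos (phase p x) * k1 x + sin (phase p x) * k2 x)).
Proof.
move=> h1 h2 j p.
have [[_ mk1 _] [_ mk2 _]] := (h1 j, h2 j).
have mp : measurable_fun setT (phase p).
  apply: measurable_sum => i; apply: measurable_funM => //.
  by have [] := h1 i.
have mc : measurable_fun setT (fun x => cos (phase p x)).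
  by apply: measurableT_comp => //; exact: measurable_cos.
have ms : measurable_fun setT (fun x => sin (phase p x)).
  by apply: measurableT_comp => //; exact: measurable_sin.
have h1' : exp_integrable mu (u j) (fun x => cos (phase p x) * k1 x + sin (phase p x) * k2 x).
  apply: exp_integrable_le (h1 j) (h2 j) _ _; last by move=> x; have [] := trig_mix_le (phase p x) (k1 x) (k2 x).
  by apply: measurable_funD; exact: measurable_funM.
have h2' : exp_integrable mu (u j) (fun x => - sin (phase p x) * k1 x + cos (phase p x) * k2 x).
  apply: exp_integrable_le (h1 j) (h2 j) _ _; last by move=> x; have [] := trig_mix_le (phase p x) (k1 x) (k2 x).
  by apply: measurable_funD; apply: measurable_funM => //; exact: measurable_funN.
have := entire_integral_trig h1' h2'; congr entire; apply/funext => t.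
apply: eq_Rintegral => x _.
by rewrite phaseD sinD cosD; ring.
Qed.

End trig_integrals.

Section sine_limit.
Context {R : realType}.

Lemma cvg_sin_scaled (t : R) : m.+1%:R * sin (t / m.+1%:R) @[m --> \oo] --> t.
Proof.
have [->|t0] := eqVneq t 0.
  by under eq_fun do rewrite mul0r sin0 mulr0; exact: cvg_cst.
have h0 : (t / m.+1%:R) @[m --> \oo] --> (0 : R).
  by rewrite -[X in _ --> X](mulr0 t); apply: cvgM; [exact: cvg_cst|exact: cvg_harmonic].
have dsin : h^-1 * sin h @[h --> (0 : R)^'] --> (1 : R).
  have := @derivable_sin R 0; rewrite /derivable => /cvg_ex[l lP].
  have : 'D_1 (@sin R) 0 = l by apply: cvg_lim lP => //; exact: Rhausdorff.
  rewrite derive_val cos0 => l1; rewrite -l1 in lP; move: lP.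
  apply: cvg_trans; apply: near_eq_cvg; near=> h => /=.
  by rewrite sin0 subr0 addr0 [_ *: 1]mulr1.
rewrite -[X in _ --> X](mulr1 t).
rewrite (_ : (fun m => _) = (fun m : nat => t * ((t / m.+1%:R)^-1 * sin (t / m.+1%:R)))); last first.
  by apply/funext => m; rewrite mulrA invfM invrK mulrA divff// mul1r.
apply: cvgM; first exact: cvg_cst.
apply/cvgrPdist_lt => e e0.
have /cvgrPdist_lt/(_ e e0) := dsin.
rewrite near_withinE => /nbhs_ballP[dl /= dl0 dlP].
have /cvgr0Pnorm_lt/(_ dl dl0) := h0.
apply: filterS => m hm; apply: dlP.
  by rewrite /ball/= sub0r normrN.
by rewrite /= mulf_neq0 ?invr_eq0 ?pnatr_eq0.
Unshelve. all: by end_near. Qed.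

(** The pointwise limit of exp (- exp (- m y)) as m grows: the indicator function of
    the positive half-line, up to its value at 0. *)
Definition soft_step (y : R) : R :=
  if 0 < y then 1 else if y == 0 then expR (- 1) else 0.

Lemma cvg_expR_Nmul (y : R) : 0 < y -> expR (- (m%:R * y)) @[m --> \oo] --> (0 : R).
Proof.
move=> y0; apply: (@squeeze_cvgr _ _ _ _ (cst 0) (fun m : nat => y^-1 * m%:R^-1)).
- exists 1%N => // m /= m1; rewrite expR_ge0/= expRN -invfM mulrC.
  rewrite lef_pV2 ?posrE ?expR_gt0 ?mulr_gt0 ?ltr0n//.
  by apply: le_trans (expR_ge1Dx _); rewrite lerDr.
- exact: cvg_cst.
rewrite -[X in _ --> X](mulr0 y^-1); apply: cvgM; first exact: cvg_cst.
by rewrite -cvg_shiftS; exact: cvg_harmonic.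
Qed.

Lemma cvg_soft_step (y : R) :
  expR (- expR (- (m%:R * y))) @[m --> \oo] --> soft_step y.
Proof.
rewrite /soft_step; case: ltgtP => [y0|y0|<-].
- rewrite -[X in _ --> X]expR0 -oppr0; apply: continuous_cvg.
    exact: continuous_expR.
  by apply: cvgN; exact: cvg_expR_Nmul.
- apply: (@squeeze_cvgr _ _ _ _ (cst 0) (fun m : nat => expR (- (m%:R * - y)))).
  + apply: nearW => m; rewrite expR_ge0/= ler_expR lerN2 mulrN.
    by apply: le_trans (expR_ge1Dx _); rewrite lerDr.
  + exact: cvg_cst.
  + by apply: cvg_expR_Nmul; rewrite oppr_gt0.
- by under eq_fun do rewrite mulr0 oppr0 expR0; exact: cvg_cst.
Qed.

Lemma soft_step_ge0 y : 0 <= soft_step y.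
Proof. by rewrite /soft_step; case: ifP => // _; case: ifP => // _; rewrite expR_ge0. Qed.

End sine_limit.

Section fourier_injectivity.
Context {R : realType} {n : nat}.
Local Notation mu := (@lebesgue_rV R n).
Variable k : 'rV[R]_n -> R.
Hypothesis ik : mu.-integrable setT (EFin \o k).

Local Notation dot := (phase (fun j (x : 'rV[R]_n) => x ord0 j)).

(** The bounded functions K for which K k has zero Fourier transform.  Real
    integrals with an arbitrary phase th stand for the complex exponential. *)
Let annihilated (K : 'rV[R]_n -> R) := [/\ measurable_fun setT K,
  exists M : R, forall x, `|K x| <= M &
  forall s (th : R), \int[mu]_x (cos (dot s x + th) * (K x * k x)) = 0].

Lemma measurable_dot s : measurable_fun setT (dot s).
Proof.
by apply: measurable_sum => i; apply: measurable_funM => //; exact: measurable_coord.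
Qed.

Let measurable_cosdot s th : measurable_fun setT (fun x => cos (dot s x + th)).
Proof.
apply: measurableT_comp; first exact: measurable_cos.
by apply: measurable_funD => //; exact: measurable_dot.
Qed.

Let mk : measurable_fun setT k := measurable_integrand ik.

Let integrable_cosK s th (K : 'rV[R]_n -> R) (M : R) : measurable_fun setT K ->
  (forall x, `|K x| <= M) ->
  mu.-integrable setT (EFin \o (fun x => cos (dot s x + th) * (K x * k x))).
Proof.
move=> mK KM; apply: integrable_leR (integrable_scaleR M (integrable_norm ik)).
  by apply: measurable_funM => //; exact: measurable_funM.
move=> x; rewrite !normrM; apply: le_trans (_ : 1 * (`|K x| * `|k x|) <= _).
  by rewrite ler_wpM2r ?cos_max// mulr_ge0.
by rewrite mul1r ler_wpM2r.
Qed.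

Let annihilated_lim (K_ : nat -> 'rV[R]_n -> R) K (M : R) :
  (forall m, annihilated (K_ m)) -> (forall m x, `|K_ m x| <= M) ->
  (forall x, K_ m x @[m --> \oo] --> K x) -> annihilated K.
Proof.
move=> aK KM cK.
have mK_ m : measurable_fun setT (K_ m) by have [] := aK m.
have mK : measurable_fun setT K by exact: (measurable_fun_cvg mK_ (fun x _ => cK x)).
have KM' x : `|K x| <= M.
  by apply: (ler_cvg_to (cvg_norm (cK x)) (cvg_cst _)); exact: nearW.
split => //; first by exists M.
move=> s th.
pose f m x := cos (dot s x + th) * (K_ m x * k x).
have mf m : measurable_fun setT (EFin \o f m).
  apply/measurable_EFinP; apply: measurable_funM => //.
  exact: measurable_funM.
have [|||_ _ cL] := @dominated_convergence _ _ _ mu setT measurableT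
  (fun m => EFin \o f m) (EFin \o (fun x => cos (dot s x + th) * (K x * k x)))
  _ mf _ _ (integrable_scaleR M (integrable_norm ik)) _.
- by apply/measurable_EFinP; apply: measurable_funM => //; exact: measurable_funM.
- apply: aeW => x _; apply: cvg_EFin; first exact: nearW.
  apply: cvgM; first exact: cvg_cst.
  by apply: cvgM => //; exact: cvg_cst.
- apply: aeW => x N _; rewrite lee_fin !normrM.
  apply: le_trans (_ : 1 * (`|K_ N x| * `|k x|) <= _).
    by rewrite ler_wpM2r ?cos_max// mulr_ge0.
  by rewrite mul1r ler_wpM2r.
apply: EFin_inj; rewrite EFin_Rintegral; last exact: integrable_cosK KM'.
apply: cvg_unique cL _ => //=.
rewrite (_ : (fun m => _) = cst 0%E); first exact: cvg_cst.
apply/funext => m; have [_ _ K0] := aK m.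
have := congr1 EFin (K0 s th).
by rewrite EFin_Rintegral//; exact: integrable_cosK (KM m).
Qed.

Let annihilated_lin c1 c2 K1 K2 : annihilated K1 -> annihilated K2 ->
  annihilated (fun x => c1 * K1 x + c2 * K2 x).
Proof.
move=> [mK1 [M1 KM1] K01] [mK2 [M2 KM2] K02]; split.
- by apply: measurable_funD; exact: measurable_funM.
- exists (`|c1| * M1 + `|c2| * M2) => x; apply: le_trans (ler_normD _ _) _.
  by rewrite !normrM lerD// ler_wpM2l.
move=> s th; rewrite (_ : (fun x => _) = (fun x =>
  c1 * (cos (dot s x + th) * (K1 x * k x)) + c2 * (cos (dot s x + th) * (K2 x * k x)))); last first.
  by apply/funext => x; ring.
have i1 := integrable_cosK s th mK1 KM1; have i2 := integrable_cosK s th mK2 KM2.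
rewrite Rintegral_addR; [|exact: integrable_scaleR..].
by rewrite !RintegralZl// K01 K02 !mulr0 addr0.
Qed.

(** The product of two cosines is a sum of two cosines with shifted frequencies. *)
Let annihilated_cos (j : 'I_n) s th K : annihilated K ->
  annihilated (fun x => cos (s * x ord0 j + th) * K x).
Proof.
move=> [mK [M KM] K0]; split.
- apply: measurable_funM => //; apply: measurableT_comp; first exact: measurable_cos.
  by apply: measurable_funD => //; apply: measurable_funM => //; exact: measurable_coord.
- exists M => x; rewrite normrM; apply: le_trans (KM x).
  by rewrite ler_piMl ?cos_max.
move=> s' th'.
pose p := s' + s *: delta_mx ord0 j; pose q := s' + (- s) *: delta_mx ord0 j.
rewrite (_ : (fun x => _) = (fun x =>
    2^-1 * (cos (dot p x + (th' + th)) * (K x * k x)) +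
    2^-1 * (cos (dot q x + (th' - th)) * (K x * k x)))); last first.
  apply/funext => x; rewrite /p /q !phaseD.
  have -> : dot s' x + s * x ord0 j + (th' + th) =
    (dot s' x + th') + (s * x ord0 j + th) by ring.
  have -> : dot s' x + - s * x ord0 j + (th' - th) =
    (dot s' x + th') - (s * x ord0 j + th) by ring.
  move: (dot s' x + th') (s * x ord0 j + th) => a b.
  by rewrite cosD cosB; field.
rewrite Rintegral_addR; [|apply: integrable_scaleR; exact: integrable_cosK KM..].
by rewrite !RintegralZl ?K0 ?mulr0 ?addr0//; exact: integrable_cosK KM.
Qed.

(** The functions g of one coordinate such that multiplication by g preserves
    annihilated functions.  They form an algebra, closed under bounded pointwise
    limits, which contains the functions cos (s t + th), and therefore also
    steps. *)
Let multiplier (j : 'I_n) (g : R -> R) :=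
  (exists M : R, forall t, `|g t| <= M) /\
  forall K, annihilated K -> annihilated (fun x => g (x ord0 j) * K x).

Let multiplier_lin j c1 c2 g1 g2 : multiplier j g1 -> multiplier j g2 ->
  multiplier j (fun t => c1 * g1 t + c2 * g2 t).
Proof.
move=> [[M1 gM1] g1P] [[M2 gM2] g2P]; split.
  exists (`|c1| * M1 + `|c2| * M2) => x; apply: le_trans (ler_normD _ _) _.
  by rewrite !normrM lerD// ler_wpM2l.
move=> K aK; have := annihilated_lin c1 c2 (g1P _ aK) (g2P _ aK).
by congr annihilated; apply/funext => x; ring.
Qed.

Let multiplier_mul j g1 g2 : multiplier j g1 -> multiplier j g2 ->
  multiplier j (fun t => g1 t * g2 t).
Proof.
move=> [[M1 gM1] g1P] [[M2 gM2] g2P]; split.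
  by exists (M1 * M2) => x; rewrite normrM ler_pM.
move=> K aK; have := g1P _ (g2P _ aK).
by congr annihilated; apply/funext => x; ring.
Qed.

Let multiplier_lim j (g_ : nat -> R -> R) g (M : R) :
  (forall m, multiplier j (g_ m)) -> (forall m t, `|g_ m t| <= M) ->
  (forall t, g_ m t @[m --> \oo] --> g t) -> multiplier j g.
Proof.
move=> mg gM cg; split.
  by exists M => t; apply: (ler_cvg_to (cvg_norm (cg t)) (cvg_cst _)); exact: nearW.
move=> K aK; have [_ [M' KM'] _] := aK.
apply: (@annihilated_lim (fun m x => g_ m (x ord0 j) * K x) _ (M * M')).
- by move=> m; exact: (mg m).2.
- by move=> m x; rewrite normrM ler_pM.
- by move=> x; apply: cvgM; [exact: cg|exact: cvg_cst].
Qed.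

Let multiplier1 j : multiplier j (cst 1).
Proof.
split; first by exists 1 => t; rewrite normr1.
by move=> K; congr annihilated; apply/funext => x; rewrite /= mul1r.
Qed.

Let multiplier_cos j s th : multiplier j (fun t => cos (s * t + th)).
Proof.
split; first by exists 1 => t; exact: cos_max.
by move=> K; exact: annihilated_cos.
Qed.

(** The exponential series of a bounded function converges boundedly. *)
Let multiplier_expR j g : multiplier j g -> multiplier j (fun t => expR (g t)).
Proof.
move=> /[dup] mg [[M gM] _].
have mX m : multiplier j (fun t => g t ^+ m).
  elim: m => [|m ih]; first by under eq_fun do rewrite expr0; exact: multiplier1.
  by under eq_fun do rewrite exprS; exact: multiplier_mul.
apply: (@multiplier_lim j (fun N t => series (fun m => (m`!%:R)^-1 * g t ^+ m) N)
    _ (expR M)).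
- elim=> [|N ih].
    rewrite (_ : (fun t => _) = (fun t => 0 * cst 1 t + 0 * cst 1 t)).
      by apply: multiplier_lin; exact: multiplier1.
    by apply/funext => t; rewrite /series/= big_geq// !mul0r addr0.
  have := multiplier_lin 1 (N`!%:R)^-1 ih (mX N); congr multiplier.
  by apply/funext => t; rewrite /series/= big_nat_recr//= mul1r.
- move=> N t; apply: le_trans (exp_type_partial_le _ _ (@exp_type_expR R)) _.
  by rewrite ler_expR.
- by move=> t; have [_] := @exp_type_expR R; exact.
Qed.

(** The function c * (t - a) is unbounded, hence not itself a multiplier; it is the
    limit of the multiples c * m * sin ((t - a) / m) of a sine, and the outer
    function exp (- exp _) is bounded by 1, so the limit is a bounded one. *)
Let multiplier_soft_sigmoid j c a :
  multiplier j (fun t => expR (- expR (c * (t - a)))).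
Proof.
apply: (@multiplier_lim j
  (fun m t => expR (- expR (c * (m.+1%:R * sin ((t - a) / m.+1%:R))))) _ 1).
- move=> m; apply: multiplier_expR.
  have ms : multiplier j (fun t => sin ((t - a) / m.+1%:R)).
    have := multiplier_cos j m.+1%:R^-1 (- a / m.+1%:R - pi / 2).
    congr multiplier; apply/funext => t.
    by rewrite addrA cosBpihalf; congr sin; rewrite mulrC mulrBl mulNr.
  have mcs : multiplier j (fun t => c * (m.+1%:R * sin ((t - a) / m.+1%:R))).
    have := multiplier_lin (c * m.+1%:R) 0 ms ms; congr multiplier.
    by apply/funext => t; rewrite mul0r addr0 mulrA.
  have me := multiplier_expR mcs.
  have := multiplier_lin (-1) 0 me me; congr multiplier.
  by apply/funext => t; rewrite mul0r addr0 mulN1r.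
- by move=> m t; rewrite ger0_norm ?expR_ge0// -[leRHS]expR0 ler_expR.
- move=> t; apply: continuous_cvg; first exact: continuous_expR.
  apply: cvgN; apply: continuous_cvg; first exact: continuous_expR.
  by apply: cvgM; [exact: cvg_cst|exact: cvg_sin_scaled].
Qed.

Let multiplier_step_up j a : multiplier j (fun t => soft_step (t - a)).
Proof.
apply: (@multiplier_lim j (fun m t => expR (- expR (- (m%:R * (t - a))))) _ 1).
- move=> m; have := multiplier_soft_sigmoid j (- m%:R) a; congr multiplier.
  by apply/funext => t; rewrite mulNr.
- by move=> m t; rewrite ger0_norm ?expR_ge0// -[leRHS]expR0 ler_expR.
- by move=> t; exact: cvg_soft_step.
Qed.

Let multiplier_step_down j b : multiplier j (fun t => soft_step (b - t)).
Proof.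
apply: (@multiplier_lim j (fun m t => expR (- expR (- (m%:R * (b - t))))) _ 1).
- move=> m; have := multiplier_soft_sigmoid j m%:R b; congr multiplier.
  by apply/funext => t; rewrite -mulrN opprB.
- by move=> m t; rewrite ger0_norm ?expR_ge0// -[leRHS]expR0 ler_expR.
- by move=> t; exact: cvg_soft_step.
Qed.

Hypothesis k_hat0 : forall s th, \int[mu]_x (cos (dot s x + th) * k x) = 0.

(** Close to the indicator function of the interval of radius e around the j-th
    coordinate of x0. *)
Let window (x0 : 'rV[R]_n) (e t : R) (j : 'I_n) : R :=
  soft_step (t - (x0 ord0 j - e)) * soft_step (x0 ord0 j + e - t).

Let annihilated_window x0 e (s : seq 'I_n) :
  annihilated (fun x => \prod_(j <- s) window x0 e (x ord0 j) j).
Proof.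
elim: s => [|j s ih].
  under eq_fun do rewrite big_nil; split; first exact: measurable_cst.
    by exists 1 => x; rewrite normr1.
  by move=> s th; under eq_Rintegral do rewrite mul1r; exact: k_hat0.
under eq_fun do rewrite big_cons.
have := multiplier_mul (multiplier_step_up j (x0 ord0 j - e))
  (multiplier_step_down j (x0 ord0 j + e)).
by move=> [_]; exact.
Qed.

(** If k x0 > 0, then k > k x0 / 2 on a small closed box around x0.  The product
    of the windows is annihilated, nonnegative, equal to 1 inside the box and to 0
    outside it; the integral of k against it would be both zero and positive. *)
Lemma fourier_injective_le0 : continuous k -> forall x0, k x0 <= 0.
Proof.
move=> ck x0; rewrite leNgt; apply/negP => k0.
have [e e0 ek] : exists2 e : R, 0 < e &
    forall y : 'rV[R]_n, (forall j, `|y ord0 j - x0 ord0 j| <= e) -> k x0 / 2 <= k y.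
  have : \forall y \near x0, k x0 / 2 < k y.
    have : k x0 / 2 < k x0 by lra.
    by move=> kk; apply: (cvgr_gt _ (ck x0)).
  move=> /nbhs_ballP[e /= e0 eP]; exists (e / 2); first by rewrite divr_gt0.
  move=> y ye; apply: ltW; apply: eP; split => // i j; rewrite (ord1 i).
  rewrite /ball/= distrC; apply: le_lt_trans (ye j) _; lra.
pose K (x : 'rV[R]_n) := \prod_(j : 'I_n) window x0 e (x ord0 j) j.
have [mK [M KM] K0] := annihilated_window x0 e (index_enum 'I_n).
have w01 t j : 0 <= window x0 e t j by rewrite mulr_ge0 ?soft_step_ge0.
have KE : \int[mu]_x (K x * k x) = 0.
  rewrite -(K0 0 0); apply: eq_Rintegral => x _.
  by rewrite addr0 /phase big1 ?cos0 ?mul1r// => i _; rewrite mxE mul0r.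
have iKk : mu.-integrable setT (EFin \o (fun x => K x * k x)).
  apply: eq_integrable (integrable_cosK 0 0 mK KM) => // x _ /=.
  by rewrite addr0 /phase big1 ?cos0 ?mul1r// => i _; rewrite mxE mul0r.
pose B : set 'rV[R]_n := [set x | forall i, `]x0 ord0 i - e, x0 ord0 i + e[%classic (x ord0 i)].
have mB : measurable B.
  have -> : B = \bigcap_(i in setT) (fun v : 'rV[R]_n => v ord0 i) @^-1`
      `]x0 ord0 i - e, x0 ord0 i + e[%classic.
    by apply/seteqP; split=> v /= vE i *; exact: vE.
  apply: fin_bigcap_measurable => // i _.
  rewrite -[X in measurable X]setTI; exact: (measurable_coord i).
have muB : mu B = ((2 * e) ^+ n)%:E.
  rewrite /B (lebesgue_rV_box (E := fun i => `]x0 ord0 i - e, x0 ord0 i + e[%classic)).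
    rewrite (eq_bigr (fun=> (2 * e)%:E)); last first.
      move=> i _; rewrite lebesgue_measure_itv/= lte_fin ifT; last by lra.
      by rewrite -EFinB; congr EFin; lra.
    by rewrite prodEFin prodr_const card_ord.
  by move=> i; exact: measurable_itv.
have iB : mu.-integrable setT (EFin \o (fun x => k x0 / 2 * \1_B x)).
  apply: integrable_scaleR; apply/integrableP; split.
    by apply/measurable_EFinP; exact: measurable_indic.
  under eq_integral do rewrite gee0_abs ?lee_fin//=.
  by rewrite integral_indic// setIT [X in (X < _)%E]muB ltry.
have : \int[mu]_x (k x0 / 2 * \1_B x) <= \int[mu]_x (K x * k x).
  apply: le_Rintegral => // x _; rewrite indicE.
  have [Bx|nBx] := boolP (x \in B).
    move: Bx; rewrite inE /B/= => Bx; rewrite mulr1.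
    rewrite /K big1 ?mul1r.
      apply: ek => j; have := Bx j; rewrite /= in_itv/= ler_distlC.
      by move=> /andP[h1 h2]; apply/andP; split; lra.
    move=> j _; have := Bx j; rewrite /= in_itv/= => /andP[h1 h2].
    by rewrite /window /soft_step ifT ?ifT ?mulr1//; lra.
  rewrite mulr0.
  have [xe|/existsNP[j xj]] := pselect (forall j, `|x ord0 j - x0 ord0 j| <= e).
    rewrite mulr_ge0//; first by apply: prodr_ge0.
    by apply: le_trans (ek x xe); lra.
  rewrite /K (bigD1 j)//= (_ : window _ _ _ _ = 0) ?mul0r//.
  have soft0 y : y < 0 -> soft_step y = 0.
    by move=> y0; rewrite /soft_step ltNge ltW//= (lt_eqF y0).
  move/negP : xj; rewrite -ltNge lter_normr => /orP[h|h].
    by rewrite /window [X in _ * X]soft0 ?mulr0//; lra.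
  by rewrite /window [X in X * _]soft0 ?mul0r//; lra.
rewrite KE RintegralZl//; last first.
  apply/integrableP; split; first by apply/measurable_EFinP; exact: measurable_indic.
  under eq_integral do rewrite gee0_abs ?lee_fin//=.
  by rewrite integral_indic// setIT [X in (X < _)%E]muB ltry.
rewrite /Rintegral integral_indic// setIT [X in fine X]muB/= leNgt => /negP; apply.
by rewrite mulr_gt0 ?exprn_gt0 ?mulr_gt0 ?divr_gt0.
Qed.

End fourier_injectivity.

(** By fourier_injective_le0 for k and for - k.  Bounded limits of trigonometric
    polynomials take the place of an inversion formula. *)
Lemma fourier_injective (R : realType) n (k : 'rV[R]_n -> R) :
  (@lebesgue_rV R n).-integrable setT (EFin \o k) -> continuous k ->
  (forall s th, \int[@lebesgue_rV R n]_x
    (cos (phase (fun j (x : 'rV[R]_n) => x ord0 j) s x + th) * k x) = 0) ->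
  forall x, k x = 0.
Proof.
move=> ik ck k0 x; apply/eqP; rewrite eq_le fourier_injective_le0//=.
have ikN : (@lebesgue_rV R n).-integrable setT (EFin \o (fun x => - k x)).
  apply: integrable_leR (integrable_norm ik) => [|y /=]; last by rewrite normrN.
  exact: measurable_funN (measurable_integrand ik).
rewrite -oppr_le0; apply: (@fourier_injective_le0 _ _ (fun x => - k x)) => //.
- move=> s th; under eq_Rintegral do rewrite mulrN -mulN1r.
  rewrite RintegralZl ?k0 ?mulr0//.
  apply: integrable_leR (integrable_norm ik).
    apply: measurable_funM; last exact: measurable_integrand ik.
    apply: measurableT_comp; first exact: measurable_cos.
    by apply: measurable_funD => //; exact: measurable_dot.
  by move=> y; rewrite normrM ler_piMl ?cos_max.
- by move=> y; have := cvgN (ck y); exact.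
Qed.

(** * Partial derivatives and integrals of derivatives *)

Section directional_derivatives.
Context {R : realType} {n : nat}.
Implicit Types (f g : 'rV[R]_n -> R) (x v : 'rV[R]_n).

(** Reduces directional derivatives to derivatives of functions of one variable. *)
Lemma is_derive_line f x v (l : R) :
  is_derive x v f l <-> is_derive (0 : R) 1 (fun t : R => f (x + t *: v)) l.
Proof.
have E : (fun h : R => h^-1 *: ((f \o shift x) (h *: v) - f x)) =
  (fun h : R => h^-1 *: (((fun t : R => f (x + t *: v)) \o shift 0) (h *: (1 : R)) - f (x + 0 *: v))).
  apply/funext => h /=; rewrite scale0r addr0 addr0.
  by rewrite [h *: (1 : R)]mulr1 [x + _]addrC.
by split=> -[d1 d2]; split; move: d1 d2; rewrite /derivable /derive E.
Qed.

Lemma is_derive_lineS f x v (l : R) (t : R) :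
  is_derive (x + t *: v) v f l -> is_derive t 1 (fun s : R => f (x + s *: v)) l.
Proof.
have E : (fun h : R => h^-1 *: ((f \o shift (x + t *: v)) (h *: v) - f (x + t *: v))) =
  (fun h : R => h^-1 *: (((fun s : R => f (x + s *: v)) \o shift t) (h *: (1 : R)) - f (x + t *: v))).
  apply/funext => h /=; rewrite [h *: (1 : R)]mulr1.
  by rewrite scalerDl addrCA.
by move=> -[d1 d2]; split; move: d1 d2; rewrite /derivable /derive E.
Qed.

(** The relational form of partial: the derivative is exhibited, so existence and
    value are obtained together by the rules of calculus. *)
Definition has_partial (j : 'I_n) f f' :=
  forall x, is_derive x (delta_mx ord0 j : 'rV[R]_n) f (f' x).

Lemma has_partialD j f f' g g' : has_partial j f f' -> has_partial j g g' ->
  has_partial j (fun x => f x + g x) (fun x => f' x + g' x).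
Proof. by move=> hf hg x; apply: is_deriveD. Qed.

Lemma has_partialM j f f' g g' : has_partial j f f' -> has_partial j g g' ->
  has_partial j (fun x => f x * g x) (fun x => f' x * g x + f x * g' x).
Proof.
move=> hf hg x; rewrite addrC [f' x * _]mulrC.
exact: (is_deriveM (hf x) (hg x)).
Qed.

Lemma has_partial_cst j c : has_partial j (fun=> c) (fun=> 0).
Proof. by move=> x; exact: is_derive_cst. Qed.

Lemma has_partialZ j c f f' : has_partial j f f' ->
  has_partial j (fun x => c * f x) (fun x => c * f' x).
Proof.
move=> hf; have := has_partialM (has_partial_cst j c) hf.
by under [X in has_partial _ _ X -> _]eq_fun do rewrite mul0r add0r.
Qed.

Lemma has_partial_coord j k :
  has_partial j (fun x => x ord0 k) (fun=> (k == j)%:R).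
Proof.
move=> x; apply/is_derive_line.
under eq_fun do rewrite !mxE eqxx andTb.
have := is_deriveD (is_derive_cst (x ord0 k) (0 : R) (1 : R))
  (is_deriveZ ((k == j)%:R : R) (is_derive_id (0 : R) (1 : R))).
rewrite add0r [X in is_derive _ _ _ X]mulr1; congr is_derive.
by apply/funext => t; rewrite /= mulrC.
Qed.

Lemma has_partial_comp j f f' (g g' : R -> R) : has_partial j f f' ->
  (forall t : R, is_derive t 1 g (g' t)) ->
  has_partial j (fun x => g (f x)) (fun x => g' (f x) * f' x).
Proof.
move=> hf hg x; apply/is_derive_line.
have /is_derive_line h := hf x.
have := @is_derive1_comp _ g (fun t : R => f (x + t *: delta_mx ord0 j)) 0 _ _ (hg _) h.
by rewrite scale0r addr0.
Qed.

Lemma has_partial_sum j (I : Type) (s : seq I) (F F' : I -> 'rV[R]_n -> R) :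
  (forall i, has_partial j (F i) (F' i)) ->
  has_partial j (fun x => \sum_(i <- s) F i x) (fun x => \sum_(i <- s) F' i x).
Proof.
move=> hF; elim: s => [|i s ih].
  rewrite (_ : (fun x => _) = fun=> 0); last by apply/funext => x; rewrite big_nil.
  rewrite (_ : (fun x => \sum_(i <- [::]) F' i x) = fun=> 0).
    exact: has_partial_cst.
  by apply/funext => x; rewrite big_nil.
rewrite (_ : (fun x => _) = fun x => F i x + \sum_(i <- s) F i x).
  rewrite (_ : (fun x => \sum_(i <- i :: s) F' i x) = fun x => F' i x + \sum_(i <- s) F' i x).
    exact: has_partialD.
  by apply/funext => x; rewrite big_cons.
by apply/funext => x; rewrite big_cons.
Qed.

Lemma has_partial_shift j f f' q : has_partial j f f' ->
  has_partial j (fun x => f (x - q)) (fun x => f' (x - q)).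
Proof.
move=> hf x; apply/is_derive_line; have /is_derive_line := hf (x - q).
by under eq_fun do rewrite addrAC.
Qed.

Lemma partialE j f f' : has_partial j f f' -> partial j f = f'.
Proof. by move=> hf; apply/funext => x; have [_ <-] := hf x. Qed.

Lemma has_partial_partial j f : (forall x, derivable f x (delta_mx ord0 j)) ->
  has_partial j f (partial j f).
Proof. by move=> df x; exact: DeriveDef. Qed.

End directional_derivatives.

Section integral_of_derivative.
Context {R : realType}.
Local Notation leb := (@lebesgue_measure R).

Lemma bounded_oneDsqr_cvg0 (g : R -> R) (C : R) (u : nat -> R) :
  (forall t, `|g t| * (1 + t ^+ 2) <= C) -> (forall m, `|u m| = m.+1%:R) ->
  g (u m) @[m --> \oo] --> (0 : R).
Proof.
move=> gC um; apply/cvgr0Pnorm_le => e e0.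
have h : (C * m.+1%:R^-1) @[m --> \oo] --> (0 : R).
  rewrite -[X in _ --> X](mulr0 C); apply: cvgM; first exact: cvg_cst.
  exact: cvg_harmonic.
have /cvgr0Pnorm_le/(_ e e0) := h; apply: filterS => m; apply: le_trans.
apply: le_trans (ler_norm _); rewrite ler_pdivlMr//.
apply: le_trans (gC (u m)); rewrite ler_wpM2l// -real_normK ?num_real// um.
by rewrite -natrX ler_wpDl// ler_nat expnS leq_pmulr.
Qed.

(** The fundamental theorem of calculus on [- m, m]: the boundary terms tend to 0
    because g is O(1/(1 + t^2)), and the integrals converge by domination. *)
Lemma integral_derive0 (g g' : R -> R) (C : R) :
  (forall t : R, is_derive t 1 g (g' t)) -> continuous g' ->
  (forall t, `|g t| * (1 + t ^+ 2) <= C) ->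
  (forall t, `|g' t| * (1 + t ^+ 2) <= C) ->
  (\int[leb]_t (g' t)%:E = 0)%E.
Proof.
move=> dg cg' gC g'C.
have cg : continuous g.
  move=> t; apply: differentiable_continuous; apply/derivable1_diffP.
  exact: ex_derive.
have mg' : measurable_fun setT g' by exact: continuous_measurable_fun.
have ig' : leb.-integrable setT (EFin \o (fun t => C * (1 + t ^+ 2)^-1)).
  exact: integrable_scaleR integrable_oneDsqrV.
pose I m := `[- m.+1%:R, m.+1%:R]%classic : set R.
have FTC m : (\int[leb]_t (g' t * \1_(I m) t)%:E = (g m.+1%:R - g (- m.+1%:R))%:E)%E.
  transitivity (\int[leb]_(t in I m) (g' t)%:E)%E.
    rewrite [RHS]integral_mkcond; apply: eq_integral => t _.
    by rewrite /patch indicE; case: (t \in I m); rewrite ?mulr1 ?mulr0.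
  rewrite (@continuous_FTC2 _ g' g)//.
  - by rewrite -subr_gt0 opprK addr_gt0.
  - by apply: continuous_subspaceT => t; exact: cg'.
  - split; first by move=> t _; have [] := dg t.
      exact: cvg_at_right_filter (cg _).
    exact: cvg_at_left_filter (cg _).
  - by move=> t _; rewrite derive1E; have [_ ->] := dg t.
have pos t : 0 < 1 + t ^+ 2 :> R by rewrite ltr_pwDl// sqr_ge0.
have := @dominated_cvg _ _ _ leb setT measurableT
  (fun m t => (g' t * \1_(I m) t)%:E) (EFin \o g') _ _ _ _ ig' _.
move=> /(_ _ _ _ _)/cvg_unique; apply => //.
- by move=> m; apply/measurable_EFinP; apply: measurable_funM => //; apply: measurable_indic; exact: measurable_itv.
- move=> t _; apply: cvg_near_cst.
  exists (Num.truncn `|t|) => // m /= tm.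
  rewrite indicE mem_set ?mulr1// /I /= in_itv/= -ler_norml.
  by apply: le_trans (ltW (truncnS_gt _)) _; rewrite ler_nat ltnS.
- move=> m t _; rewrite lee_fin/= normrM ler_pdivlMr//.
  apply: le_trans (g'C t); rewrite ler_wpM2r ?(ltW (pos t))//.
  by rewrite ler_piMr// indicE; case: (_ \in _); rewrite ?normr1 ?normr0.
rewrite (_ : (fun m => _) = (fun m => (g m.+1%:R - g (- m.+1%:R))%:E)); last first.
  by apply/funext => m; exact: FTC.
apply: cvg_EFin; first exact: nearW.
rewrite -[X in _ --> X](subr0 0); apply: cvgB.
  by apply: (bounded_oneDsqr_cvg0 gC) => m; rewrite ger0_norm.
by apply: (bounded_oneDsqr_cvg0 gC) => m; rewrite normrN ger0_norm.
Qed.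

(** The j-th variable is integrated first.  The induction on the dimension splits off
    the first variable until it is the j-th one. *)
Lemma integral_partial0 n (f f' : 'rV[R]_n -> R) j (C : R) :
  has_partial j f f' -> measurable_fun setT f' ->
  (forall x, continuous (fun t : R => f' (x + t *: delta_mx ord0 j))) ->
  (forall x, `|f x| * weight x <= C) -> (forall x, `|f' x| * weight x <= C) ->
  \int[@lebesgue_rV R n]_x f' x = 0.
Proof.
elim: n f f' j => [|n ih] f f' j; first by case: j.
move=> df mf' cf' fC f'C.
have if' := integrable_weight_bound mf' f'C.
have wge (v : 'rV[R]_n) t : 1 + t ^+ 2 <= weight (rV_cons (t, v)).
  by rewrite weight_cons ler_peMr ?weight_ge1// addr_ge0// sqr_ge0.
have wge' (v : 'rV[R]_n) t : weight v <= weight (rV_cons (t, v)).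
  by rewrite weight_cons ler_peMl ?(ltW (weight_gt0 _))// lerDl sqr_ge0.
rewrite /Rintegral; case: (unliftP ord0 j) => [k jk|j0].
  rewrite integral_rV_cons1//.
  under eq_integral => t _.
    rewrite -[X in integral _ _ X]/(EFin \o (fun v => f' (rV_cons (t, v)))).
    have mt : measurable_fun setT (fun v => f' (rV_cons (t, v))).
      apply: (measurableT_comp mf').
      apply: (measurableT_comp (@measurable_rV_cons R n)).
      exact: measurable_fun_pair.
    have bt v : `|f' (rV_cons (t, v))| * weight v <= C.
      by apply: le_trans (f'C (rV_cons (t, v))); rewrite ler_wpM2l.
    have /= <- := EFin_Rintegral (integrable_weight_bound mt bt).
    rewrite (ih (fun v => f (rV_cons (t, v))) (fun v => f' (rV_cons (t, v))) k)//; last first.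
    - by move=> v; apply: le_trans (fC (rV_cons (t, v))); rewrite ler_wpM2l.
    - by move=> v; under eq_fun do rewrite rV_consDlift -jk; exact: cf'.
    - move=> v; apply/is_derive_line; under eq_fun do rewrite rV_consDlift -jk.
      by apply/is_derive_line; exact: df.
    over.
  by rewrite integral0.
rewrite integral_rV_cons2// integral0_eq// => v _.
have E t : rV_cons (t, v) = rV_cons (0, v) + t *: delta_mx ord0 j.
  by rewrite j0 -rV_consD0 add0r.
apply: (@integral_derive0 (fun t => f (rV_cons (t, v))) _ C).
- move=> t; under [X in is_derive _ _ X]eq_fun do rewrite E.
  by rewrite (E t); apply: is_derive_lineS; exact: df.
- by under eq_fun do rewrite E; exact: cf'.
- by move=> t; apply: le_trans (fC (rV_cons (t, v))); rewrite ler_wpM2l.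
- by move=> t; apply: le_trans (f'C (rV_cons (t, v))); rewrite ler_wpM2l.
Qed.

End integral_of_derivative.

(** * Decay of the short-time Fourier transform *)

Section real_continuous.
Context {R : realType} {T : topologicalType}.
Implicit Types f g : T -> R.

Lemma continuous_cstR (c : R) : continuous (fun _ : T => c).
Proof. exact: cst_continuous. Qed.

Lemma continuous_addR f g : continuous f -> continuous g ->
  continuous (fun x => f x + g x).
Proof. by move=> cf cg x; exact: cvgD (cf x) (cg x). Qed.

Lemma continuous_mulR f g : continuous f -> continuous g ->
  continuous (fun x => f x * g x).
Proof. by move=> cf cg x; exact: cvgM (cf x) (cg x). Qed.

Lemma continuous_compR f (g : R -> R) : continuous f -> continuous g ->
  continuous (fun x => g (f x)).
Proof. by move=> cf cg x; exact: continuous_comp (cf x) (cg _). Qed.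

Lemma continuous_sumR (I : Type) (s : seq I) (F : I -> T -> R) :
  (forall i, continuous (F i)) -> continuous (fun x => \sum_(i <- s) F i x).
Proof.
move=> cF; elim: s => [|i s ih].
  rewrite (_ : (fun y => _) = fun=> 0); first exact: continuous_cstR.
  by apply/funext => y; rewrite big_nil.
rewrite (_ : (fun y => _) = fun y => F i y + \sum_(i <- s) F i y).
  exact: continuous_addR.
by apply/funext => y; rewrite big_cons.
Qed.

End real_continuous.

Lemma continuous_subr (R : realType) (V : normedModType R) (q : V) :
  continuous (fun x : V => x - q).
Proof. by move=> x; apply: cvgB; [exact: cvg_id|exact: cvg_cst]. Qed.

Lemma continuous_line (R : realType) (V : normedModType R) (x v : V) :
  continuous (fun t : R => x + t *: v).
Proof.
by move=> t; apply: cvgD; [exact: cvg_cst|apply: cvgZl; exact: cvg_id].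
Qed.

Lemma continuous_coordR (R : realType) n (j : 'I_n) :
  continuous (fun x : 'rV[R]_n => x ord0 j).
Proof. exact: coord_continuous. Qed.

Section short_time_fourier.
Context {R : realType} {n : nat}.
Local Notation mu := (@lebesgue_rV R n).
Implicit Types (f h phi : 'rV[R]_n -> R) (S : ('rV[R]_n -> R) -> Prop).

Definition rapid f := forall m, exists C : R, forall x, `|f x| * weight x ^+ m <= C.

(** An abstract substitute for the space of real Schwartz functions: families
    stable under partial derivatives and multiplication by coordinates whose
    members are continuous and decay rapidly.  Windows and signals are taken in
    two such families, so that the same argument serves the Gaussian and the
    derivatives of a given Schwartz function. *)
Definition schwartz_class S := forall f, S f ->
  [/\ continuous f, rapid f, forall j, exists2 f', S f' & has_partial j f f' &
      forall j, S (fun x => x ord0 j * f x)].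

Variables (eps : R) (eps0 : eps != 0).
Variables (S1 S2 : ('rV[R]_n -> R) -> Prop).
Hypotheses (S1P : schwartz_class S1) (S2P : schwartz_class S2).
Local Notation phase_space := ('rV[R]_n * 'rV[R]_n)%type.

(** Coordinates recentered at q and divided by eps, so that
    phase (centered q) p x is p . (x - q) / eps. *)
Definition centered (q : 'rV[R]_n) (j : 'I_n) (x : 'rV[R]_n) : R :=
  eps^-1 * (x ord0 j - q ord0 j).

(** The real short-time Fourier transform with window h; the values 0 and - pi / 2
    of the phase shift th give the cosine and the sine parts. *)
Definition stft (th : R) h phi (z : phase_space) : R :=
  \int[mu]_x (cos (phase (centered z.1) z.2 x + th) * (h (x - z.1) * phi x)).

Lemma continuous_phase q p : continuous (phase (centered q) p).
Proof.
apply: continuous_sumR => j; apply: continuous_mulR.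
  exact: continuous_cstR.
apply: continuous_mulR; first exact: continuous_cstR.
by apply: continuous_addR; [exact: continuous_coordR|exact: continuous_cstR].
Qed.

Let integrand th h phi (z : phase_space) x :=
  cos (phase (centered z.1) z.2 x + th) * (h (x - z.1) * phi x).

Lemma continuous_integrand th h phi z : continuous h -> continuous phi ->
  continuous (integrand th h phi z).
Proof.
move=> ch cphi; apply: continuous_mulR.
  apply: continuous_compR; last exact: continuous_cos.
  by apply: continuous_addR; [exact: continuous_phase|exact: continuous_cstR].
apply: continuous_mulR => // x.
exact: (continuous_comp (@continuous_subr _ _ z.1 x) (ch _)).
Qed.

Lemma integrand_bound h phi : S1 h -> S2 phi ->
  exists2 C : R, 0 <= C & forall th z x, `|integrand th h phi z x| * weight x <= C.
Proof.
move=> /S1P[_ /(_ 0%N)[Ch hC] _ _] /S2P[_ /(_ 1%N)[Cp pC] _ _].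
have Ch0 : 0 <= Ch by apply: le_trans (hC 0); rewrite mulr_ge0.
have Cp0 : 0 <= Cp.
  by apply: le_trans (pC 0); rewrite mulr_ge0 ?exprn_ge0// ltW ?weight_gt0.
exists (Ch * Cp) => [|th z x]; first exact: mulr_ge0.
rewrite !normrM -!mulrA; apply: le_trans (_ : 1 * (`|h (x - z.1)| * (`|phi x| * weight x)) <= _).
  by rewrite ler_wpM2r ?cos_max// !mulr_ge0// ltW// weight_gt0.
rewrite mul1r; apply: ler_pM => //.
- by rewrite mulr_ge0// ltW// weight_gt0.
- by have := hC (x - z.1); rewrite expr0 mulr1.
Qed.

Lemma integrable_integrand th h phi z : S1 h -> S2 phi ->
  mu.-integrable setT (EFin \o integrand th h phi z).
Proof.
move=> Sh Sp; have [C _ bC] := integrand_bound Sh Sp.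
apply: integrable_weight_bound (bC th z); apply: continuous_measurable_rV.
have [ch _ _ _] := S1P Sh; have [cp _ _ _] := S2P Sp.
exact: continuous_integrand.
Qed.

Lemma stft_bounded th h phi : S1 h -> S2 phi ->
  exists C : R, forall z, `|stft th h phi z| <= C.
Proof.
move=> Sh Sp; have [C _ bC] := integrand_bound Sh Sp.
exists (C * \int[mu]_x (weight (x : 'rV[R]_n))^-1) => z.
apply: (normr_Rintegral_weight_bound _ (bC th z)).
exact: measurable_integrand (integrable_integrand th z Sh Sp).
Qed.

(** Write q_j = x_j - (x_j - q_j) under the integral: the first term multiplies
    the signal by the coordinate, the second one the window. *)
Lemma stft_mul_position th h phi j (z : phase_space) : S1 h -> S2 phi ->
  z.1 ord0 j * stft th h phi z =
  stft th h (fun x => x ord0 j * phi x) z - stft th (fun x => x ord0 j * h x) phi z.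
Proof.
move=> Sh Sp.
have Sh' : S1 (fun x => x ord0 j * h x) by have [_ _ _] := S1P Sh; exact.
have Sp' : S2 (fun x => x ord0 j * phi x) by have [_ _ _] := S2P Sp; exact.
have i0 := integrable_integrand th z Sh Sp.
have i1 := integrable_integrand th z Sh Sp'.
have i2 := integrable_integrand th z Sh' Sp.
rewrite -(RintegralZl _ _ i0)// -(RintegralB _ i1 i2)//.
by apply: eq_Rintegral => x _; rewrite /integrand !mxE; ring.
Qed.

Lemma has_partial_phase q p j :
  has_partial j (phase (centered q) p) (fun=> eps^-1 * p ord0 j).
Proof.
have h k : has_partial j (fun x => p ord0 k * centered q k x)
    (fun=> p ord0 k * (eps^-1 * ((k == j)%:R + 0))).
  apply: has_partialZ; apply: has_partialZ.
  exact: has_partialD (has_partial_coord _ _) (has_partial_cst _ _).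
have := has_partial_sum (index_enum _) h.
congr has_partial; apply/funext => x.
rewrite (bigD1 j)//= eqxx addr0 mulr1 mulrC big1 ?addr0// => k kj.
by rewrite (negbTE kj) addr0 !mulr0.
Qed.

(** Integration by parts: up to the factor p_j / eps, the cosine is the derivative
    of the same cosine shifted by - pi / 2, and the derivative is transferred to the
    window and the signal. *)
Lemma stft_mul_momentum th h phi h' phi' j (z : phase_space) : S1 h -> S2 phi ->
  S1 h' -> S2 phi' -> has_partial j h h' -> has_partial j phi phi' ->
  z.2 ord0 j * stft th h phi z =
  - eps * (stft (th - pi / 2) h' phi z + stft (th - pi / 2) h phi' z).
Proof.
move=> Sh Sp Sh' Sp' dh dp.
have [[ch _ _ _] [cp _ _ _]] := (S1P Sh, S2P Sp).
have [[ch' _ _ _] [cp' _ _ _]] := (S1P Sh', S2P Sp').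
pose f' x := eps^-1 * z.2 ord0 j * integrand th h phi z x +
  (integrand (th - pi / 2) h' phi z x + integrand (th - pi / 2) h phi' z x).
have df : has_partial j (integrand (th - pi / 2) h phi z) f'.
  have := has_partialM (has_partial_comp
      (has_partialD (has_partial_phase z.1 z.2 j) (has_partial_cst j (th - pi / 2)))
      (fun t => is_derive_cos t))
    (has_partialM (has_partial_shift z.1 dh) dp).
  congr has_partial; apply/funext => x.
  rewrite /f' /integrand [X in - sin X]addrA sinBpihalf.
  by ring.
have [C C0 bC] := integrand_bound Sh Sp.
have [C1 C10 bC1] := integrand_bound Sh' Sp.
have [C2 C20 bC2] := integrand_bound Sh Sp'.
have cf' : continuous f'.
  apply: continuous_addR; last by apply: continuous_addR; exact: continuous_integrand.
  by apply: continuous_mulR; [exact: continuous_cstR|exact: continuous_integrand].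
have w0 (x : 'rV[R]_n) : 0 <= weight x by rewrite ltW// weight_gt0.
have := @integral_partial0 _ _ _ f' j
  (Num.max C (`|eps^-1 * z.2 ord0 j| * C + (C1 + C2))) df.
have i0 := integrable_integrand th z Sh Sp.
have i1 := integrable_integrand (th - pi / 2) z Sh' Sp.
have i2 := integrable_integrand (th - pi / 2) z Sh Sp'.
have i3 := integrable_scaleR (eps^-1 * z.2 ord0 j) i0.
rewrite (RintegralD _ i3 (integrable_addR i1 i2))//.
rewrite (RintegralD _ i1 i2)// (RintegralZl _ _ i0)//.
rewrite -/(stft th h phi z) -/(stft (th - pi / 2) h' phi z) -/(stft (th - pi / 2) h phi' z).
move=> H; have {}H : eps^-1 * z.2 ord0 j * stft th h phi z =
    - (stft (th - pi / 2) h' phi z + stft (th - pi / 2) h phi' z); last first.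
  by rewrite mulNr -mulrN -H !mulrA divff// mul1r.
apply/eqP; rewrite -addr_eq0; apply/eqP; apply: H.
- exact: continuous_measurable_rV.
- move=> x t.
  exact: (continuous_comp (@continuous_line _ _ x (delta_mx ord0 j) t) (cf' _)).
- by move=> x; rewrite le_max bC.
- move=> x; rewrite le_max; apply/orP; right.
  apply: le_trans (ler_wpM2r (w0 x) (ler_normD _ _)) _.
  rewrite mulrDl lerD//; first by rewrite normrM -mulrA ler_wpM2l.
  apply: le_trans (ler_wpM2r (w0 x) (ler_normD _ _)) _.
  by rewrite mulrDl lerD.
Qed.

(** Linear combinations of transforms, the space on which multiplications by the
    coordinates of q and p act. *)
Inductive stft_span : (phase_space -> R) -> Prop :=
| Span_stft th h phi : S1 h -> S2 phi -> stft_span (stft th h phi)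
| Span_add F G : stft_span F -> stft_span G -> stft_span (fun z => F z + G z)
| Span_scale (c : R) F : stft_span F -> stft_span (fun z => c * F z).

Lemma stft_span_position j F :
  stft_span F -> stft_span (fun z => z.1 ord0 j * F z).
Proof.
elim=> [th h phi Sh Sp|{}F G _ ihF _ ihG|c {}F _ ih].
- have Sh' : S1 (fun x => x ord0 j * h x) by have [_ _ _] := S1P Sh; exact.
  have Sp' : S2 (fun x => x ord0 j * phi x) by have [_ _ _] := S2P Sp; exact.
  have := Span_add (Span_stft th Sh Sp') (Span_scale (-1) (Span_stft th Sh' Sp)).
  congr stft_span; apply/funext => z.
  by rewrite stft_mul_position// mulN1r.
- have := Span_add ihF ihG; congr stft_span.
  by apply/funext => z; rewrite mulrDr.
- have := Span_scale c ih; congr stft_span.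
  by apply/funext => z; rewrite mulrCA.
Qed.

Lemma stft_span_momentum j F :
  stft_span F -> stft_span (fun z => z.2 ord0 j * F z).
Proof.
elim=> [th h phi Sh Sp|{}F G _ ihF _ ihG|c {}F _ ih].
- have [_ _ /(_ j)[h' Sh' dh] _] := S1P Sh.
  have [_ _ /(_ j)[phi' Sp' dp] _] := S2P Sp.
  have := Span_scale (- eps) (Span_add (Span_stft (th - pi / 2) Sh' Sp)
    (Span_stft (th - pi / 2) Sh Sp')).
  congr stft_span; apply/funext => z.
  by rewrite (stft_mul_momentum _ _ Sh Sp Sh' Sp' dh dp).
- have := Span_add ihF ihG; congr stft_span.
  by apply/funext => z; rewrite mulrDr.
- have := Span_scale c ih; congr stft_span.
  by apply/funext => z; rewrite mulrCA.
Qed.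

(** The weight is a product of factors 1 + q_j^2 and 1 + p_j^2, each of which is made of
    two multiplications and an addition. *)
Lemma stft_span_weight F : stft_span F ->
  stft_span (fun z => weight z.1 * weight z.2 * F z).
Proof.
move=> SF.
have momentum (s : seq 'I_n) : stft_span (fun z =>
    (\prod_(j <- s) (1 + z.2 ord0 j ^+ 2)) * F z).
  elim: s => [|j s ih].
    have := Span_scale 1 SF; congr stft_span; apply/funext => z.
    by rewrite big_nil.
  have := Span_add ih (stft_span_momentum j (stft_span_momentum j ih)).
  congr stft_span; apply/funext => z; rewrite big_cons; ring.
suff : forall s : seq 'I_n, stft_span (fun z =>
    (\prod_(j <- s) (1 + z.1 ord0 j ^+ 2)) * (weight z.2 * F z)).
  move=> /(_ (index_enum 'I_n)); congr stft_span; apply/funext => z.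
  by rewrite mulrA.
elim=> [|j s ih].
  have := Span_scale 1 (momentum (index_enum 'I_n)); congr stft_span.
  by apply/funext => z; rewrite big_nil.
have := Span_add ih (stft_span_position j (stft_span_position j ih)).
by congr stft_span; apply/funext => z; rewrite big_cons; ring.
Qed.

Lemma stft_span_bounded F : stft_span F ->
  exists C : R, forall z, `|F z| <= C.
Proof.
elim=> [th h phi Sh Sp|{}F G _ [C FC] _ [C' GC]|c {}F _ [C FC]].
- exact: stft_bounded.
- by exists (C + C') => z; apply: le_trans (ler_normD _ _) _; exact: lerD.
- by exists (`|c| * C) => z; rewrite normrM ler_wpM2l.
Qed.

(** The transform times any power of the weights is in stft_span, whose elements
    are bounded. *)
Lemma stft_rapid th h phi m : S1 h -> S2 phi -> exists2 C : R, 0 <= C &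
  forall z, `|stft th h phi z| * (weight z.1 * weight z.2) ^+ m <= C.
Proof.
move=> Sh Sp.
have SF : stft_span (fun z => (weight z.1 * weight z.2) ^+ m * stft th h phi z).
  elim: m => [|m ih].
    rewrite (_ : (fun z => _) = (fun z => 1 * stft th h phi z)).
      exact/Span_scale/Span_stft.
    by apply/funext => z; rewrite expr0.
  have := stft_span_weight ih; congr stft_span.
  by apply/funext => z; rewrite exprS mulrA.
have [C bC] := stft_span_bounded SF.
have bC' z : `|stft th h phi z| * (weight z.1 * weight z.2) ^+ m <= C.
  apply: le_trans (bC z); rewrite normrM mulrC ler_wpM2r// ler_norm//.
exists C => //; apply: le_trans (bC' (0, 0)).
by rewrite mulr_ge0// exprn_ge0// mulr_ge0 // ltW// weight_gt0.
Qed.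

End short_time_fourier.

(** * Gaussian windows and Schwartz functions *)

Section weights.
Context {R : realType} {n : nat}.
Implicit Types (x q : 'rV[R]_n).

Lemma normr_coord_le x j : `|x ord0 j| <= `|x|.
Proof.
rewrite [leRHS]mx_normrE.
by rewrite (le_bigmax _ (fun ij : 'I_1 * 'I_n => `|x ij.1 ij.2|) (ord0, j)).
Qed.

Lemma weight_norm x : weight x <= (1 + `|x| ^+ 2) ^+ n.
Proof.
rewrite -[X in _ ^+ X]card_ord -prodr_const; apply: ler_prod => j _.
rewrite addr_ge0 ?sqr_ge0//= lerD2l -real_normK ?num_real//.
by rewrite lerXn2r ?nnegrE// normr_coord_le.
Qed.

Lemma weight_coord x j : 1 + x ord0 j ^+ 2 <= weight x.
Proof.
rewrite /weight (bigD1 j)//= ler_peMr ?addr_ge0 ?sqr_ge0//.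
elim/big_ind : _ => // [a b a1 b1|i _]; first by rewrite mulr_ege1.
by rewrite lerDl sqr_ge0.
Qed.

Lemma coord_le_weight x j : `|x ord0 j| <= weight x.
Proof.
apply: le_trans (weight_coord x j); rewrite -real_normK ?num_real//.
have := sqr_ge0 (`|x ord0 j| - 1); rewrite sqrrB1; nra.
Qed.

(** A form of the Peetre inequality, from
    1 + (a + b)^2 <= 2 (1 + a^2) (1 + b^2) in each coordinate. *)
Lemma weight_peetre x q : weight x <= 2 ^+ n * (weight q * weight (x - q)).
Proof.
rewrite /weight -big_split/= -[X in _ ^+ X]card_ord -prodr_const -big_split/=.
apply: ler_prod => j _; rewrite addr_ge0 ?sqr_ge0//= !mxE.
move: (x ord0 j) (q ord0 j) => a b; rewrite -subr_ge0.
(* The difference of the two sides as a sum of squares, with a - b for the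
   coordinate of x - q. *)
rewrite (_ : _ - _ = 1 + (b - (a - b)) ^+ 2 + 2 * (b * (a - b)) ^+ 2); last ring.
apply: addr_ge0; last by rewrite pmulr_rge0// sqr_ge0.
by rewrite addr_ge0// sqr_ge0.
Qed.

(** Completing the square leaves half of the Gaussian, exp (- b (1 + r^2)) up to a
    constant, and y^N <= N! exp y absorbs the power. *)
Lemma gauss_exp_bound (c s : R) N : 0 < c -> 0 <= s -> exists C : R,
  forall r, 0 <= r -> expR (s * r - c * r ^+ 2) * (1 + r ^+ 2) ^+ N <= C.
Proof.
move=> c0 s0; pose b := c / 2; have b0 : 0 < b by rewrite divr_gt0.
exists (expR (s ^+ 2 / (2 * c) + b) * (N`!%:R / b ^+ N)) => r r0.
have h1 : s * r - c * r ^+ 2 <= (s ^+ 2 / (2 * c) + b) - b * (1 + r ^+ 2).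
  rewrite -subr_ge0 (_ : _ - _ = (2 * c)^-1 * (s - c * r) ^+ 2); last first.
    by rewrite /b; field; rewrite gt_eqF.
  by rewrite mulr_ge0 ?sqr_ge0// invr_ge0 mulr_ge0// ltW.
have y0 : 0 <= 1 + r ^+ 2 by rewrite addr_ge0 ?sqr_ge0.
apply: le_trans (_ : expR ((s ^+ 2 / (2 * c) + b) - b * (1 + r ^+ 2)) * (1 + r ^+ 2) ^+ N <= _).
  by rewrite ler_wpM2r ?exprn_ge0// ler_expR.
rewrite expRD -mulrA ler_pM2l ?expR_gt0// expRN ler_pdivrMl ?expR_gt0//.
rewrite mulrA ler_pdivlMr ?exprn_gt0// -exprMn_comm; last exact: mulrC.
rewrite -ler_pdivrMr ?ltr0n ?fact_gt0//.
have by0 : 0 <= b * (1 + r ^+ 2) by rewrite mulr_ge0// ltW.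
have := exp_type_partial_le (b * (1 + r ^+ 2)) N.+1 (@exp_type_expR R).
rewrite [X in expR X](ger0_norm by0); apply: le_trans.
apply: le_trans (ler_norm _); rewrite /series/= big_nat_recr//= [leLHS]mulrC [in leLHS](mulrC _ b).
by rewrite lerDr sumr_ge0// => i _; rewrite mulr_ge0 ?invr_ge0// exprn_ge0.
Qed.

End weights.

Section poly_span.
Context {R : realType} {n : nat}.
Implicit Types (f : 'rV[R]_n -> R) (B : ('rV[R]_n -> R) -> Prop).

(** For B the set of the derivatives of a function, or the singleton of a Gaussian
    profile, this space is also stable under differentiation. *)
Inductive poly_span B : ('rV[R]_n -> R) -> Prop :=
| Span_base f : B f -> poly_span B f
| Span_addf f g : poly_span B f -> poly_span B g -> poly_span B (fun x => f x + g x)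
| Span_scalef (c : R) f : poly_span B f -> poly_span B (fun x => c * f x)
| Span_coord j f : poly_span B f -> poly_span B (fun x => x ord0 j * f x).

Lemma poly_span_sum B (I : Type) (s : seq I) (c : I -> R) (F : I -> 'rV[R]_n -> R) f :
  B f -> (forall i, poly_span B (F i)) ->
  poly_span B (fun x => \sum_(i <- s) c i * F i x).
Proof.
move=> Bf BF; elim: s => [|i s ih].
  rewrite (_ : (fun x => _) = (fun x => 0 * f x)).
    exact/Span_scalef/Span_base.
  by apply/funext => x; rewrite big_nil mul0r.
rewrite (_ : (fun x => _) = (fun x => c i * F i x + \sum_(i <- s) c i * F i x)).
  by apply: Span_addf => //; exact: Span_scalef.
by apply/funext => x; rewrite big_cons.
Qed.

(** The closure properties of a schwartz_class only have to be checked on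
    generators: continuity, decay and derivatives in the span all pass to sums and to
    products with coordinates. *)
Lemma poly_span_class B :
  (forall f, B f -> [/\ continuous f, rapid f &
     forall j, exists2 f', poly_span B f' & has_partial j f f']) ->
  schwartz_class (poly_span B).
Proof.
move=> BP f; elim.
- move=> {}f Bf; have [cf rf df] := BP f Bf; split => // j.
  exact/Span_coord/Span_base.
- move=> {}f g Sf [cf rf df _] Sg [cg rg dg _]; split.
  + exact: continuous_addR.
  + move=> m; have [C1 h1] := rf m; have [C2 h2] := rg m; exists (C1 + C2) => x.
    apply: le_trans (lerD (h1 x) (h2 x)); rewrite -mulrDl ler_wpM2r//.
      by rewrite exprn_ge0// ltW// weight_gt0.
    exact: ler_normD.
  + move=> j; have [f' Sf' df'] := df j; have [g' Sg' dg'] := dg j.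
    exists (fun x => f' x + g' x); first exact: Span_addf.
    exact: has_partialD.
  + by move=> j; exact/Span_coord/Span_addf.
- move=> c {}f Sf [cf rf df _]; split.
  + by apply: continuous_mulR => //; exact: continuous_cstR.
  + move=> m; have [C1 h1] := rf m; exists (`|c| * C1) => x.
    by rewrite normrM -mulrA ler_wpM2l.
  + move=> j; have [f' Sf' df'] := df j.
    exists (fun x => c * f' x); first exact: Span_scalef.
    exact: has_partialZ.
  + by move=> j; exact/Span_coord/Span_scalef.
- move=> k {}f Sf [cf rf df _]; split.
  + by apply: continuous_mulR => //; exact: continuous_coordR.
  + move=> m; have [C1 h1] := rf m.+1; exists C1 => x.
    apply: le_trans (h1 x); rewrite normrM exprS -mulrA [leRHS]mulrCA.
    by rewrite ler_wpM2r ?coord_le_weight// mulr_ge0// exprn_ge0// ltW// weight_gt0.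
  + move=> j; have [f' Sf' df'] := df j.
    exists (fun x => (k == j)%:R * f x + x ord0 k * f' x).
      by apply: Span_addf; [exact: Span_scalef|exact: Span_coord].
    exact: has_partialM (has_partial_coord _ _) df'.
  + by move=> j; do 2 apply: Span_coord.
Qed.

(** Compares the product weight with the powers of the sup norm used in the
    definition of Schwartz functions. *)
Lemma weight_exp_le (x : 'rV[R]_n) m :
  weight x ^+ m <= 2 ^+ (n * m) * (1 + `|x| ^+ (2 * (n * m))).
Proof.
apply: le_trans (_ : (1 + `|x| ^+ 2) ^+ (n * m) <= _).
  by rewrite exprM lerXn2r ?nnegrE ?weight_norm ?exprn_ge0 ?addr_ge0 ?sqr_ge0
    ?(ltW (weight_gt0 _)).
move: (n * m)%N => N; have [x1|x1] := leP (`|x| ^+ 2) 1.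
  apply: le_trans (_ : 2 ^+ N * 1 <= _); last first.
    by rewrite ler_wpM2l ?exprn_ge0// lerDl exprn_ge0.
  rewrite mulr1 lerXn2r ?nnegrE ?addr_ge0 ?sqr_ge0//; lra.
apply: le_trans (_ : (2 * `|x| ^+ 2) ^+ N <= _).
  rewrite lerXn2r ?nnegrE ?addr_ge0 ?mulr_ge0 ?sqr_ge0//; lra.
by rewrite exprMn -exprM ler_wpM2l ?exprn_ge0// lerDr.
Qed.

Lemma Re_cpartials (psi : 'rV[R]_n -> R[i]) s x :
  complex.Re (cpartials s psi x) = partials s (fun y => complex.Re (psi y)) x.
Proof.
elim: s x => [//|j s ih] x /=.
by congr (partial _ _ _); apply/funext => y; exact: ih.
Qed.

Lemma Im_cpartials (psi : 'rV[R]_n -> R[i]) s x :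
  complex.Im (cpartials s psi x) = partials s (fun y => complex.Im (psi y)) x.
Proof.
elim: s x => [//|j s ih] x /=.
by congr (partial _ _ _); apply/funext => y; exact: ih.
Qed.

Definition schwartz_span f := poly_span [set g | exists s, g = partials s f].

Lemma schwartz_span_class f : smooth f ->
  (forall (k : nat) s, exists C : R, forall x, `|x| ^+ k * `|partials s f x| <= C) ->
  schwartz_class (schwartz_span f).
Proof.
move=> sf bf; apply: poly_span_class => _ [s ->]; have [cf df] := sf s; split => //.
- move=> m; have [C0 h0] := bf 0%N s; have [C1 h1] := bf (2 * (n * m))%N s.
  exists (2 ^+ (n * m) * (C0 + C1)) => x.
  apply: le_trans (ler_wpM2l (normr_ge0 _) (weight_exp_le x m)) _.
  rewrite mulrCA ler_wpM2l ?exprn_ge0// mulrDr lerD//.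
    by have := h0 x; rewrite expr0 mul1r mulr1.
  by rewrite mulrC.
- move=> j; exists (partials (j :: s) f); first by apply: Span_base; exists (j :: s).
  exact: has_partial_partial.
Qed.

Lemma schwartz_ReIm (psi : 'rV[R]_n -> R[i]) : schwartz psi ->
  schwartz_class (schwartz_span (fun x => complex.Re (psi x))) /\
  schwartz_class (schwartz_span (fun x => complex.Im (psi x))).
Proof.
move=> [sR sI b]; split; apply: schwartz_span_class => // k s;
  have [C h] := b k s; exists C => x; apply: le_trans (h x);
  rewrite ler_wpM2l ?exprn_ge0//.
  by rewrite -Re_cpartials normr_Re_le.
by rewrite -Im_cpartials normr_Im_le.
Qed.

End poly_span.

Section gaussian_profile.
Context {R : realType} {D : nat}.
Variables (eps : R) (Gamma : 'M[R]_D).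
Hypotheses (eps_gt0 : 0 < eps) (Gamma_sym : Gamma^T = Gamma)
  (Gamma_posdef : posdefmx Gamma).
Implicit Types u : 'rV[R]_D.

Definition quad u : R := (u *m Gamma *m u^T) ord0 ord0.
(** The j-th coordinate of u Gamma, half of a partial derivative of quad when Gamma
    is symmetric. *)
Definition mulGamma j u : R := \sum_k Gamma k j * u ord0 k.
Definition profile u : R := expR (- (2 * eps)^-1 * quad u).

Lemma quadE u : quad u = \sum_j mulGamma j u * u ord0 j.
Proof.
rewrite /quad mxE; apply: eq_bigr => j _; rewrite !mxE; congr (_ * _).
by apply: eq_bigr => k _; rewrite mulrC.
Qed.

Lemma continuous_quad : continuous quad.
Proof.
rewrite (_ : quad = fun u => \sum_j mulGamma j u * u ord0 j); last first.
  by apply/funext => u; exact: quadE.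
apply: continuous_sumR => j; apply: continuous_mulR; last exact: continuous_coordR.
apply: continuous_sumR => k; apply: continuous_mulR; last exact: continuous_coordR.
exact: continuous_cstR.
Qed.

Lemma has_partial_quad j : has_partial j quad (fun u => 2 * mulGamma j u).
Proof.
rewrite (_ : quad = fun u => \sum_k mulGamma k u * u ord0 k); last first.
  by apply/funext => u; exact: quadE.
have dG k : has_partial j (mulGamma k) (fun=> \sum_i Gamma i k * (i == j)%:R).
  apply: has_partial_sum => i; apply: has_partialZ; exact: has_partial_coord.
have := has_partial_sum (index_enum _) (fun k => has_partialM (dG k) (has_partial_coord j k)).
congr has_partial; apply/funext => u; rewrite big_split/=.
rewrite mulrDl mul1r; congr (_ + _).
  apply: eq_bigr => k _; rewrite (bigD1 j)//= eqxx mulr1 big1 ?addr0.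
    by rewrite -{1}Gamma_sym mxE.
  by move=> i ij; rewrite (negbTE ij) mulr0.
rewrite (bigD1 j)//= eqxx mulr1 big1 ?addr0// => i ij.
by rewrite (negbTE ij) mulr0.
Qed.

(** A positive-definite form has a positive minimum on the unit sphere, which is
    compact; homogeneity does the rest. *)
Lemma coercive_quad : exists2 c : R, 0 < c & forall u, c * `|u| ^+ 2 <= quad u.
Proof.
pose S : set 'rV[R]_D := [set u | `|u| = 1].
have [S0|/set0P S0] := eqVneq S set0.
  exists 1 => // u; have [->|u0] := eqVneq u 0.
    by rewrite normr0 expr0n/= mulr0 /quad mul0mx mul0mx mxE.
  suff : S (`|u|^-1 *: u) by rewrite S0.
  by rewrite /S/= normrZ normfV normr_id mulVf// normr_eq0.
have cS : compact S.
  apply: bounded_closed_compact.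
    exists 1; split; first exact: num_real.
    by move=> y y1 u /= ->; exact: ltW.
  rewrite (_ : S = (fun u => `|u|) @^-1` [set (1 : R)])//.
  apply: closed_comp; last exact: closed_eq.
  by move=> u _; exact: norm_continuous.
have [c] := EVT_min_rV S0 cS (continuous_subspaceT continuous_quad).
rewrite inE => Sc cmin.
exists (quad c).
  by apply: Gamma_posdef; rewrite -normr_gt0 Sc.
move=> u; have [->|u0] := eqVneq u 0.
  by rewrite normr0 expr0n/= mulr0 /quad mul0mx mul0mx mxE.
have := cmin (`|u|^-1 *: u); rewrite inE => /(_ _).
have nu0 : 0 < `|u| by rewrite normr_gt0.
rewrite {1}/S/= normrZ normfV normr_id mulVf ?gt_eqF// => /(_ erefl).
rewrite [leRHS]/quad linearZ/= -scalemxAr -!scalemxAl mxE [X in _ * X]mxE -/(quad u).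
move=> h; rewrite -ler_pdivlMr ?exprn_gt0//; apply: le_trans h _.
by rewrite mulrA -invfM -expr2 mulrC.
Qed.

Lemma profile_bound (s : R) m : 0 <= s -> exists C : R, forall u,
  expR (s * `|u|) * profile u * weight u ^+ m <= C.
Proof.
move=> s0; have [c c0 cq] := coercive_quad.
have [C CP] := @gauss_exp_bound R ((2 * eps)^-1 * c) s (D * m) ltac:(by rewrite mulr_gt0 ?invr_gt0 ?mulr_gt0) s0.
exists C => u; apply: le_trans (CP `|u| (normr_ge0 u)).
rewrite -expRD; apply: ler_pM; rewrite ?expR_ge0//.
- by rewrite exprn_ge0// ltW// weight_gt0.
- rewrite ler_expR lerD2l mulNr lerN2 -mulrA ler_wpM2l ?invr_ge0 ?mulr_ge0//.
  exact: ltW.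
- by rewrite exprM lerXn2r ?nnegrE ?weight_norm ?exprn_ge0 ?addr_ge0 ?sqr_ge0
    ?(ltW (weight_gt0 _)).
Qed.

Lemma profile_ge0 u : 0 <= profile u. Proof. exact: expR_ge0. Qed.

Lemma continuous_profile : continuous profile.
Proof.
apply: (continuous_compR (g := expR)); last exact: continuous_expR.
by apply: continuous_mulR; [exact: continuous_cstR|exact: continuous_quad].
Qed.

Lemma has_partial_profile j :
  has_partial j profile (fun u => - eps^-1 * mulGamma j u * profile u).
Proof.
have := has_partial_comp (has_partialZ (- (2 * eps)^-1) (has_partial_quad j))
  (fun t => is_derive_expR t).
congr has_partial; apply/funext => u; rewrite -/(profile u).
by field; rewrite gt_eqF.
Qed.

Definition gauss_span := poly_span [set profile].

Lemma gauss_span_class : schwartz_class gauss_span.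
Proof.
apply: poly_span_class => _ ->; split; first exact: continuous_profile.
  move=> m; have [C CP] := profile_bound m (lexx 0); exists C => x.
  by have := CP x; rewrite mul0r expR0 mul1r ger0_norm ?profile_ge0.
move=> j; exists (fun u => - eps^-1 * mulGamma j u * profile u); last exact: has_partial_profile.
have := @poly_span_sum R D [set profile] _ (index_enum _) (fun k => - eps^-1 * Gamma k j)
  (fun k u => u ord0 k * profile u) profile erefl
  (fun k => Span_coord k (Span_base erefl)).
congr poly_span; apply/funext => u.
rewrite /mulGamma mulr_sumr mulr_suml; apply: eq_bigr => k _; ring.
Qed.

End gaussian_profile.

(** * Growth of sub-quadratic potentials, measurability of parametric integrals *)

Section temperate_growth.
Context {R : realType} {n : nat}.
Implicit Types (f : 'rV[R]_n -> R) (x : 'rV[R]_n).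

Lemma normr_increment_le (g g' : R -> R) (K a b : R) :
  (forall t : R, is_derive t 1 g (g' t)) ->
  (forall t, `|t| <= Num.max `|a| `|b| -> `|g' t| <= K) ->
  `|g b - g a| <= K * `|b - a|.
Proof.
move=> dg g'K.
have cg : continuous g.
  move=> t; apply: differentiable_continuous; apply/derivable1_diffP.
  exact: ex_derive.
wlog ab : a b g'K / a < b.
  move=> H; have [ab|ba|->] := ltgtP a b; first exact: H.
    by rewrite distrC [X in _ * X]distrC; apply: H => // t; rewrite maxC; exact: g'K.
  by rewrite !subrr normr0 mulr0.
have [c + ->] := MVT ab (fun t _ => dg t) (continuous_subspaceT cg).
rewrite in_itv/= => /andP[ac cb]; rewrite normrM ler_wpM2r// g'K//.
rewrite le_max; have [c0|c0] := leP 0 c; apply/orP; [right|left].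
  by rewrite !ger0_norm ?(ltW cb)// (le_trans c0 (ltW cb)).
by rewrite !ler0_norm ?lerN2 ?(ltW ac) ?(ltW c0)// ltW// (lt_trans ac).
Qed.

(** Go from 0 to x by changing one coordinate at a time and apply the mean value
    inequality on each of the n segments: the weight at an intermediate point
    is at most the one at x. *)
Lemma temperate_primitive f (f' : 'I_n -> 'rV[R]_n -> R) m (C : R) : 0 <= C ->
  (forall j, has_partial j f (f' j)) ->
  (forall j x, `|f' j x| <= C * weight x ^+ m) ->
  exists2 C' : R, 0 <= C' & forall x, `|f x| <= C' * weight x ^+ m.+1.
Proof.
move=> C0 df f'C.
have w0 (x : 'rV[R]_n) : 0 <= weight x by rewrite ltW// weight_gt0.
(* The point of the path at which the first k coordinates have been changed. *)
pose r k x : 'rV[R]_n := \row_i (if (i < k)%N then x ord0 i else 0).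
have step (k : 'I_n) x : `|f (r k.+1 x) - f (r k x)| <= C * weight x ^+ m.+1.
  have -> : r k.+1 x = r k x + x ord0 k *: delta_mx ord0 k.
    apply/rowP => i; rewrite !mxE eqxx/= ltnS leq_eqVlt.
    have [->|ik] := eqVneq i k; first by rewrite eqxx ltnn/= add0r mulr1.
    by rewrite (negbTE (ik : (i : nat) != k)) mulr0 addr0.
  have := @normr_increment_le (fun t => f (r k x + t *: delta_mx ord0 k))
    (fun t => f' k (r k x + t *: delta_mx ord0 k)) (C * weight x ^+ m) 0 (x ord0 k).
  rewrite scale0r addr0 subr0 => H; apply: le_trans (H _ _) _.
  - by move=> t; apply: is_derive_lineS; exact: df.
  - move=> t; rewrite normr0 max_r// => tx; apply: le_trans (f'C k _) _.
    rewrite ler_wpM2l ?C0// lerXn2r ?nnegrE ?w0//.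
    apply: ler_prod => i _; rewrite addr_ge0 ?sqr_ge0//= lerD2l !mxE eqxx/=.
    have [->|ik] := eqVneq i k; last first.
      by rewrite mulr0 addr0; case: ifP; rewrite ?expr0n/= ?sqr_ge0.
    rewrite ltnn add0r mulr1 -(real_normK (num_real t)) -[leRHS]real_normK ?num_real//.
    by rewrite lerXn2r ?nnegrE.
  rewrite exprSr mulrA ler_wpM2l ?mulr_ge0 ?C0 ?exprn_ge0//.
  exact: coord_le_weight.
have w1 x : 1 <= weight x ^+ m.+1 by rewrite exprn_ege1// weight_ge1.
exists (`|f 0| + C *+ n); first by rewrite addr_ge0// mulrn_wge0.
move=> x; suff H k : (k <= n)%N ->
    `|f (r k x)| <= (`|f 0| + C *+ k) * weight x ^+ m.+1.
  rewrite (_ : x = r n x) ?[X in weight X](_ : r n x = x); first exact: H.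
  - by apply/rowP => i; rewrite mxE ltn_ord.
  - by apply/rowP => i; rewrite mxE ltn_ord.
elim: k => [_|k ih kn].
  rewrite mulr0n addr0 (_ : r 0%N x = 0); last by apply/rowP => i; rewrite !mxE.
  by rewrite ler_peMr.
rewrite -(subrK (f (r k x)) (f (r k.+1 x))); apply: le_trans (ler_normD _ _) _.
apply: le_trans (lerD (step (Ordinal kn) x) (ih (ltnW kn))) _.
by rewrite -mulrDl mulrS addrCA.
Qed.
End temperate_growth.

(** Bounded second derivatives give first derivatives of order weight, hence
    values of order weight^2, by temperate_primitive twice. *)
Lemma subquadratic_growth (R : realType) n (V : 'rV[R]_n -> R) : subquadratic V ->
  continuous V /\ exists2 C : R, 0 <= C & forall x, `|V x| <= C * weight x ^+ 2.
Proof.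
move=> [sV bV]; have [cV dV] := sV [::]; split => //.
have /choice[C CP] (j : 'I_n) : exists C, 0 <= C /\ forall x, `|partial j V x| <= C * weight x ^+ 1.
  have [_ dVj] := sV [:: j].
  have /choice[c cP] (i : 'I_n) : exists c : R, forall x, `|partial i (partial j V) x| <= c.
    by have [c cP] := bV [:: i; j] isT; exists c.
  have [|||C C0 CP] := @temperate_primitive R n (partial j V) (fun i => partial i (partial j V)) 0
    (\sum_i `|c i|).
  - by rewrite sumr_ge0.
  - by move=> i; apply: has_partial_partial.
  - move=> i x; rewrite expr0 mulr1; apply: le_trans (cP i x) _.
    by apply: le_trans (ler_norm _) _; rewrite (bigD1 i)//= lerDl sumr_ge0.
  - by exists C.
have [|||C' C0 C'P] := @temperate_primitive R n V (fun i => partial i V) 1 (\sum_i C i).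
- by rewrite sumr_ge0// => i _; have [] := CP i.
- by move=> i; apply: has_partial_partial.
- move=> i x; have [_ /(_ x)] := CP i; move/le_trans; apply.
  rewrite ler_wpM2r ?exprn_ge0 ?(ltW (weight_gt0 _))//.
  by rewrite (bigD1 i)//= lerDl sumr_ge0// => k _; have [] := CP k.
- by exists C'.
Qed.

Lemma measurable_Rintegral_param d1 d2 (T1 : measurableType d1)
    (T2 : measurableType d2) (R : realType)
    (m2 : {sigma_finite_measure set T2 -> \bar R}) (g : T1 * T2 -> R) :
  measurable_fun setT g -> measurable_fun setT (fun x => \int[m2]_y g (x, y)).
Proof.
move=> mg; apply: measurableT_comp => //.
have mg' : measurable_fun setT (EFin \o g) by exact/measurable_EFinP.
have := emeasurable_funB
  (measurable_fun_fubini_tonelli_F (m2 := m2) _ (measurable_funepos mg') (funepos_ge0 _))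
  (measurable_fun_fubini_tonelli_F (m2 := m2) _ (measurable_funeneg mg') (funeneg_ge0 _)).
congr measurable_fun; apply/funext => x.
rewrite [RHS]integralE; congr (_ - _)%E; apply: eq_integral => y _.
  by rewrite !funeposE.
by rewrite !funenegE.
Qed.

(** * Wave packet transform of temperate functions *)

Section wave_packets.
Local Open Scope complex_scope.
Context {R : realType} {D : nat}.
Variables (eps : R) (Gamma : 'M[R]_D).
Hypotheses (eps_gt0 : 0 < eps) (Gamma_sym : Gamma^T = Gamma)
  (Gamma_posdef : posdefmx Gamma).
Local Notation phase_space := ('rV[R]_D * 'rV[R]_D)%type.
Local Notation mu := (@lebesgue_rV R D).
Local Notation theta z := (phase (centered eps z.1) z.2).
Local Notation profile := (profile eps Gamma).
Local Notation g := (gaussian eps Gamma).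

Definition amplitude : R := (\det Gamma / (pi ^+ D * eps ^+ D)) `^ 4^-1.

Lemma amplitude_gt0 : 0 < amplitude.
Proof.
rewrite /amplitude /powR ifF ?expR_gt0//; apply/negbTE.
rewrite mulf_neq0//.
  apply/negP => /det0P[v v0 vG]; have := Gamma_posdef v0.
  by rewrite vG mul0mx mxE ltxx.
by rewrite invr_eq0 mulf_neq0// expf_neq0// gt_eqF// pi_gt0.
Qed.

Lemma gaussianE z x : g z x =
  Complex (amplitude * profile (x - z.1) * cos (theta z x))
          (amplitude * profile (x - z.1) * sin (theta z x)).
Proof.
rewrite /gaussian /cexp /= -/amplitude -/(quad Gamma (x - z.1)) -/(profile (x - z.1)).
rewrite (_ : eps^-1 * _ = theta z x); last first.
  rewrite mxE mulr_sumr; apply: eq_bigr => j _.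
  by rewrite !mxE /centered; ring.
by apply/eqP; rewrite eq_complex /=; apply/andP; split; apply/eqP; ring.
Qed.

Definition temperate (f : 'rV[R]_D -> R) := continuous f /\
  exists C m, 0 <= C /\ forall x, `|f x| <= C * weight x ^+ m.

Definition ctemperate (phi : 'rV[R]_D -> R[i]) :=
  temperate (fun x => complex.Re (phi x)) /\ temperate (fun x => complex.Im (phi x)).

(** The modulus of the Gaussian centered at q times f: what remains of
    the integrand of an inner product with g_(q,p) once the phase is taken apart. *)
Definition windowed q (f : 'rV[R]_D -> R) x := amplitude * profile (x - q) * f x.

Lemma continuous_windowed q f : continuous f -> continuous (windowed q f).
Proof.
move=> cf; apply: continuous_mulR => //; apply: continuous_mulR.
  exact: continuous_cstR.
move=> x; exact: (continuous_comp (@continuous_subr _ _ q x) (@continuous_profile _ _ eps Gamma _)).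
Qed.

(** The Gaussian absorbs both exp (s |x - q| / eps) and the polynomial growth of f;
    weight_peetre moves the weight from x to x - q. *)
Lemma exp_integrable_windowed q f j : temperate f ->
  exp_integrable mu (centered eps q j) (windowed q f).
Proof.
move=> [cf [C [m [C0 fC]]]].
have cc : continuous (centered eps q j).
  apply: continuous_mulR; first exact: continuous_cstR.
  by apply: continuous_addR; [exact: continuous_coordR|exact: continuous_cstR].
split.
- exact: continuous_measurable_rV.
- by apply: continuous_measurable_rV; exact: continuous_windowed.
move=> s s0.
have [K KP] := profile_bound eps_gt0 Gamma_posdef m.+1 (divr_ge0 s0 (ltW eps_gt0)).
apply: (@integrable_weight_bound _ _ _ (amplitude * C * (2 ^+ D * weight q) ^+ m.+1 * K)).
  apply: continuous_measurable_rV; apply: continuous_mulR.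
    apply: (continuous_compR (g := expR)); last exact: continuous_expR.
    apply: continuous_mulR; first exact: continuous_cstR.
    by apply: (continuous_compR (g := Num.norm)) => //; exact: norm_continuous.
  apply: (continuous_compR (g := Num.norm)); last exact: norm_continuous.
  exact: continuous_windowed.
move=> x; have w0 (y : 'rV[R]_D) : 0 <= weight y by rewrite ltW// weight_gt0.
have a0 := ltW amplitude_gt0.
set e := expR (s * _); have e0 : 0 <= e by exact: expR_ge0.
rewrite normrM normr_id (ger0_norm e0) !normrM (ger0_norm a0) (ger0_norm (profile_ge0 _ _ _)).
have e1 : e <= expR (s / eps * `|x - q|).
  rewrite ler_expR /centered normrM gtr0_norm ?invr_gt0// mulrA ler_wpM2l//.
    by rewrite divr_ge0// ltW.
  by have := normr_coord_le (x - q) j; rewrite !mxE.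
have e2 : `|f x| * weight x <= C * ((2 ^+ D * weight q) ^+ m.+1 * weight (x - q) ^+ m.+1).
  apply: le_trans (_ : C * weight x ^+ m.+1 <= _).
    by rewrite exprSr mulrA ler_wpM2r.
  rewrite ler_wpM2l// -exprMn lerXn2r ?nnegrE ?mulr_ge0 ?exprn_ge0//.
  by rewrite -mulrA weight_peetre.
set B := (2 ^+ D * weight q) ^+ m.+1 in e2 *.
have B0 : 0 <= B by rewrite exprn_ge0// mulr_ge0// exprn_ge0.
rewrite (_ : e * _ * _ = amplitude * ((e * profile (x - q)) * (`|f x| * weight x))); last ring.
rewrite -!mulrA ler_wpM2l// !mulrA -[leLHS]mulrA.
apply: le_trans (ler_pM _ _ (ler_wpM2r (profile_ge0 _ _ _) e1) e2) _.
- by rewrite mulr_ge0 ?expR_ge0 ?profile_ge0.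
- by rewrite mulr_ge0.
rewrite (_ : _ * (C * _) = C * B * (expR (s / eps * `|x - q|) *
  profile (x - q) * weight (x - q) ^+ m.+1)); last ring.
by rewrite ler_wpM2l ?mulr_ge0.
Qed.

Lemma integrable_windowed q f : temperate f ->
  mu.-integrable setT (EFin \o windowed q f).
Proof.
move=> tf; have [cf [C [m [C0 fC]]]] := tf.
have [K KP] := profile_bound eps_gt0 Gamma_posdef m.+1 (lexx 0).
have w0 (y : 'rV[R]_D) : 0 <= weight y by rewrite ltW// weight_gt0.
have a0 := ltW amplitude_gt0.
apply: (@integrable_weight_bound _ _ _ (amplitude * (K * (C * (2 ^+ D * weight q) ^+ m.+1)))).
  by apply: continuous_measurable_rV; exact: continuous_windowed.
move=> x; rewrite !normrM (ger0_norm a0) (ger0_norm (profile_ge0 _ _ _)) -!mulrA ler_wpM2l//.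
have e2 : `|f x| * weight x <= weight (x - q) ^+ m.+1 * (C * (2 ^+ D * weight q) ^+ m.+1).
  apply: le_trans (_ : C * weight x ^+ m.+1 <= _).
    by rewrite exprSr mulrA ler_wpM2r.
  rewrite mulrCA ler_wpM2l// -exprMn lerXn2r ?nnegrE ?mulr_ge0 ?exprn_ge0//.
  by rewrite mulrC -mulrA weight_peetre.
apply: le_trans (ler_wpM2l (profile_ge0 _ _ _) e2) _.
rewrite mulrA ler_wpM2r ?mulr_ge0 ?exprn_ge0 ?mulr_ge0 ?exprn_ge0//.
by have := KP (x - q); rewrite mul0r expR0 mul1r.
Qed.

Lemma integrable_trigM (c : R -> R) z k : continuous c -> (forall t, `|c t| <= 1) ->
  mu.-integrable setT (EFin \o k) ->
  mu.-integrable setT (EFin \o (fun x => c (theta z x) * k x)).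
Proof.
move=> cc c1 ik; apply: integrable_leR (integrable_norm ik).
  apply: measurable_funM; last exact: measurable_integrand ik.
  apply: continuous_measurable_rV; apply: (continuous_compR (g := c)) => //.
  exact: continuous_phase.
by move=> x; rewrite normrM ler_piMl.
Qed.

Lemma inner_gaussianE z phi : inner (g z) phi = Complex
  (\int[mu]_x (cos (theta z x) * windowed z.1 (fun y => complex.Re (phi y)) x +
               sin (theta z x) * windowed z.1 (fun y => complex.Im (phi y)) x))
  (\int[mu]_x (cos (theta z x) * windowed z.1 (fun y => complex.Im (phi y)) x +
               sin (theta z x) * - windowed z.1 (fun y => complex.Re (phi y)) x)).
Proof.
rewrite /inner /cintegral; congr Complex; apply: eq_Rintegral => x _.
  by rewrite gaussianE /windowed Re_mulc /=; ring.
by rewrite gaussianE /windowed Im_mulc /=; ring.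
Qed.

Lemma thetaN (q p x : 'rV[R]_D) : theta (q, - p) x = - theta (q, p) x.
Proof. by rewrite /phase -sumrN; apply: eq_bigr => j _; rewrite mxE mulNr. Qed.

(** The transform at (q, p) is the Fourier transform at p / eps up to a phase
    depending on q only; hence the frequency eps * s in the proof. *)
Lemma windowed_fourier_injective (q : 'rV[R]_D) k : mu.-integrable setT (EFin \o k) ->
  continuous k ->
  (forall p, \int[mu]_x (cos (theta (q, p) x) * k x) = 0) ->
  (forall p, \int[mu]_x (sin (theta (q, p) x) * k x) = 0) ->
  forall x, k x = 0.
Proof.
move=> ik ck kc ks; apply: fourier_injective => // s th.
pose c := \sum_j s ord0 j * q ord0 j + th.
have E x : phase (fun j (y : 'rV[R]_D) => y ord0 j) s x + th =
    theta (q, eps *: s) x + c.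
  rewrite addrA; congr (_ + _); rewrite -big_split/=; apply: eq_bigr => j _.
  by rewrite mxE /centered; field; rewrite gt_eqF.
have icos := integrable_trigM (q, eps *: s) (@continuous_cos R) (@cos_max R) ik.
have isin := integrable_trigM (q, eps *: s) (@continuous_sin R) (@sin_max R) ik.
transitivity (\int[mu]_x (cos c * (cos (theta (q, eps *: s) x) * k x) -
                          sin c * (sin (theta (q, eps *: s) x) * k x))).
  by apply: eq_Rintegral => x _; rewrite E cosD; ring.
rewrite RintegralB//; [|exact: integrable_scaleR..].
by rewrite !RintegralZl// kc ks !mulr0 subr0.
Qed.

(** Otherwise the Fourier transform of windowed q phi vanishes.  In the vanishing
    real and imaginary parts, the cosine transforms are even in p and the sine
    transforms odd; comparing p with - p separates them, so that the real functions
    Re phi and Im phi can be treated one at a time. *)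
Lemma inner_gaussian_neq0 q phi x0 : ctemperate phi -> phi x0 != 0 ->
  exists p, inner (g (q, p)) phi != 0.
Proof.
move=> [t1 t2] phi0; apply: contrapT => /forallNP all0.
have i0 p : inner (g (q, p)) phi = 0 by apply/eqP/negPn/negP; exact: all0.
set k1 := windowed q (fun y => complex.Re (phi y)).
set k2 := windowed q (fun y => complex.Im (phi y)).
have ik1 : mu.-integrable setT (EFin \o k1) by exact: integrable_windowed.
have ik2 : mu.-integrable setT (EFin \o k2) by exact: integrable_windowed.
have ic p k (ik : mu.-integrable setT (EFin \o k)) :=
  integrable_trigM (q, p) (@continuous_cos R) (@cos_max R) ik.
have is_ p k (ik : mu.-integrable setT (EFin \o k)) :=
  integrable_trigM (q, p) (@continuous_sin R) (@sin_max R) ik.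
pose C k p := \int[mu]_x (cos (theta (q, p) x) * k x).
pose S k p := \int[mu]_x (sin (theta (q, p) x) * k x).
have CN k p : C k (- p) = C k p.
  by apply: eq_Rintegral => x _; rewrite thetaN cosN.
have SN k p : mu.-integrable setT (EFin \o k) -> S k (- p) = - S k p.
  move=> ik; rewrite -mulN1r -RintegralZl//; last exact: is_.
  by apply: eq_Rintegral => x _; rewrite thetaN sinN; ring.
have e1 p : C k1 p + S k2 p = 0.
  rewrite -RintegralD//; [|exact: ic|exact: is_].
  by have := i0 p; rewrite inner_gaussianE => -[].
have e2 p : C k2 p - S k1 p = 0.
  rewrite -RintegralB//; [|exact: ic|exact: is_].
  have := i0 p; rewrite inner_gaussianE => -[_] <-.
  by apply: eq_Rintegral => x _; rewrite mulrN.
have [ck1 ck2] : continuous k1 /\ continuous k2.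
  by split; apply: continuous_windowed; [exact: t1.1|exact: t2.1].
have L (a b : R) : a + b = 0 -> a - b = 0 -> a = 0 /\ b = 0.
  by move=> h1 h2; split; lra.
have p1 p : C k1 p = 0 /\ S k2 p = 0.
  by apply: L (e1 p) _; rewrite -(e1 (- p)) CN SN.
have p2 p : C k2 p = 0 /\ S k1 p = 0.
  have [||h1 h2] := L (C k2 p) (- S k1 p).
  - exact: e2.
  - by rewrite -(e2 (- p)) CN SN.
  - by split=> //; rewrite -[LHS]opprK h2 oppr0.
have k0 : k1 x0 = 0 /\ k2 x0 = 0.
  split.
    apply: (windowed_fourier_injective ik1 ck1) => p; first exact: (p1 p).1.
    exact: (p2 p).2.
  apply: (windowed_fourier_injective ik2 ck2) => p; first exact: (p2 p).1.
  exact: (p1 p).2.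
move: phi0; rewrite eq_complex/= => /negP; apply.
have a0 : amplitude * profile (x0 - q) != 0.
  by rewrite mulf_neq0 ?gt_eqF ?amplitude_gt0// expR_gt0.
move: k0; rewrite /k1 /k2 /windowed => -[/eqP + /eqP].
by rewrite mulf_eq0 (negbTE a0)/= => ->; rewrite mulf_eq0 (negbTE a0)/= => ->.
Qed.

Section measurability.
Context {d : measure_display} {T : measurableType d}.
Variables (z : T -> phase_space) (f1 f2 : T * 'rV[R]_D -> R).
Hypotheses (mz : measurable_fun setT z) (mf1 : measurable_fun setT f1)
  (mf2 : measurable_fun setT f2).

Lemma measurable_theta :
  measurable_fun setT (fun w : T * 'rV[R]_D => theta (z w.1) w.2).
Proof.
have [mq mp] : measurable_fun setT (fst \o z) /\ measurable_fun setT (snd \o z).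
  exact/measurable_fun_pairP.
apply: measurable_sum => j; apply: measurable_funM.
  apply: (measurableT_comp (measurable_coord j)).
  exact: (measurableT_comp mp).
apply: measurable_funM => //; apply: measurable_funB.
  by apply: (measurableT_comp (measurable_coord j)); exact: measurable_snd.
apply: (measurableT_comp (measurable_coord j)).
exact: (measurableT_comp mq).
Qed.

Lemma measurable_windowed f : measurable_fun setT f ->
  measurable_fun setT (fun w : T * 'rV[R]_D =>
    windowed (z w.1).1 (fun y => f (w.1, y)) w.2).
Proof.
have [mq mp] : measurable_fun setT (fst \o z) /\ measurable_fun setT (snd \o z).
  exact/measurable_fun_pairP.
move=> mf; apply: measurable_funM; last first.
  by under eq_fun do rewrite -surjective_pairing.
apply: measurable_funM => //.
apply: (measurableT_comp (f := profile)).
  by apply: continuous_measurable_rV; exact: continuous_profile.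
apply/measurable_fun_rVP => j; under eq_fun do rewrite !mxE.
apply: measurable_funB.
  by apply: (measurableT_comp (measurable_coord j)); exact: measurable_snd.
apply: (measurableT_comp (measurable_coord j)).
exact: (measurableT_comp mq).
Qed.

Let ip t := inner (g (z t)) (fun x => Complex (f1 (t, x)) (f2 (t, x))).

(** Stated for a packet z t and a function both depending on a parameter t, to
    cover z |-> <g_z, psi0> as well as (y, z) |-> <g_y, A g_z>. *)
Lemma measurable_inner_gaussian :
  measurable_fun setT (fun t => complex.Re (ip t)) /\
  measurable_fun setT (fun t => complex.Im (ip t)).
Proof.
have mc : measurable_fun setT (fun w : T * 'rV[R]_D => cos (theta (z w.1) w.2)).
  by apply: measurableT_comp; [exact: measurable_cos|exact: measurable_theta].
have ms : measurable_fun setT (fun w : T * 'rV[R]_D => sin (theta (z w.1) w.2)).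
  by apply: measurableT_comp; [exact: measurable_sin|exact: measurable_theta].
split; rewrite /ip; under eq_fun do rewrite inner_gaussianE/=.
  apply: (@measurable_Rintegral_param _ _ _ _ _ mu (fun w : T * 'rV[R]_D =>
    cos (theta (z w.1) w.2) * windowed (z w.1).1 (fun y => f1 (w.1, y)) w.2 +
    sin (theta (z w.1) w.2) * windowed (z w.1).1 (fun y => f2 (w.1, y)) w.2)).
  by apply: measurable_funD; apply: measurable_funM => //; exact: measurable_windowed.
apply: (@measurable_Rintegral_param _ _ _ _ _ mu (fun w : T * 'rV[R]_D =>
  cos (theta (z w.1) w.2) * windowed (z w.1).1 (fun y => f2 (w.1, y)) w.2 +
  sin (theta (z w.1) w.2) * - windowed (z w.1).1 (fun y => f1 (w.1, y)) w.2)).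
apply: measurable_funD; apply: measurable_funM => //; first exact: measurable_windowed.
by apply: measurable_funN; exact: measurable_windowed.
Qed.

End measurability.

End wave_packets.

(** * Zero set and decay of the wave packet transform *)

Section wave_packet_transform.
Local Open Scope complex_scope.
Context {R : realType} {D : nat}.
Variables (eps : R) (Gamma : 'M[R]_D).
Hypotheses (eps_gt0 : 0 < eps) (Gamma_sym : Gamma^T = Gamma)
  (Gamma_posdef : posdefmx Gamma).
Local Notation phase_space := ('rV[R]_D * 'rV[R]_D)%type.
Local Notation mu := (@lebesgue_rV R D).
Local Notation theta z := (phase (centered eps z.1) z.2).
Local Notation g := (gaussian eps Gamma).
Local Notation profile := (profile eps Gamma).
Local Notation amplitude := (amplitude eps Gamma).

Lemma measurable_cset0 d (T : measurableType d) (f : T -> R[i]) :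
  measurable_fun setT (fun t => complex.Re (f t)) ->
  measurable_fun setT (fun t => complex.Im (f t)) ->
  measurable [set t | f t = 0].
Proof.
move=> mR mI.
rewrite (_ : [set t | _] = (setT `&` (fun t => complex.Re (f t)) @^-1` [set 0]) `&`
  (setT `&` (fun t => complex.Im (f t)) @^-1` [set 0])).
  by apply: measurableI; [exact: mR|exact: mI].
rewrite !setTI; apply/seteqP; split=> t /=; first by move=> ->.
by move=> [fR fI]; apply/eqP; rewrite eq_complex fR fI !eqxx.
Qed.

Lemma measurable_inner_fixed phi : ctemperate phi ->
  measurable_fun setT (fun z => complex.Re (inner (g z) phi)) /\
  measurable_fun setT (fun z => complex.Im (inner (g z) phi)).
Proof.
move=> [[c1 _] [c2 _]].
have mm (f : 'rV[R]_D -> R) : continuous f ->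
    measurable_fun setT (fun w : phase_space * 'rV[R]_D => f w.2).
  move=> cf; apply: (measurableT_comp (continuous_measurable_rV cf)).
  exact: measurable_snd.
have := @measurable_inner_gaussian R D eps Gamma _ phase_space id _ _
  (@measurable_id _ _ _) (mm _ c1) (mm _ c2).
rewrite (_ : (fun t => complex.Re _) = (fun z => complex.Re (inner (g z) phi))); last first.
  by apply/funext => z; congr (complex.Re (inner _ _)); apply/funext => x; case: (phi x).
rewrite (_ : (fun t => complex.Im _) = (fun z => complex.Im (inner (g z) phi))) //.
by apply/funext => z; congr (complex.Im (inner _ _)); apply/funext => x; case: (phi x).
Qed.

(** One of the real and imaginary parts is nonzero at some p0, and both are
    separately entire in p. *)
Lemma inner_gaussian_null_momentum q phi x0 : ctemperate phi -> phi x0 != 0 ->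
  mu [set p | inner (g (q, p)) phi = 0] = 0%E.
Proof.
move=> tphi phi0.
have [p0 ip0] := inner_gaussian_neq0 eps_gt0 Gamma_posdef q tphi phi0.
have [mR mI] := measurable_inner_fixed tphi.
have [t1 t2] := tphi.
have hR := fun j => exp_integrable_windowed eps_gt0 Gamma_posdef q j t1.
have hI := fun j => exp_integrable_windowed eps_gt0 Gamma_posdef q j t2.
have hN j : exp_integrable mu (centered eps q j)
    (fun x => - windowed eps Gamma q (fun y => complex.Re (phi y)) x).
  apply: exp_integrable_le (hR j) (hR j) _ _.
    by apply: measurable_funN; have [] := hR j.
  by move=> x; rewrite normrN lerDl.
have sub (f : 'rV[R]_D -> R) : measurable_fun setT f -> sep_entire f -> f p0 != 0 ->
    [set p | inner (g (q, p)) phi = 0] `<=` [set p | f p = 0] ->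
    mu [set p | inner (g (q, p)) phi = 0] = 0%E.
  move=> mf fE f0 sf; apply/eqP; rewrite -measure_le0.
  rewrite -[leRHS](sep_entire_zero_null mf fE f0) le_measure// inE.
    by apply: measurable_cset0;
      [exact: (measurable_fun_pair2 q mR)|exact: (measurable_fun_pair2 q mI)].
  by rewrite -[X in measurable X]setTI; exact: (mf measurableT [set 0] (measurable_set1 0)).
have := ip0; rewrite eq_complex/= negb_and => /orP[h|h].
  apply: (sub (fun p => complex.Re (inner (g (q, p)) phi))) => //.
  - exact: (measurable_fun_pair2 q mR).
  - under eq_fun do rewrite inner_gaussianE/=.
    exact: sep_entire_integral_trig.
  - by move=> p; rewrite /mkset => ->.
apply: (sub (fun p => complex.Im (inner (g (q, p)) phi))) => //.
- exact: (measurable_fun_pair2 q mI).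
- under eq_fun do rewrite inner_gaussianE/=.
  exact: sep_entire_integral_trig.
- by move=> p; rewrite /mkset => ->.
Qed.

Lemma inner_gaussian_null phi x0 : ctemperate phi -> phi x0 != 0 ->
  @lebesgue_2D R D [set z | inner (g z) phi = 0] = 0%E.
Proof.
move=> tphi phi0.
transitivity (\int[mu]_q (cst 0%E q : \bar R))%E; last exact: integral0.
apply: eq_integral => q _ /=.
rewrite -[RHS](inner_gaussian_null_momentum q tphi phi0); congr (mu _).
by apply/seteqP; split=> p; rewrite /xsection/= inE.
Qed.

Lemma schwartz_ctemperate psi : schwartz psi -> @ctemperate R D psi.
Proof.
move=> /schwartz_ReIm[cR cI].
have [kR rR _ _] := cR _ (Span_base (ex_intro _ [::] erefl)).
have [kI rI _ _] := cI _ (Span_base (ex_intro _ [::] erefl)).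
have tb (f : 'rV[R]_D -> R) : continuous f -> rapid f -> temperate f.
  move=> cf rf; split => //; have [C CP] := rf 0%N; exists C, 0%N; split.
    by have := CP 0; apply: le_trans; rewrite expr0 mulr1.
  by move=> x; rewrite expr0 mulr1; have := CP x; rewrite expr0 mulr1.
by split; exact: tb.
Qed.

(** Each of the real and imaginary parts is a combination of two transforms with
    window profile, to which stft_rapid applies. *)
Lemma inner_schwartz_rapid psi m : schwartz psi -> exists2 C : R, 0 <= C &
  forall z, Normc.normc (inner (g z) psi) * (weight z.1 * weight z.2) ^+ m <= C.
Proof.
move=> sp; have [cR cI] := schwartz_ReIm sp.
have [t1 t2] := schwartz_ctemperate sp.
have SR : schwartz_span (fun x => complex.Re (psi x)) (fun x => complex.Re (psi x)).
  by apply: Span_base; exists [::].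
have SI : schwartz_span (fun x => complex.Im (psi x)) (fun x => complex.Im (psi x)).
  by apply: Span_base; exists [::].
have SG : gauss_span eps Gamma profile by apply: Span_base.
have e0 : eps != 0 by rewrite gt_eqF.
have cG := gauss_span_class eps_gt0 Gamma_sym Gamma_posdef.
have [C1 C10 b1] := stft_rapid e0 cG cR 0 m SG SR.
have [C2 C20 b2] := stft_rapid e0 cG cI (- (pi / 2)) m SG SI.
have [C3 C30 b3] := stft_rapid e0 cG cI 0 m SG SI.
have [C4 C40 b4] := stft_rapid e0 cG cR (- (pi / 2)) m SG SR.
have a0 := amplitude_gt0 eps_gt0 Gamma_posdef.
exists (amplitude * ((C1 + C2) + (C3 + C4))).
  by rewrite mulr_ge0 ?addr_ge0// ltW.
move=> z.
have icos k (ik : mu.-integrable setT (EFin \o k)) :=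
  integrable_trigM eps z (@continuous_cos R) (@cos_max R) ik.
have isin k (ik : mu.-integrable setT (EFin \o k)) :=
  integrable_trigM eps z (@continuous_sin R) (@sin_max R) ik.
have i1 := integrable_windowed eps_gt0 Gamma_posdef z.1 t1.
have i2 := integrable_windowed eps_gt0 Gamma_posdef z.1 t2.
have Ec f : mu.-integrable setT (EFin \o windowed eps Gamma z.1 f) ->
    \int[mu]_x (cos (theta z x) * windowed eps Gamma z.1 f x) =
    amplitude * stft eps 0 profile f z.
  move=> fi; apply/esym; have /eqP a0' : amplitude != 0 by rewrite gt_eqF.
  have -> : stft eps 0 profile f z =
      \int[mu]_x (amplitude^-1 * (cos (theta z x) * windowed eps Gamma z.1 f x)).
    apply: eq_Rintegral => x _; rewrite addr0 /windowed; field; exact/eqP.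
  by rewrite RintegralZl ?mulrA ?divff ?mul1r//; [exact/eqP|exact: icos].
have Es f : mu.-integrable setT (EFin \o windowed eps Gamma z.1 f) ->
    \int[mu]_x (sin (theta z x) * windowed eps Gamma z.1 f x) =
    amplitude * stft eps (- (pi / 2)) profile f z.
  move=> fi; apply/esym; have /eqP a0' : amplitude != 0 by rewrite gt_eqF.
  have -> : stft eps (- (pi / 2)) profile f z =
      \int[mu]_x (amplitude^-1 * (sin (theta z x) * windowed eps Gamma z.1 f x)).
    apply: eq_Rintegral => x _; rewrite cosBpihalf /windowed; field; exact/eqP.
  by rewrite RintegralZl ?mulrA ?divff ?mul1r//; [exact/eqP|exact: isin].
have w0 : 0 <= (weight z.1 * weight z.2) ^+ m.
  by rewrite exprn_ge0// mulr_ge0// ltW// weight_gt0.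
apply: le_trans (ler_wpM2r w0 (normc_le_ReIm _)) _.
have E1 : complex.Re (inner (g z) psi) = amplitude *
    (stft eps 0 profile (fun x => complex.Re (psi x)) z +
     stft eps (- (pi / 2)) profile (fun x => complex.Im (psi x)) z).
  rewrite inner_gaussianE/= RintegralD//; [|exact: icos|exact: isin].
  by rewrite Ec// Es// mulrDr.
have E2 : complex.Im (inner (g z) psi) = amplitude *
    (stft eps 0 profile (fun x => complex.Im (psi x)) z -
     stft eps (- (pi / 2)) profile (fun x => complex.Re (psi x)) z).
  rewrite inner_gaussianE/= mulrBr -Ec// -Es// -RintegralB//; [|exact: icos|exact: isin].
  by apply: eq_Rintegral => x _; rewrite mulrN.
rewrite E1 E2 !normrM !(ger0_norm (ltW a0)).
rewrite -mulrDr -mulrA ler_pM2l// mulrDl.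
apply: lerD; apply: le_trans (ler_wpM2r w0 (ler_normD _ _)) _.
  by rewrite mulrDl lerD.
by rewrite normrN mulrDl lerD.
Qed.

Lemma L2norm_neq0 (psi : 'rV[R]_D -> R[i]) : L2norm psi = 1%E -> exists x, psi x != 0.
Proof.
move=> n1; apply: contrapT => /forallNP h; move: n1.
rewrite /L2norm (_ : (fun x => _) = cst 0%E).
  by rewrite Lnorm0// => -[] /esym/eqP; rewrite oner_eq0.
apply/funext => x; have /negP := h x; rewrite negbK => /eqP ->.
by rewrite Normc.normc0.
Qed.

End wave_packet_transform.

(** * Symbols of polynomial growth and complex derivatives *)

Section symbols.
Context {R : realType} {D : nat}.
Local Notation phase_space := ('rV[R]_D * 'rV[R]_D)%type.
Implicit Types M N : phase_space -> 'rV[R]_D -> R.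

(** Families of functions of x indexed by phase space, continuous in x and of
    polynomial growth in all the variables: stable under the algebraic
    operations which produce the multipliers of Gaussians. *)
Definition symbol M := [/\ measurable_fun setT (fun w : phase_space * 'rV[R]_D => M w.1 w.2),
  forall z, continuous (M z) &
  exists C m, 0 <= C /\ forall z x,
    `|M z x| <= C * (weight z.1 * weight z.2 * weight x) ^+ m].

Let bigweight_ge1 (z : phase_space) (x : 'rV[R]_D) :
  1 <= weight z.1 * weight z.2 * weight x.
Proof. by rewrite !mulr_ege1 ?weight_ge1. Qed.

Let bigweight_ge0 (z : phase_space) (x : 'rV[R]_D) :
  0 <= weight z.1 * weight z.2 * weight x.
Proof. exact: le_trans (bigweight_ge1 z x). Qed.

Lemma symbol_cst c : symbol (fun _ _ => c).
Proof.
split; [exact: measurable_cst|by move=> z; exact: continuous_cstR|].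
by exists `|c|, 0%N; split => // z x; rewrite expr0 mulr1.
Qed.

Lemma symbolD M N : symbol M -> symbol N -> symbol (fun z x => M z x + N z x).
Proof.
move=> [mM cM [C [m [C0 MC]]]] [mN cN [C' [m' [C'0 NC]]]]; split.
- exact: measurable_funD.
- by move=> z; exact: continuous_addR.
exists (C + C'), (m + m')%N; split => [|z x]; first exact: addr_ge0.
apply: le_trans (ler_normD _ _) _; rewrite mulrDl; apply: lerD.
  apply: le_trans (MC z x) _.
  by rewrite ler_wpM2l// ler_weXn2l// leq_addr.
apply: le_trans (NC z x) _.
by rewrite ler_wpM2l// ler_weXn2l// leq_addl.
Qed.

Lemma symbolM M N : symbol M -> symbol N -> symbol (fun z x => M z x * N z x).
Proof.
move=> [mM cM [C [m [C0 MC]]]] [mN cN [C' [m' [C'0 NC]]]]; split.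
- exact: measurable_funM.
- by move=> z; exact: continuous_mulR.
exists (C * C'), (m + m')%N; split => [|z x]; first exact: mulr_ge0.
by rewrite normrM exprD mulrACA ler_pM.
Qed.

Lemma symbolN M : symbol M -> symbol (fun z x => - M z x).
Proof.
move=> sM; have := symbolM (symbol_cst (-1)) sM; congr symbol.
by apply/funext => z; apply/funext => x; rewrite mulN1r.
Qed.

Lemma symbol_sum (I : Type) (s : seq I) (F : I -> phase_space -> 'rV[R]_D -> R) :
  (forall i, symbol (F i)) -> symbol (fun z x => \sum_(i <- s) F i z x).
Proof.
move=> sF; elim: s => [|i s ih].
  have := symbol_cst 0; congr symbol.
  by apply/funext => z; apply/funext => x; rewrite big_nil.
have := symbolD (sF i) ih; congr symbol.
by apply/funext => z; apply/funext => x; rewrite big_cons.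
Qed.

Lemma symbol_position (V : 'rV[R]_D -> R) (C : R) m : continuous V -> 0 <= C ->
  (forall x, `|V x| <= C * weight x ^+ m) -> symbol (fun _ x => V x).
Proof.
move=> cV C0 VC; split => //.
  apply: (measurableT_comp (continuous_measurable_rV cV)).
  exact: measurable_snd.
exists C, m; split => // z x; apply: le_trans (VC x) _.
rewrite ler_wpM2l// lerXn2r ?nnegrE ?(ltW (weight_gt0 _))//.
by rewrite ler_peMl ?(ltW (weight_gt0 _))// mulr_ege1 ?weight_ge1.
Qed.

Lemma symbol_coord j : symbol (fun _ x => x ord0 j).
Proof.
apply: (@symbol_position _ 1 1) => //; first exact: continuous_coordR.
by move=> x; rewrite mul1r expr1 coord_le_weight.
Qed.

Lemma symbol_q j : symbol (fun z _ => z.1 ord0 j).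
Proof.
split; [|by move=> z; exact: continuous_cstR|].
  apply: (measurableT_comp (measurable_coord j)).
  by apply: (measurableT_comp measurable_fst); exact: measurable_fst.
exists 1, 1%N; split => // z x; rewrite mul1r expr1.
apply: le_trans (coord_le_weight _ _) _.
by rewrite -mulrA ler_peMr ?(ltW (weight_gt0 _))// mulr_ege1 ?weight_ge1.
Qed.

Lemma symbol_p j : symbol (fun z _ => z.2 ord0 j).
Proof.
split; [|by move=> z; exact: continuous_cstR|].
  apply: (measurableT_comp (measurable_coord j)).
  by apply: (measurableT_comp measurable_snd); exact: measurable_fst.
exists 1, 1%N; split => // z x; rewrite mul1r expr1.
apply: le_trans (coord_le_weight _ _) _.
by rewrite mulrAC ler_peMl ?(ltW (weight_gt0 _))// mulr_ege1 ?weight_ge1.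
Qed.

Implicit Types K L : phase_space -> 'rV[R]_D -> R[i].

Definition csymbol K := symbol (fun z x => complex.Re (K z x)) /\
  symbol (fun z x => complex.Im (K z x)).

Lemma csymbol_cst c : csymbol (fun _ _ => c).
Proof. by split; exact: symbol_cst. Qed.

Lemma csymbolD K L : csymbol K -> csymbol L -> csymbol (fun z x => K z x + L z x).
Proof.
move=> [K1 K2] [L1 L2]; split.
  have := symbolD K1 L1; congr symbol; apply/funext => z; apply/funext => x.
  by case: (K z x) (L z x) => ? ? [].
have := symbolD K2 L2; congr symbol; apply/funext => z; apply/funext => x.
by case: (K z x) (L z x) => ? ? [].
Qed.

Lemma csymbolM K L : csymbol K -> csymbol L -> csymbol (fun z x => K z x * L z x).
Proof.
move=> [K1 K2] [L1 L2]; split.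
  have := symbolD (symbolM K1 L1) (symbolN (symbolM K2 L2)); congr symbol.
  by apply/funext => z; apply/funext => x; rewrite Re_mulc.
have := symbolD (symbolM K1 L2) (symbolM K2 L1); congr symbol.
by apply/funext => z; apply/funext => x; rewrite Im_mulc.
Qed.

Lemma csymbol_sum (I : Type) (s : seq I) (F : I -> phase_space -> 'rV[R]_D -> R[i]) :
  (forall i, csymbol (F i)) -> csymbol (fun z x => \sum_(i <- s) F i z x).
Proof.
move=> sF; elim: s => [|i s ih].
  have := csymbol_cst 0; congr csymbol.
  by apply/funext => z; apply/funext => x; rewrite big_nil.
have := csymbolD (sF i) ih; congr csymbol.
by apply/funext => z; apply/funext => x; rewrite big_cons.
Qed.

Lemma csymbol_poly K (p : {poly R[i]}) : csymbol K ->
  csymbol (fun z x => p.[K z x]).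
Proof.
move=> sK; elim/poly_ind: p => [|p c ih].
  have := csymbol_cst 0; congr csymbol.
  by apply/funext => z; apply/funext => x; rewrite horner0.
have := csymbolD (csymbolM ih sK) (csymbol_cst c); congr csymbol.
by apply/funext => z; apply/funext => x; rewrite hornerMXaddC.
Qed.

Lemma csymbol_real M : symbol M -> csymbol (fun z x => Complex (M z x) 0).
Proof. by move=> sM; split => //; exact: symbol_cst. Qed.

End symbols.

Section complex_derivatives.
Local Open Scope complex_scope.
Context {R : realType} {D : nat}.
Implicit Types f h : 'rV[R]_D -> R[i].

Definition has_cpartial (j : 'I_D) f f' :=
  has_partial j (fun x => complex.Re (f x)) (fun x => complex.Re (f' x)) /\
  has_partial j (fun x => complex.Im (f x)) (fun x => complex.Im (f' x)).

Lemma cpartialE j f f' : has_cpartial j f f' -> cpartial j f = f'.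
Proof.
move=> [h1 h2]; apply/funext => x; rewrite /cpartial (partialE h1) (partialE h2).
by case: (f' x).
Qed.

Lemma has_cpartial_cst j c : has_cpartial j (fun=> c) (fun=> 0).
Proof. by split; exact: has_partial_cst. Qed.

Lemma has_cpartialD j f f' h h' : has_cpartial j f f' -> has_cpartial j h h' ->
  has_cpartial j (fun x => f x + h x) (fun x => f' x + h' x).
Proof.
move=> [f1 f2] [h1 h2]; split.
  have := has_partialD f1 h1; congr has_partial; apply/funext => x.
    by case: (f x) (h x) => ? ? [].
  by case: (f' x) (h' x) => ? ? [].
have := has_partialD f2 h2; congr has_partial; apply/funext => x.
  by case: (f x) (h x) => ? ? [].
by case: (f' x) (h' x) => ? ? [].
Qed.

Lemma has_cpartialM j f f' h h' : has_cpartial j f f' -> has_cpartial j h h' ->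
  has_cpartial j (fun x => f x * h x) (fun x => f' x * h x + f x * h' x).
Proof.
move=> [f1 f2] [h1 h2]; split.
  have := has_partialD (has_partialM f1 h1) (has_partialZ (-1) (has_partialM f2 h2)).
  congr has_partial; apply/funext => x; first by rewrite Re_mulc mulN1r.
  by case: (f x) (h x) (f' x) (h' x) => ? ? [? ?] [? ?] [? ?] /=; ring.
have := has_partialD (has_partialM f1 h2) (has_partialM f2 h1).
congr has_partial; apply/funext => x; first by rewrite Im_mulc.
by case: (f x) (h x) (f' x) (h' x) => ? ? [? ?] [? ?] [? ?] /=; ring.
Qed.

End complex_derivatives.

(** * Observables as multipliers of Gaussians *)

Section observables_on_gaussians.
Local Open Scope complex_scope.
Context {R : realType} {D : nat}.
Variables (eps : R) (Gamma : 'M[R]_D) (V : 'rV[R]_D -> R).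
Hypotheses (eps_gt0 : 0 < eps) (Gamma_sym : Gamma^T = Gamma)
  (Gamma_posdef : posdefmx Gamma).
Local Notation phase_space := ('rV[R]_D * 'rV[R]_D)%type.
Local Notation g := (gaussian eps Gamma).
Local Notation theta z := (phase (centered eps z.1) z.2).
Implicit Types z : phase_space.

(** The vector p + i Gamma (x - q): the operator phat multiplies the Gaussian
    at z by its j-th component. *)
Definition local_momentum j z x : R[i] := Complex (z.2 ord0 j) (mulGamma Gamma j (x - z.1)).
Definition i_over_eps : R[i] := Complex 0 eps^-1.

Lemma has_cpartial_gaussian j z :
  has_cpartial j (g z) (fun x => i_over_eps * local_momentum j z x * g z x).
Proof.
have dp := has_partialZ (amplitude eps Gamma)
  (has_partial_shift z.1 (has_partial_profile eps_gt0 Gamma_sym j)).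
have dc := has_partial_comp (has_partial_phase eps z.1 z.2 j) (fun t => is_derive_cos t).
have ds := has_partial_comp (has_partial_phase eps z.1 z.2 j) (fun t => is_derive_sin t).
split.
  have := has_partialM dp dc; congr has_partial; apply/funext => x.
    by rewrite gaussianE.
  by rewrite gaussianE /local_momentum /i_over_eps /=; ring.
have := has_partialM dp ds; congr has_partial; apply/funext => x.
  by rewrite gaussianE.
by rewrite gaussianE /local_momentum /i_over_eps /=; ring.
Qed.

Lemma has_cpartial_local_momentum j z :
  has_cpartial j (local_momentum j z) (fun=> Complex 0 (Gamma j j)).
Proof.
split; first exact: has_partial_cst.
have dG : has_partial j (mulGamma Gamma j) (fun=> \sum_k Gamma k j * (k == j)%:R).
  by apply: has_partial_sum => k; apply: has_partialZ; exact: has_partial_coord.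
have := has_partial_shift z.1 dG; congr has_partial; apply/funext => x /=.
rewrite (bigD1 j)//= eqxx mulr1 big1 ?addr0// => k kj.
by rewrite (negbTE kj) mulr0.
Qed.

Lemma has_cpartial_horner j z (p : {poly R[i]}) :
  has_cpartial j (fun x => p.[local_momentum j z x])
    (fun x => p^`().[local_momentum j z x] * Complex 0 (Gamma j j)).
Proof.
elim/poly_ind: p => [|p c ih].
  rewrite (_ : (fun x => 0.[_]) = fun=> 0); last by apply/funext => x; rewrite horner0.
  rewrite (_ : (fun x => 0^`().[_] * _) = fun=> 0); first exact: has_cpartial_cst.
  by apply/funext => x; rewrite linear0 horner0 mul0r.
have := has_cpartialD (has_cpartialM ih (has_cpartial_local_momentum j z)) (has_cpartial_cst j c).
congr has_cpartial; apply/funext => x; first by rewrite hornerMXaddC.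
rewrite derivMXaddC hornerD hornerMX addr0 mulrDl addrC; congr (_ + _).
by rewrite mulrAC.
Qed.

(** Polynomials of Hermite type: by the Leibniz rule,
    phat (P(l) g) = (l P(l) + eps Gamma_jj P'(l)) g with l the local momentum,
    whose derivative is constant. *)
Fixpoint momentum_poly (j : 'I_D) n : {poly R[i]} :=
  if n is m.+1 then 'X * momentum_poly j m +
    (eps * Gamma j j)%:C *: (momentum_poly j m)^`()
  else 1.

Lemma size_momentum_poly j n : size (momentum_poly j n) = n.+1.
Proof.
elim: n => [|n ih]; first by rewrite size_poly1.
have p0 : momentum_poly j n != 0 by rewrite -size_poly_gt0 ih.
have sX : size ('X * momentum_poly j n) = n.+2.
  by rewrite mulrC size_mulX ?ih.
rewrite /= size_polyDl ?sX//.
apply: leq_ltn_trans (size_scale_leq _ _) _.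
by apply: leq_trans (lt_size_deriv p0) _; rewrite ih.
Qed.

Lemma iter_phat_gaussian j n z :
  iter n (phat eps j) (g z) = (fun x => (momentum_poly j n).[local_momentum j z x] * g z x).
Proof.
elim: n => [|n ih]; first by apply/funext => x; rewrite /= -polyC1 hornerC mul1r.
rewrite iterS ih; apply/funext => x; rewrite /phat.
rewrite (cpartialE (has_cpartialM (has_cpartial_horner j z _) (has_cpartial_gaussian j z))).
rewrite /= hornerD hornerZ hornerM hornerX.
set P := (momentum_poly j n).[_]; set P' := (_^`()).[_]; set l := local_momentum j z x.
have e1 : - 'i%C * eps%:C * i_over_eps = 1 :> R[i].
  apply/eqP; rewrite eq_complex /=; apply/andP.
  by split; apply/eqP; field; rewrite gt_eqF.
have e2 : - 'i%C * eps%:C * Complex 0 (Gamma j j) = (eps * Gamma j j)%:C :> R[i].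
  by apply/eqP; rewrite eq_complex /=; apply/andP; split; apply/eqP; ring.
rewrite -e2 mulrDr.
rewrite (_ : _ * (P * _) = (- 'i%C * eps%:C * i_over_eps) * (l * P * g z x)); last ring.
by rewrite e1; ring.
Qed.

Lemma csymbol_local_momentum j : csymbol (local_momentum j).
Proof.
split; first exact: symbol_p.
rewrite /local_momentum/=; apply: symbol_sum => k.
apply: symbolM; first exact: symbol_cst.
have -> : (fun z (x : 'rV[R]_D) => (x - z.1) ord0 k) =
    (fun z x => x ord0 k + - z.1 ord0 k).
  by apply/funext => z; apply/funext => x; rewrite !mxE.
by apply: symbolD; [exact: symbol_coord|apply: symbolN; exact: symbol_q].
Qed.

Lemma diag_gt0 j : 0 < Gamma j j.
Proof.
have := @Gamma_posdef (delta_mx ord0 j).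
rewrite -rowE trmx_delta -colE !mxE; apply.
by apply/eqP => /rowP/(_ j)/eqP; rewrite !mxE !eqxx oner_eq0.
Qed.

(** The local momentum takes infinitely many values as x moves along the j-th axis,
    more than a nonzero polynomial of degree n has roots. *)
Lemma momentum_poly_neq0 j n z : exists x, (momentum_poly j n).[local_momentum j z x] != 0.
Proof.
apply: contrapT => /forallNP h.
have p0 : momentum_poly j n != 0 by rewrite -size_poly_gt0 size_momentum_poly.
pose pt (k : nat) := z.1 + k%:R *: delta_mx ord0 j.
have ellpt k : local_momentum j z (pt k) = Complex (z.2 ord0 j) (k%:R * Gamma j j).
  congr Complex; rewrite /pt addrC addKr /mulGamma (bigD1 j)//= !mxE !eqxx mulr1 mulrC.
  by rewrite big1 ?addr0// => i ij; rewrite !mxE (negbTE ij) andbF mulr0 mulr0.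
(* n + 1 distinct values of the local momentum, one more than the degree. *)
pose rs := [seq local_momentum j z (pt k) | k <- iota 0 n.+1].
have urs : uniq rs.
  rewrite map_inj_uniq ?iota_uniq// => k1 k2; rewrite !ellpt => -[].
  by move=> /(mulIf (lt0r_neq0 (diag_gt0 j)))/eqP; rewrite eqr_nat => /eqP.
have ars : all (root (momentum_poly j n)) rs.
  apply/allP => _ /mapP[k _ ->]; rewrite /root.
  by have /negP := h (pt k); rewrite negbK.
have := max_poly_roots p0 ars urs.
by rewrite size_map size_iota size_momentum_poly ltnn.
Qed.

Definition kinetic_symbol z x : R[i] :=
  (- (eps ^+ 2 / 2))%:C * \sum_j (i_over_eps * Complex 0 (Gamma j j) +
     i_over_eps * local_momentum j z x * (i_over_eps * local_momentum j z x)).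

Lemma kinetic_gaussian z : kinetic eps (g z) = (fun x => kinetic_symbol z x * g z x).
Proof.
apply/funext => x; rewrite /kinetic /kinetic_symbol -mulrA mulr_suml.
congr (_ * _); apply: eq_bigr => j _.
have dl := has_cpartialM (has_cpartial_cst j i_over_eps) (has_cpartial_local_momentum j z).
rewrite (cpartialE (has_cpartial_gaussian j z)).
rewrite (cpartialE (has_cpartialM dl (has_cpartial_gaussian j z))).
by ring.
Qed.

Lemma csymbol_kinetic : csymbol kinetic_symbol.
Proof.
apply: csymbolM; first exact: csymbol_cst.
apply: csymbol_sum => j; apply: csymbolD; first exact: csymbol_cst.
by apply: csymbolM; apply: csymbolM; exact: csymbol_cst || exact: csymbol_local_momentum.
Qed.

(** At x = q + p the local momentum is p + i Gamma p, so half the sum of the squares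
    of its components has imaginary part p . Gamma p. *)
Lemma Im_kinetic_symbol z : complex.Im (kinetic_symbol z (z.1 + z.2)) = quad Gamma z.2.
Proof.
rewrite /kinetic_symbol Im_mulc /= mul0r addr0.
have Im_sum (I : Type) (s : seq I) (F : I -> R[i]) :
    complex.Im (\sum_(i <- s) F i) = \sum_(i <- s) complex.Im (F i).
  elim: s => [|i s ih]; first by rewrite !big_nil.
  by rewrite !big_cons -ih; case: (F i) (\sum_(_ <- _) _) => ? ? [].
rewrite Im_sum mulr_sumr quadE; apply: eq_bigr => j _.
have E : z.1 + z.2 - z.1 = z.2 by rewrite addrC addKr.
rewrite /local_momentum /i_over_eps E /=.
by field; rewrite gt_eqF.
Qed.

(** For T and H the multiplier is nonzero at x = q + p if p is nonzero, since its
    imaginary part is positive there and a real potential does not change it.  For V the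
    multiplier is V, which is not zero because the operator is not. *)
Lemma observable_symbol A : continuous V ->
  (exists2 C : R, 0 <= C & forall x, `|V x| <= C * weight x ^+ 2) ->
  observable eps V A -> nonzero_operator A ->
  exists M, [/\ csymbol M, forall z x, A (g z) x = M z x * g z x &
    forall z, z.2 != 0 -> exists x, M z x != 0].
Proof.
move=> cV [C C0 VC] obs; have sV := symbol_position cV C0 VC.
have Vcase z : z.2 != 0 -> 0 < quad Gamma z.2 by exact: Gamma_posdef.
case: obs => [|j n|j n|||] Aneq0.
- exists (fun _ _ => 1); split; first exact: csymbol_cst.
    by move=> z x; rewrite mul1r.
  by move=> z _; exists 0; exact: oner_neq0.
- exists (fun _ x => ('X^n : {poly R[i]}).[(x ord0 j)%:C]); split.
  + by apply: csymbol_poly; apply: csymbol_real; exact: symbol_coord.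
  + move=> z x; rewrite hornerXn; elim: n {Aneq0} => [|n ih]; first by rewrite mul1r.
    by rewrite iterS /qhat ih exprS mulrA.
  + move=> z _; exists (delta_mx ord0 j); rewrite !mxE !eqxx hornerXn expr1n.
    exact: oner_neq0.
- exists (fun z x => (momentum_poly j n).[local_momentum j z x]); split.
  + by apply: csymbol_poly; exact: csymbol_local_momentum.
  + by move=> z x; rewrite iter_phat_gaussian.
  + by move=> z _; exact: momentum_poly_neq0.
- exists kinetic_symbol; split; first exact: csymbol_kinetic.
    by move=> z x; rewrite kinetic_gaussian.
  move=> z z0; exists (z.1 + z.2); apply: contraTneq (Vcase z z0) => /(congr1 (@complex.Im R)).
  by rewrite Im_kinetic_symbol => ->; rewrite ltxx.
- exists (fun _ x => (V x)%:C); split; first exact: csymbol_real.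
    by [].
  move=> z _; apply: contrapT => /forallNP V0; case: Aneq0 => psi _; apply.
  apply/funext => x; rewrite /potential.
  by have /negP := V0 x; rewrite negbK => /eqP ->; rewrite mul0r.
- exists (fun z x => kinetic_symbol z x + (V x)%:C); split.
  + by apply: csymbolD; [exact: csymbol_kinetic|exact: csymbol_real].
  + by move=> z x; rewrite /hamiltonian kinetic_gaussian /potential mulrDl.
  move=> z z0; exists (z.1 + z.2); apply: contraTneq (Vcase z z0) => /(congr1 (@complex.Im R)).
  case: (kinetic_symbol _ _) (Im_kinetic_symbol z) => a b /= ->.
  by rewrite addr0 => ->; rewrite ltxx.
Qed.

End observables_on_gaussians.

(** * Growth of the matrix elements of an observable *)

Section product_measures.
Context {d1 d2 : measure_display} {T1 : measurableType d1} {T2 : measurableType d2}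
  {R : realType}.
Variables (m1 : {sigma_finite_measure set T1 -> \bar R})
  (m2 : {sigma_finite_measure set T2 -> \bar R}).

Lemma integrable_prodR (f : T1 -> R) (h : T2 -> R) :
  m1.-integrable setT (EFin \o f) -> m2.-integrable setT (EFin \o h) ->
  (m1 \x m2)%E.-integrable setT (EFin \o (fun w => f w.1 * h w.2)).
Proof.
move=> fi hi; have mf := measurable_integrand fi; have mh := measurable_integrand hi.
have mfh : measurable_fun setT (fun w : T1 * T2 => f w.1 * h w.2).
  by apply: measurable_funM;
    [exact: (measurableT_comp mf measurable_fst)|exact: (measurableT_comp mh measurable_snd)].
apply/integrableP; split; first exact/measurable_EFinP.
rewrite fubini_tonelli1//; last first.
  by apply: measurableT_comp => //; exact/measurable_EFinP.
have [_ foo] := integrableP _ _ _ fi; have [_ hoo] := integrableP _ _ _ hi.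
set c := (\int[m2]_x `|(EFin \o h) x|)%E in hoo.
have cE : c = (fine c)%:E by rewrite fineK// ge0_fin_numE// integral_ge0.
have E x : fubini_F m2 (fun w => `|(f w.1 * h w.2)%:E|)%E x = ((fine c)%:E * `|f x|%:E)%E.
  rewrite muleC /fubini_F -cE /c -ge0_integralZl_EFin//.
  - by apply: eq_integral => y _ /=; rewrite normrM EFinM.
  - by apply/measurable_EFinP; exact: measurableT_comp.
rewrite (eq_integral (fun x => ((fine c)%:E * `|f x|%:E)%E)); last first.
  by move=> x _; exact: E.
rewrite ge0_integralZl_EFin//; last 2 first.
- by apply/measurable_EFinP; exact: measurableT_comp.
- by rewrite fine_ge0// integral_ge0.
by rewrite lte_mul_pinfty// ?lee_fin ?fine_ge0// integral_ge0.
Qed.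

(** The sections are taken at fixed second variable because the observable acts on
    the packet sitting there: the other packet is then varied against a fixed
    function. *)
Lemma null_ysection (A : set (T1 * T2)) : measurable A ->
  {ae m2, forall y, m1 [set x | A (x, y)] = 0%E} -> (m1 \x m2)%E A = 0%E.
Proof.
move=> mA A0.
have mi : measurable_fun setT (fun w : T1 * T2 => (\1_A w : R)%:E).
  by apply/measurable_EFinP; exact: measurable_indic.
have -> : (m1 \x m2)%E A = (\int[m1 \x m2]_w (\1_A w)%:E)%E.
  by rewrite integral_indic// setIT.
rewrite fubini_tonelli2//.
transitivity (\int[m2]_y (cst 0%E y))%E; last exact: integral0.
apply: ae_eq_integral => //.
  by apply: measurable_fun_fubini_tonelli_G => // w; rewrite lee_fin.
move: A0; apply: filterS => y A0 _; rewrite /fubini_G /=.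
have mAy : measurable [set x | A (x, y)].
  have := measurable_ysection y mA; congr measurable.
  by apply/seteqP; split=> x; rewrite /ysection/= inE.
rewrite (eq_integral (fun x => (\1_[set x | A (x, y)] x : R)%:E)); last first.
  by move=> x _; rewrite !indicE; congr ((nat_of_bool _)%:R%:E); apply/idP/idP; rewrite !inE.
by rewrite integral_indic// setIT.
Qed.

End product_measures.

Section observable_packets.
Local Open Scope complex_scope.
Context {R : realType} {D : nat}.
Variables (eps : R) (Gamma : 'M[R]_D).
Hypotheses (eps_gt0 : 0 < eps) (Gamma_posdef : posdefmx Gamma).
Local Notation phase_space := ('rV[R]_D * 'rV[R]_D)%type.
Local Notation mu := (@lebesgue_rV R D).
Local Notation g := (gaussian eps Gamma).
Variables (A : operator R D) (M : phase_space -> 'rV[R]_D -> R[i]).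
Hypotheses (sM : csymbol M) (AM : forall z x, A (g z) x = M z x * g z x).

Definition phase_weight (z : phase_space) : R := weight z.1 * weight z.2.

Lemma phase_weight_ge1 z : 1 <= phase_weight z.
Proof. by rewrite mulr_ege1 ?weight_ge1. Qed.

Lemma phase_weight_gt0 z : 0 < phase_weight z.
Proof. exact: lt_le_trans (phase_weight_ge1 z). Qed.

Lemma observable_gaussianE z : A (g z) = fun x => M z x * g z x.
Proof. by apply/funext => x. Qed.

Lemma gaussian_neq0 z x : g z x != 0.
Proof.
rewrite gaussianE eq_complex/= -(negbK (_ && _)) negbK.
have c0 : amplitude eps Gamma * profile eps Gamma (x - z.1) != 0.
  by rewrite mulf_neq0// gt_eqF ?expR_gt0 ?amplitude_gt0.
rewrite !mulrI_eq0; try exact/mulfI.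
apply/negP => /andP[/eqP c /eqP s]; have := cos2Dsin2 (phase (centered eps z.1) z.2 x).
by rewrite c s expr0n/= addr0 => /esym/eqP; rewrite oner_eq0.
Qed.

Lemma normc_gaussian z x :
  Normc.normc (g z x) = amplitude eps Gamma * profile eps Gamma (x - z.1).
Proof.
have a0 : 0 <= amplitude eps Gamma * profile eps Gamma (x - z.1).
  by rewrite mulr_ge0 ?profile_ge0// ltW// amplitude_gt0.
apply/eqP; rewrite -(eqrXn2 (n := 2))// ?normc_ge0// normc_sqr gaussianE/=.
by rewrite !exprMn -mulrDr cos2Dsin2 mulr1.
Qed.

Lemma continuous_gaussian z : continuous (fun x => complex.Re (g z x)) /\
  continuous (fun x => complex.Im (g z x)).
Proof.
have ct : continuous (phase (centered eps z.1) z.2) by exact: continuous_phase.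
split; under eq_fun do rewrite gaussianE/=.
  apply: (@continuous_windowed _ _ eps Gamma z.1 (fun x => cos (phase (centered eps z.1) z.2 x))).
  exact: continuous_compR (@continuous_cos R).
apply: (@continuous_windowed _ _ eps Gamma z.1 (fun x => sin (phase (centered eps z.1) z.2 x))).
exact: continuous_compR (@continuous_sin R).
Qed.

(** The decay of the Gaussian absorbs the growth of M z x in x; moving the
    weight from x to x - z.1 costs powers of the weight of z only. *)
Lemma packet_bound : exists2 K : R, 0 <= K & exists m, forall z x,
  Normc.normc (M z x * g z x) * weight x <= K * phase_weight z ^+ m.
Proof.
have [[_ _ [C1 [n1 [C10 b1]]]] [_ _ [C2 [n2 [C20 b2]]]]] := sM.
pose N := (n1 + n2)%N.
have [Kp KpP] := profile_bound eps_gt0 Gamma_posdef N.+1 (lexx 0).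
have Kp0 : 0 <= Kp.
  apply: le_trans (KpP 0); rewrite !mulr_ge0 ?expR_ge0 ?profile_ge0//.
  by rewrite exprn_ge0// ltW// weight_gt0.
have a0 : 0 <= amplitude eps Gamma by rewrite ltW// amplitude_gt0.
have w0 (y : 'rV[R]_D) : 0 <= weight y by rewrite ltW// weight_gt0.
have B1 (z : phase_space) (x : 'rV[R]_D) : 1 <= weight z.1 * weight z.2 * weight x.
  by rewrite !mulr_ege1 ?weight_ge1.
have Mb z x : Normc.normc (M z x) <= (C1 + C2) * (phase_weight z * weight x) ^+ N.
  apply: le_trans (normc_le_ReIm _) _; rewrite mulrDl lerD//.
    apply: le_trans (b1 z x) _; rewrite ler_wpM2l// ler_weXn2l//.
    exact: leq_addr.
  apply: le_trans (b2 z x) _; rewrite ler_wpM2l// ler_weXn2l//.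
  exact: leq_addl.
exists ((C1 + C2) * amplitude eps Gamma * Kp * (2 ^+ D) ^+ N.+1).
  by rewrite !mulr_ge0 ?addr_ge0 ?exprn_ge0.
exists (N + N.+1)%N => z x; rewrite Normc.normcM normc_gaussian.
set p := profile _ _ _; have p0 : 0 <= p by exact: profile_ge0.
have w20 : 0 <= phase_weight z by rewrite ltW// phase_weight_gt0.
apply: le_trans (_ : (C1 + C2) * (phase_weight z * weight x) ^+ N * (amplitude eps Gamma * p) * weight x <= _).
  by rewrite ler_wpM2r// ler_wpM2r// mulr_ge0.
have h1 : weight x ^+ N.+1 <= (2 ^+ D) ^+ N.+1 * phase_weight z ^+ N.+1 * weight (x - z.1) ^+ N.+1.
  rewrite -!exprMn lerXn2r ?nnegrE ?mulr_ge0 ?exprn_ge0//.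
  apply: le_trans (weight_peetre x z.1) _; rewrite -mulrA ler_wpM2l ?exprn_ge0//.
  by rewrite ler_wpM2r// /phase_weight ler_peMr ?weight_ge1.
have h2 : p * weight (x - z.1) ^+ N.+1 <= Kp.
  by have := KpP (x - z.1); rewrite mul0r expR0 mul1r.
rewrite [leLHS](_ : _ = (C1 + C2) * amplitude eps Gamma * phase_weight z ^+ N * (p * weight x ^+ N.+1)); last first.
  by rewrite exprMn exprSr; move: (phase_weight z ^+ N) (weight x ^+ N) => u v; ring.
apply: le_trans (_ : (C1 + C2) * amplitude eps Gamma * phase_weight z ^+ N *
   (p * ((2 ^+ D) ^+ N.+1 * phase_weight z ^+ N.+1 * weight (x - z.1) ^+ N.+1)) <= _).
  rewrite ler_wpM2l ?mulr_ge0 ?addr_ge0 ?exprn_ge0//.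
  by rewrite ler_wpM2l.
rewrite [leLHS](_ : _ = (C1 + C2) * amplitude eps Gamma * (2 ^+ D) ^+ N.+1 *
  phase_weight z ^+ (N + N.+1) * (p * weight (x - z.1) ^+ N.+1)); last first.
  rewrite exprD; move: (phase_weight z ^+ N) (phase_weight z ^+ N.+1) ((2 ^+ D) ^+ N.+1)
    (weight (x - z.1) ^+ N.+1) => u v w t; ring.
rewrite [leRHS](_ : _ = (C1 + C2) * amplitude eps Gamma * (2 ^+ D) ^+ N.+1 *
  phase_weight z ^+ (N + N.+1) * Kp); last first.
  move: (phase_weight z ^+ (N + N.+1)) ((2 ^+ D) ^+ N.+1) => u v; ring.
by rewrite ler_wpM2l ?mulr_ge0 ?addr_ge0 ?exprn_ge0.
Qed.

Lemma ctemperate_packet z : ctemperate (A (g z)).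
Proof.
have [[_ c1 _] [_ c2 _]] := sM; have [c3 c4] := continuous_gaussian z.
have [K K0 [m KP]] := packet_bound.
have b f : (forall x, `|f x| <= Normc.normc (M z x * g z x)) ->
    exists C n, 0 <= C /\ forall x : 'rV[R]_D, `|f x| <= C * weight x ^+ n.
  move=> fb; exists (K * phase_weight z ^+ m), 0%N; split.
    by rewrite mulr_ge0// exprn_ge0// ltW// phase_weight_gt0.
  move=> x; rewrite expr0 mulr1; apply: le_trans (KP z x).
  by apply: le_trans (fb x) _; rewrite ler_peMr ?normc_ge0 ?weight_ge1.
rewrite observable_gaussianE; split; split.
- under eq_fun do rewrite Re_mulc.
  apply: continuous_addR; first exact: continuous_mulR.
  have := continuous_mulR (@continuous_cstR R _ (-1)) (continuous_mulR (c2 z) c4).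
  by under eq_fun do rewrite mulN1r.
- by apply: b => x; exact: normr_Re_le.
- under eq_fun do rewrite Im_mulc.
  by apply: continuous_addR; exact: continuous_mulR.
- by apply: b => x; exact: normr_Im_le.
Qed.

Lemma profile_le1 u : profile eps Gamma u <= 1.
Proof.
have [c c0 cq] := coercive_quad Gamma_posdef.
rewrite -expR0 ler_expR mulNr oppr_le0 mulr_ge0 ?invr_ge0 ?mulr_ge0 ?(ltW eps_gt0)//.
by apply: le_trans (cq u); rewrite mulr_ge0 ?sqr_ge0// ltW.
Qed.

(** The modulus of g_y is bounded independently of y, so the bound depends on z
    only. *)
Lemma O_0_bound : exists2 K : R, 0 <= K & exists m, forall w,
  Normc.normc (O_0 eps Gamma A w) <= K * phase_weight w.2 ^+ m.
Proof.
have [K K0 [m KP]] := packet_bound.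
have a0 : 0 <= amplitude eps Gamma by rewrite ltW// amplitude_gt0.
pose I := \int[mu]_x (weight (x : 'rV[R]_D))^-1.
have I0 : 0 <= I by apply: Rintegral_ge0 => x _; rewrite invr_ge0 ltW// weight_gt0.
exists (2 * (2 * amplitude eps Gamma * K * I)).
  by rewrite mulr_ge0// !mulr_ge0.
exists m => -[y z].
change (Normc.normc (inner (g y) (A (g z))) <=
  2 * (2 * amplitude eps Gamma * K * I) * phase_weight z ^+ m).
have w0 (x : 'rV[R]_D) : 0 <= weight x by rewrite ltW// weight_gt0.
have [t1 t2] := ctemperate_packet z.
have wb f : (forall x, `|f x| <= Normc.normc (M z x * g z x)) -> forall x,
    `|windowed eps Gamma y.1 f x| * weight x <= amplitude eps Gamma * K * phase_weight z ^+ m.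
  move=> fb x; rewrite /windowed !normrM (ger0_norm a0) (ger0_norm (profile_ge0 _ _ _)).
  rewrite -!mulrA ler_wpM2l//; apply: le_trans (KP z x).
  apply: le_trans (_ : 1 * (Normc.normc (M z x * g z x) * weight x) <= _); last by rewrite mul1r.
  apply: ler_pM; rewrite ?profile_ge0 ?mulr_ge0 ?profile_le1//.
  by rewrite ler_wpM2r.
have b1 := wb _ (fun x => normr_Re_le (M z x * g z x)).
have b2 := wb _ (fun x => normr_Im_le (M z x * g z x)).
have i1 := integrable_windowed eps_gt0 Gamma_posdef y.1 t1.
have i2 := integrable_windowed eps_gt0 Gamma_posdef y.1 t2.
have bound f1 f2 : mu.-integrable setT (EFin \o f1) -> mu.-integrable setT (EFin \o f2) ->
  (forall x, `|f1 x| * weight x <= amplitude eps Gamma * K * phase_weight z ^+ m) ->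
  (forall x, `|f2 x| * weight x <= amplitude eps Gamma * K * phase_weight z ^+ m) ->
  `|\int[mu]_x (cos (phase (centered eps y.1) y.2 x) * f1 x +
                sin (phase (centered eps y.1) y.2 x) * f2 x)| <=
  2 * amplitude eps Gamma * K * phase_weight z ^+ m * I.
  move=> if1 if2 f1b f2b; apply: normr_Rintegral_weight_bound.
    apply: measurable_integrand; apply: integrable_addR.
      exact: integrable_trigM (@continuous_cos R) (@cos_max R) if1.
    exact: integrable_trigM (@continuous_sin R) (@sin_max R) if2.
  move=> x; have [tb _] := trig_mix_le (phase (centered eps y.1) y.2 x) (f1 x) (f2 x).
  apply: le_trans (ler_wpM2r (w0 x) tb) _; rewrite mulrDl.
  by apply: le_trans (lerD (f1b x) (f2b x)) _; rewrite le_eqVlt; apply/orP; left; apply/eqP; ring.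
apply: le_trans (normc_le_ReIm _) _; rewrite inner_gaussianE/=.
rewrite (_ : 2 * _ * _ = 2 * amplitude eps Gamma * K * phase_weight z ^+ m * I +
   2 * amplitude eps Gamma * K * phase_weight z ^+ m * I); last ring.
rewrite observable_gaussianE in i1 i2 *; apply: lerD; apply: bound => //.
  apply: integrable_leR (integrable_norm i1) => [|x /=]; last by rewrite normrN.
  exact: measurable_funN (measurable_integrand i1).
by move=> x; rewrite normrN.
Qed.

End observable_packets.

(** * Integrability and zero set of the sampling integrand *)

Section sampling_integrand.
Local Open Scope complex_scope.
Context {R : realType} {D : nat}.
Variables (eps : R) (Gamma : 'M[R]_D).
Hypotheses (D_ge1 : (1 <= D)%N) (eps_gt0 : 0 < eps) (Gamma_sym : Gamma^T = Gamma)
  (Gamma_posdef : posdefmx Gamma).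
Local Notation phase_space := ('rV[R]_D * 'rV[R]_D)%type.
Local Notation mu := (@lebesgue_rV R D).
Local Notation g := (gaussian eps Gamma).
Variables (psi0 : 'rV[R]_D -> R[i]) (A : operator R D)
  (M : phase_space -> 'rV[R]_D -> R[i]).
Hypotheses (psi0_schwartz : schwartz psi0) (psi0_norm1 : L2norm psi0 = 1%E)
  (sM : csymbol M) (AM : forall z x, A (g z) x = M z x * g z x)
  (M_neq0 : forall z, z.2 != 0 -> exists x, M z x != 0).
Local Notation F := (fun z => inner (g z) psi0).
Local Notation h := (fun w => f_0 eps Gamma psi0 w * O_0 eps Gamma A w).
Local Notation c0 := ((2 * pi * eps) ^- (2 * D) : R).

Lemma inner_gaussianC z : inner psi0 (g z) = (F z)^*.
Proof.
have [t1 t2] := schwartz_ctemperate psi0_schwartz.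
have i1 := integrable_windowed eps_gt0 Gamma_posdef z.1 t1.
have i2 := integrable_windowed eps_gt0 Gamma_posdef z.1 t2.
rewrite inner_gaussianE /inner /cintegral; congr Complex.
  apply: eq_Rintegral => x _; rewrite gaussianE /windowed Re_mulc.
  by case: (psi0 x) => a b /=; ring.
rewrite -[RHS]mulN1r -RintegralZl//; last first.
  apply: integrable_addR; first exact: integrable_trigM (@continuous_cos R) (@cos_max R) i2.
  apply: integrable_trigM (@continuous_sin R) (@sin_max R) _.
  apply: integrable_leR (integrable_norm i1) => [|x /=]; last by rewrite normrN.
  exact: measurable_funN (measurable_integrand i1).
apply: eq_Rintegral => x _; rewrite gaussianE /windowed Im_mulc.
by case: (psi0 x) => a b /=; ring.
Qed.

Lemma f_0E w : f_0 eps Gamma psi0 w = c0%:C * ((F w.1)^* * F w.2).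
Proof. by rewrite /f_0 inner_gaussianC. Qed.

Lemma c0_gt0 : 0 < c0.
Proof. by rewrite invr_gt0 exprn_gt0// !mulr_gt0// pi_gt0. Qed.

Lemma measurable_O_0 :
  measurable_fun setT (fun w => complex.Re (O_0 eps Gamma A w)) /\
  measurable_fun setT (fun w => complex.Im (O_0 eps Gamma A w)).
Proof.
have [[mR _ _] [mI _ _]] := sM.
pose zx (w : (phase_space * phase_space) * 'rV[R]_D) := (w.1.2, w.2).
have mzx : measurable_fun setT zx.
  apply: measurable_fun_pair; last exact: measurable_snd.
  by apply: (measurableT_comp measurable_snd); exact: measurable_fst.
have mg (t : R -> R) : continuous t -> measurable_fun setT (fun w : phase_space * 'rV[R]_D =>
    amplitude eps Gamma * profile eps Gamma (w.2 - w.1.1) *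
    t (phase (centered eps w.1.1) w.1.2 w.2)).
  move=> ct.
  have := @measurable_windowed R D eps Gamma _ phase_space id (@measurable_id _ _ _)
    (fun w : phase_space * 'rV[R]_D => t (phase (centered eps w.1.1) w.1.2 w.2)).
  apply; apply: (measurableT_comp (continuous_measurable_fun ct)).
  exact: measurable_theta (@measurable_id _ _ _).
have m1 : measurable_fun setT (fun w => complex.Re (M (zx w).1 (zx w).2 * g (zx w).1 (zx w).2)).
  apply: (measurableT_comp (f := fun w => complex.Re (M w.1 w.2 * g w.1 w.2)) _ mzx).
  under eq_fun do rewrite Re_mulc gaussianE/=.
  by apply: measurable_funB; apply: measurable_funM => //; apply: mg;
    [exact: continuous_cos|exact: continuous_sin].
have m2 : measurable_fun setT (fun w => complex.Im (M (zx w).1 (zx w).2 * g (zx w).1 (zx w).2)).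
  apply: (measurableT_comp (f := fun w => complex.Im (M w.1 w.2 * g w.1 w.2)) _ mzx).
  under eq_fun do rewrite Im_mulc gaussianE/=.
  by apply: measurable_funD; apply: measurable_funM => //; apply: mg;
    [exact: continuous_sin|exact: continuous_cos].
have E w : O_0 eps Gamma A w = inner (g w.1) (fun x =>
    Complex (complex.Re (M w.2 x * g w.2 x)) (complex.Im (M w.2 x * g w.2 x))).
  by congr (inner _ _); apply/funext => x; rewrite AM; case: (_ * _).
have [H1 H2] := @measurable_inner_gaussian R D eps Gamma _ (phase_space * phase_space)%type
  fst _ _ measurable_fst m1 m2.
by split; under eq_fun do rewrite E; [exact: H1|exact: H2].
Qed.

Lemma measurable_f_0 :
  measurable_fun setT (fun w => complex.Re (f_0 eps Gamma psi0 w)) /\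
  measurable_fun setT (fun w => complex.Im (f_0 eps Gamma psi0 w)).
Proof.
have [mR mI] := @measurable_inner_fixed R D eps Gamma _ (schwartz_ctemperate psi0_schwartz).
have R1 : measurable_fun setT (fun w : phase_space * phase_space => complex.Re (F w.1)).
  exact: (measurableT_comp mR measurable_fst).
have R2 : measurable_fun setT (fun w : phase_space * phase_space => complex.Re (F w.2)).
  exact: (measurableT_comp mR measurable_snd).
have I1 : measurable_fun setT (fun w : phase_space * phase_space => complex.Im (F w.1)).
  exact: (measurableT_comp mI measurable_fst).
have I2 : measurable_fun setT (fun w : phase_space * phase_space => complex.Im (F w.2)).
  exact: (measurableT_comp mI measurable_snd).
split.
  rewrite (_ : (fun w => _) = fun w => c0 * (complex.Re (F w.1) * complex.Re (F w.2) +
     complex.Im (F w.1) * complex.Im (F w.2))); last first.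
    apply/funext => w; rewrite f_0E.
    by case: (F w.1) (F w.2) => a b [c e] /=; ring.
  exact: (measurable_funM (measurable_cst c0)
    (measurable_funD (measurable_funM R1 R2) (measurable_funM I1 I2))).
rewrite (_ : (fun w => _) = fun w => c0 * (complex.Re (F w.1) * complex.Im (F w.2) -
   complex.Im (F w.1) * complex.Re (F w.2))); last first.
  apply/funext => w; rewrite f_0E.
  by case: (F w.1) (F w.2) => a b [c e] /=; ring.
exact: (measurable_funM (measurable_cst c0)
  (measurable_funB (measurable_funM R1 I2) (measurable_funM I1 R2))).
Qed.

Lemma measurable_sampling_integrand : measurable_fun setT (fun w => complex.Re (h w)) /\
  measurable_fun setT (fun w => complex.Im (h w)).
Proof.
have [fR fI] := measurable_f_0; have [oR oI] := measurable_O_0.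
split; under eq_fun do rewrite ?Re_mulc ?Im_mulc.
  exact: (measurable_funB (measurable_funM fR oR) (measurable_funM fI oI)).
exact: (measurable_funD (measurable_funM fR oI) (measurable_funM fI oR)).
Qed.

Lemma normc_conj (z : R[i]) : Normc.normc z^* = Normc.normc z.
Proof. by case: z => a b /=; rewrite sqrrN. Qed.

Lemma integrable_phase_weightV : (@lebesgue_2D R D).-integrable setT
  (EFin \o (fun z => (phase_weight z)^-1)).
Proof.
have := integrable_prodR (@integrable_weightV R D) (@integrable_weightV R D).
by congr (is_true (_.-integrable _ _)); apply/funext => z; rewrite /phase_weight/= invfM.
Qed.

Lemma measurable_normc_sampling_integrand : measurable_fun setT (fun w => Normc.normc (h w)).
Proof.
have [mR mI] := measurable_sampling_integrand.
rewrite (_ : (fun w => _) = (fun w => Num.sqrt (complex.Re (h w) ^+ 2 + complex.Im (h w) ^+ 2))).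
  apply: (measurableT_comp (f := @Num.sqrt R)).
    by apply: continuous_measurable_fun; exact: sqrt_continuous.
  by apply: measurable_funD; exact: measurable_funX.
by apply/funext => w; case: (h w).
Qed.

(** The growth of O_0 in z is of some order m; the decay of <g_z, psi0> of order
    m + 1 absorbs it and leaves one inverse weight, and <g_y, psi0> provides the
    one in y. *)
Lemma integrable_sampling_integrand : (@lebesgue_4D R D).-integrable setT
  (EFin \o (fun w => Normc.normc (h w))).
Proof.
have [K K0 [m KP]] := O_0_bound eps_gt0 Gamma_posdef sM AM.
have [C1 C10 b1] := inner_schwartz_rapid eps_gt0 Gamma_sym Gamma_posdef 1 psi0_schwartz.
have [C2 C20 b2] := inner_schwartz_rapid eps_gt0 Gamma_sym Gamma_posdef m.+1 psi0_schwartz.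
have i4 : (@lebesgue_4D R D).-integrable setT
    (EFin \o (fun w => (phase_weight w.1)^-1 * (phase_weight w.2)^-1)).
  exact: integrable_prodR integrable_phase_weightV integrable_phase_weightV.
apply: integrable_leR (integrable_scaleR (c0 * C1 * (C2 * K)) i4).
  exact: measurable_normc_sampling_integrand.
move=> w; rewrite ger0_norm ?normc_ge0// Normc.normcM f_0E !Normc.normcM normc_conj.
rewrite (_ : Normc.normc c0%:C = c0); last first.
  by rewrite /= expr0n/= addr0 sqrtr_sqr gtr0_norm// c0_gt0.
have w1 := phase_weight_gt0 w.1; have w2 := phase_weight_gt0 w.2.
have h1 : Normc.normc (F w.1) <= C1 / phase_weight w.1.
  by rewrite ler_pdivlMr//; have := b1 w.1; rewrite expr1.
have h2 : Normc.normc (F w.2) * Normc.normc (O_0 eps Gamma A w) <= C2 * K / phase_weight w.2.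
  apply: le_trans (ler_wpM2l (normc_ge0 _) (KP w)) _.
  rewrite ler_pdivlMr// [leLHS](_ : _ = Normc.normc (F w.2) * phase_weight w.2 ^+ m.+1 * K).
    by rewrite ler_wpM2r//; exact: b2.
  by rewrite exprSr; ring.
rewrite -!mulrA ler_wpM2l//; first by have := ltW c0_gt0; rewrite /c0 -mulrA.
apply: le_trans (ler_pM (normc_ge0 _) _ h1 h2) _.
  by rewrite mulr_ge0 ?normc_ge0.
by rewrite le_eqVlt; apply/orP; left; apply/eqP; ring.
Qed.

Lemma lebesgue_rV_origin : mu [set p : 'rV[R]_D | p = 0] = 0%E.
Proof.
transitivity (mu [set x : 'rV[R]_D | forall i, [set 0] (x ord0 i)]).
  congr (mu _); apply/seteqP; split=> x /=.
    by move=> xE i; rewrite xE /= mxE.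
  by move=> x0; apply/rowP => i; rewrite mxE; exact: x0.
rewrite (lebesgue_rV_box (E := fun=> [set 0]) (fun=> measurable_set1 0)).
by rewrite (bigD1 (Ordinal D_ge1))//= lebesgue_measure_set1 mul0e.
Qed.

Lemma zero_momentum_null : @lebesgue_2D R D [set z | z.2 = 0] = 0%E.
Proof.
transitivity (\int[mu]_q (cst 0%E q : \bar R))%E; last exact: integral0.
apply: eq_integral => q _ /=; rewrite -[RHS]lebesgue_rV_origin; congr (mu _).
by apply/seteqP; split=> p; rewrite /xsection/= inE.
Qed.

(** For almost every z, both the momentum and <g_z, psi0> are nonzero.  For such z,
    f_0 O_0 vanishes only if <g_y, psi0> or <g_y, A g_z> does, which happens
    for y in a null set. *)
Lemma sampling_integrand_null : @lebesgue_4D R D [set w | h w = 0] = 0%E.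
Proof.
have [mR mI] := measurable_sampling_integrand.
have [x0 psi0x0] := L2norm_neq0 psi0_norm1.
have tpsi := schwartz_ctemperate psi0_schwartz.
have [mFR mFI] := @measurable_inner_fixed R D eps Gamma _ tpsi.
have NF := inner_gaussian_null eps_gt0 Gamma_posdef tpsi psi0x0.
have mF : measurable [set z | F z = 0] by exact: measurable_cset0.
have m0 : measurable [set z : phase_space | z.2 = 0].
  rewrite (_ : [set z | _] = snd @^-1` [set p : 'rV[R]_D | p = 0]) //.
  rewrite -[X in measurable X]setTI; apply: (measurable_snd measurableT).
  rewrite (_ : [set p : 'rV[R]_D | p = 0] = \bigcap_(i in setT)
      ((fun p : 'rV[R]_D => p ord0 i) @^-1` [set 0])).
    apply: fin_bigcap_measurable => // i _.
    rewrite -[X in measurable X]setTI; exact: (measurable_coord i).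
  apply/seteqP; split=> p /=; first by move=> -> i _; rewrite /= mxE.
  by move=> p0; apply/rowP => i; rewrite mxE; exact: p0.
apply: null_ysection; first exact: measurable_cset0.
exists ([set z | z.2 = 0] `|` [set z | F z = 0]); split.
- exact: measurableU.
- apply/eqP; rewrite -measure_le0.
  by apply: (le_trans (measureU2 (@lebesgue_2D R D) m0 mF));
    rewrite -[leRHS]adde0; apply: leeD; rewrite le_eqVlt; apply/orP; left;
    apply/eqP; [exact: zero_momentum_null|exact: NF].
move=> z /= hz; apply: contrapT => /not_orP[/eqP z0 Fz]; apply: hz.
have [x1 Mx1] := M_neq0 z0.
have Ax1 : A (g z) x1 != 0 by rewrite AM mulf_neq0// gaussian_neq0.
have tA := ctemperate_packet eps_gt0 Gamma_posdef sM AM z.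
have NO := inner_gaussian_null eps_gt0 Gamma_posdef tA Ax1.
have [mOR mOI] := @measurable_inner_fixed R D eps Gamma _ tA.
have mO : measurable [set y | inner (g y) (A (g z)) = 0] by exact: measurable_cset0.
have mhz : measurable [set y | h (y, z) = 0].
  by apply: measurable_cset0;
    [exact: (measurable_fun_pair1 z mR)|exact: (measurable_fun_pair1 z mI)].
apply/eqP; rewrite -measure_le0.
apply: (@le_trans _ _ (@lebesgue_2D R D ([set y | F y = 0] `|` [set y | inner (g y) (A (g z)) = 0]))).
  apply: le_measure; rewrite ?inE//; first exact: measurableU.
  move=> y /= /eqP; rewrite f_0E !mulf_eq0 /= => /orP[/orP[|/orP[]]|].
  - by rewrite eq_complex/= gt_eqF ?c0_gt0.
  - by rewrite conjc_eq0 => /eqP; left.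
  - by move/eqP.
  - by move/eqP; right.
by apply: (le_trans (measureU2 (@lebesgue_2D R D) mF mO)); rewrite -[leRHS]adde0; apply: leeD;
  rewrite le_eqVlt; apply/orP; left; apply/eqP; [exact: NF|exact: NO].
Qed.

Lemma lebesgue_4D_gt0 : (0 < @lebesgue_4D R D setT)%E.
Proof.
pose B : set 'rV[R]_D := [set x | forall i, `[0, 1]%classic (x ord0 i)].
have mB : measurable B.
  have -> : B = \bigcap_(i in setT) (fun v : 'rV[R]_D => v ord0 i) @^-1` `[0, 1]%classic.
    by apply/seteqP; split=> v /= vE i *; exact: vE.
  apply: fin_bigcap_measurable => // i _.
  rewrite -[X in measurable X]setTI; exact: (measurable_coord i).
have muB : mu B = 1%E.
  rewrite (lebesgue_rV_box (E := fun=> `[0, 1]%classic))//.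
  by rewrite big1// => i _; rewrite lebesgue_measure_itv/= lte_fin ltr01 sube0.
have m2 : @lebesgue_2D R D (B `*` B) = 1%E.
  by rewrite /lebesgue_2D product_measure1E// [X in (X * _)%E]muB mul1e.
have m4 : @lebesgue_4D R D ((B `*` B) `*` (B `*` B)) = 1%E.
  rewrite /lebesgue_4D product_measure1E ?[X in (X * _)%E]m2 ?mul1e//; exact: measurableX.
apply: (@lt_le_trans _ _ 1%E) => //; rewrite -m4.
by apply: le_measure; rewrite ?inE//; apply: measurableX; exact: measurableX.
Qed.

End sampling_integrand.

(** * The optimal density *)

Theorem theorem5 (R : realType) (D : nat) (eps : R) (Gamma : 'M[R]_D)
    (V : 'rV[R]_D -> R) (psi0 : 'rV[R]_D -> R[i]) (A : operator R D)
    (D_ge1 : (1 <= D)%N) (eps_gt0 : 0 < eps)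
    (Gamma_sym : Gamma^T = Gamma) (Gamma_posdef : posdefmx Gamma)
    (V_subquadratic : subquadratic V)
    (psi0_schwartz : schwartz psi0) (psi0_norm1 : L2norm psi0 = 1%E)
    (A_observable : observable eps V A) (A_neq0 : nonzero_operator A) :
  let mu := @lebesgue_4D R D in
  let kappa := kappa_opt eps Gamma psi0 A in
  let rho_o := rho_opt eps Gamma psi0 A in
  let Var := variance_0 eps Gamma psi0 A in
  [/\ (0 < kappa < +oo)%E,
      prob_density rho_o,
      forall rho, prob_density rho -> (Var rho_o <= Var rho)%E,
      forall rho, prob_density rho -> Var rho = Var rho_o ->
        {ae mu, forall w, rho w = rho_o w} &
      Var rho_o =
        (kappa ^+ 2 - (Normc.normc (mean_0 eps Gamma psi0 A) ^+ 2)%:E)%E].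
Proof.
move=> mu kappa rho_o Var; rewrite {}/mu.
have [cV VC] := subquadratic_growth V_subquadratic.
have [M [sM AM M_neq0]] := observable_symbol eps_gt0 Gamma_sym Gamma_posdef cV VC
  A_observable A_neq0.
pose h w := f_0 eps Gamma psi0 w * O_0 eps Gamma A w.
have [mR mI] := measurable_sampling_integrand eps_gt0 Gamma_posdef psi0_schwartz sM AM.
have ih : (@lebesgue_4D R D).-integrable setT (EFin \o (fun w => Normc.normc (h w))).
  exact: (integrable_sampling_integrand eps_gt0 Gamma_sym Gamma_posdef psi0_schwartz sM AM).
have h_ae : {ae @lebesgue_4D R D, forall w, h w != 0}.
  exists [set w | h w = 0]; split.
  - exact: measurable_cset0.
  - exact: (sampling_integrand_null D_ge1 eps_gt0 Gamma_posdef psi0_schwartz psi0_norm1 sM AM M_neq0).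
  - by move=> w /= /negP; rewrite negbK => /eqP.
pose k := \int[@lebesgue_4D R D]_w Normc.normc (h w).
have kE : kappa = k%:E by rewrite EFin_Rintegral.
have mh := measurable_integrand ih.
(* If kappa were 0, the integrand would vanish almost everywhere, but it is almost
   everywhere nonzero and phase space is not a null set. *)
have k0 : 0 < k.
  rewrite lt_neqAle Rintegral_ge0 ?andbT; last by move=> w _; exact: normc_ge0.
  apply/eqP => k0.
  have : (\int[@lebesgue_4D R D]_w `|(Normc.normc (h w))%:E| = 0)%E.
    under eq_integral do rewrite gee0_abs ?lee_fin ?normc_ge0//.
    by rewrite -EFin_Rintegral// -/k -k0.
  have mE : measurable_fun setT (fun w => (Normc.normc (h w))%:E) by exact/measurable_EFinP.
  move=> /(ae_eq_integral_abs (@lebesgue_4D R D) measurableT mE) h0.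
  have : {ae @lebesgue_4D R D, forall w, False}.
    move: h_ae h0; apply: filterS2 => w hw hw0.
    have aw0 : Normc.normc (h w) = 0 by apply: EFin_inj; exact: hw0.
    by move: hw; rewrite -normc_eq0 aw0 eqxx.
  move=> [N [mN N0 NT]]; have := @lebesgue_4D_gt0 R D.
  rewrite lt_neqAle => /andP[/eqP + _]; apply; apply/esym.
  apply/eqP; rewrite -measure_le0 -[leRHS]N0 le_measure ?inE//.
  by move=> w _; apply: NT.
have rhoE w : rho_o w = k^-1 * Normc.normc (h w) by rewrite /rho_o /rho_opt -/kappa kE.
have drho : prob_density rho_o.
  split.
  - rewrite (_ : rho_o = fun w => k^-1 * Normc.normc (h w)); last exact/funext.
    exact: (measurable_funM (measurable_cst _) mh).
  - by move=> w; rewrite rhoE mulr_ge0 ?normc_ge0// invr_ge0 ltW.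
  - move: h_ae; apply: filterS => w hw.
    by rewrite rhoE mulr_gt0 ?invr_gt0// lt_neqAle eq_sym normc_eq0 hw normc_ge0.
  - under eq_integral do rewrite rhoE.
    rewrite -EFin_Rintegral; last exact: integrable_scaleR.
    by rewrite RintegralZl// -/k mulVf// gt_eqF.
have VarE rho : prob_density rho ->
    (Var rho = \int[@lebesgue_4D R D]_w ((Normc.normc (h w) - k * rho w) ^+ 2 / rho w)%:E +
     (k ^+ 2 - Normc.normc (mean_0 eps Gamma psi0 A) ^+ 2)%:E)%E.
  move=> [mr r0 r1 r2].
  exact: (@variance_decomposition _ _ _ (@lebesgue_4D R D) h mR mI ih rho mr r0 r1 r2).
have fluct0 rho : prob_density rho ->
    (\int[@lebesgue_4D R D]_w ((Normc.normc (h w) - k * rho w) ^+ 2 / rho w)%:E = 0)%E <->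
    {ae @lebesgue_4D R D, forall w, Normc.normc (h w) = k * rho w}.
  move=> [mr r0 r1 r2].
  exact: (@integral_fluct_eq0 _ _ _ (@lebesgue_4D R D) h ih rho mr r0 r1).
have Varo : Var rho_o = (k ^+ 2 - Normc.normc (mean_0 eps Gamma psi0 A) ^+ 2)%:E.
  rewrite VarE// (_ : integral _ _ _ = 0%E) ?add0e//.
  apply/(fluct0 _ drho); apply: aeW => w.
  by rewrite rhoE mulrA divff ?mul1r// gt_eqF.
have fge0 rho : prob_density rho ->
    (0 <= \int[@lebesgue_4D R D]_w ((Normc.normc (h w) - k * rho w) ^+ 2 / rho w)%:E)%E.
  move=> [_ r0 _ _]; apply: integral_ge0 => w _.
  by rewrite lee_fin divr_ge0 ?sqr_ge0.
split.
- by rewrite kE lte_fin k0 ltry.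
- exact: drho.
- by move=> rho drh; rewrite Varo VarE// leeDr// fge0.
- move=> rho drh; rewrite Varo VarE// => E.
  have /(fluct0 _ drh) : (\int[@lebesgue_4D R D]_w ((Normc.normc (h w) - k * rho w) ^+ 2 / rho w)%:E = 0)%E.
    move: E (fge0 rho drh); case: (integral _ _ _) => [r||]//=.
    rewrite -EFinD => -[E] _; congr EFin.
    by move: E => /eqP; rewrite -subr_eq0 addrK => /eqP.
  by apply: filterS => w hE; rewrite rhoE hE mulrA mulVf ?mul1r// gt_eqF.
- by rewrite Varo kE EFinB EFin_expe.
Qed.
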